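(* Let $n\geq 2$, let $\Omega\subset\mathbb{R}^n$ be a bounded and smooth convex domain, let $f\in(L^2(\Omega))^n$, and let $V\subset\Omega$ be a nonempty open set. Assume that $\mathrm{d}f|_V=0$. Then $X_1f=0$ on all lines intersecting $V$ if and only if $f=\mathrm{d}\phi$ for some $\phi\in H^1_0(\Omega)$.
   Context: One-forms are identified with vector fields; $f\in(L^2(\Omega))^n$ means $f=(f_1,\dots,f_n)$ with each $f_i\in L^2(\Omega)$. The exterior derivative of $f$ is given, in the sense of distributions, by $(\mathrm{d}f)_{ij}=\partial_i f_j-\partial_j f_i$; for a scalar $\phi$, $\mathrm{d}\phi=(\partial_1\phi,\dots,\partial_n\phi)$ (weak gradient). $\mathrm{d}f|_V=0$ means that all components $(\mathrm{d}f)_{ij}$ vanish as distributions on $V$. Let $\Gamma=\{(z,\theta):\theta\in S^{n-1},\ z\in\theta^\perp\}$ be the manifold of oriented lines, where $(z,\theta)$ represents $t\mapsto z+t\theta$, with measure $dz\,d\theta$. The X-ray transform of a smooth compactly supported one-form $f$ on $\mathbb{R}^n$ is $X_1f(z,\theta)=\int_{\mathbb{R}}f(z+t\theta)\cdot\theta\,dt$, and its adjoint, acting on $\psi\in C^\infty(\Gamma)$, is $(X_1^*\psi)_i(x)=\int_{S^{n-1}}\theta_i\,\psi(x-(x\cdot\theta)\theta,\theta)\,d\theta$. For a tuple $f=(f_1,\dots,f_n)$ of compactly supported distributions on $\mathbb{R}^n$, $X_1f\in\mathcal{E}'(\Gamma)$ (a compactly supported distribution on $\Gamma$) is defined by $\langle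 X_1f,\varphi\rangle=\langle f,X_1^*\varphi\rangle=\sum_i\langle f_i,(X_1^*\varphi)_i\rangle$ for $\varphi\in C^\infty(\Gamma)$. For $f\in(L^2(\Omega))^n$ one sets $X_1f:=X_1\widetilde f$, where $\widetilde f$ is the extension of $f$ by zero to $\mathbb{R}^n$. ''$X_1f=0$ on all lines intersecting $V$'' means that $X_1f$ vanishes as a distribution on the open subset of $\Gamma$ consisting of the lines that meet $V$, i.e. $\langle X_1f,\varphi\rangle=0$ for every $\varphi\in C_c^\infty(\Gamma)$ supported in that open subset. *)

(* Defs.v *)
From HB Require Import structures.
From mathcomp Require Import all_boot all_order all_algebra.
From mathcomp Require Import all_classical all_reals all_analysis.
From mathcomp Require Import measurable_realfun.

Set Implicit Arguments.
Unset Strict Implicit.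
Unset Printing Implicit Defensive.

Import Order.TTheory GRing.Theory Num.Theory.
Import numFieldNormedType.Exports.

Local Open Scope classical_set_scope.
Local Open Scope ring_scope.

(* R^n is 'rV[R]_n. Its library norm is the sup norm, which is used only
   through the topology and boundedness; Euclidean notions go through [dot]. *)

(* The sigma-algebra generated by the coordinates, i.e. the Borel one. *)
Section measurable_rV.
Context {R : realType} (n : nat).

Let coord (i : 'I_n) (x : 'rV[R]_n) : R := x ord0 i.

Let rV_set0 : g_sigma_preimage coord set0.
Proof. exact: sigma_algebra0. Qed.

Let rV_setC A : g_sigma_preimage coord A -> g_sigma_preimage coord (~` A).
Proof. exact: sigma_algebraC. Qed.

Let rV_bigcup (F : _^nat) : (forall i, g_sigma_preimage coord (F i)) ->
  g_sigma_preimage coord (\bigcup_i (F i)).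
Proof. exact: sigma_algebra_bigcup. Qed.

HB.instance Definition _ :=
  @isMeasurable.Build (measure_tuple_display default_measure_display)
    'rV[R]_n (g_sigma_preimage coord) rV_set0 rV_setC rV_bigcup.

End measurable_rV.

Lemma measurable_coord (R : realType) n (i : 'I_n) :
  measurable_fun [set: 'rV[R]_n] (fun x : 'rV[R]_n => x ord0 i).
Proof.
move=> _ Y mY; rewrite setTI; apply: sub_sigma_algebra => /=.
rewrite -bigcup_seq/=; exists i => /=; first by rewrite mem_index_enum.
by exists Y => //; rewrite setTI.
Qed.

Lemma measurable_fun_rV d (T : measurableType d) (R : realType) n
    (f : T -> 'rV[R]_n) :
  (forall i, measurable_fun [set: T] (fun t => f t ord0 i)) ->
  measurable_fun [set: T] f.
Proof.
move=> mf; pose coord (i : 'I_n) (x : 'rV[R]_n) := x ord0 i.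
suff sub : g_sigma_preimage (fun i => coord i \o f) `<=` measurable.
  move=> _ A mA; apply: sub; rewrite g_sigma_preimage_comp.
  by exists A.
apply: smallest_sub; first exact: sigma_algebra_measurable.
rewrite -bigcup_seq/=; apply: bigcup_sub => i _ A [B mB <-].
exact: mf.
Qed.

Definition rV_cons (R : realType) n (p : R * 'rV[R]_n) : 'rV[R]_n.+1 :=
  \row_i oapp (fun j => p.2 ord0 j) p.1 (unlift ord0 i).

Lemma measurable_rV_cons (R : realType) n :
  measurable_fun setT (@rV_cons R n).
Proof.
apply: measurable_fun_rV => i.
under eq_fun do rewrite mxE.
case: unliftP => [j|] _ /=; last exact: measurable_fst.
apply: (measurableT_comp (@measurable_coord R n j)); exact: measurable_snd.
Qed.

Fixpoint leb_rV (R : realType) n : set 'rV[R]_n -> \bar R :=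
  match n with
  | 0%N => \d_ (0 : 'rV[R]_0)
  | m.+1 => pushforward (@lebesgue_measure R \x @leb_rV R m)%E (@rV_cons R m)
  end.
Arguments leb_rV {R n}.


Definition rV_uncons (R : realType) n (x : 'rV[R]_n.+1) : R * 'rV[R]_n :=
  (x ord0 ord0, \row_j x ord0 (lift ord0 j)).

Lemma rV_consK (R : realType) n : cancel (@rV_cons R n) (@rV_uncons R n).
Proof.
case=> t x; rewrite /rV_uncons /rV_cons !mxE unlift_none/=; congr pair.
by apply/rowP => j; rewrite !mxE liftK.
Qed.

Lemma measurable_rV_uncons (R : realType) n :
  measurable_fun setT (@rV_uncons R n).
Proof.
apply/measurable_fun_pair => /=; first exact: measurable_coord.
apply: measurable_fun_rV => i; under eq_fun do rewrite mxE.
exact: measurable_coord.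
Qed.

Section leb_rV_step.
Context (R : realType) n (m : {sigma_finite_measure set 'rV[R]_n -> \bar R}).

Definition leb_rV_step :=
  pushforward (@lebesgue_measure R \x m)%E (@rV_cons R n).
Let mu : {measure set 'rV[R]_n.+1 -> \bar R} :=
  measure_function_pushforward__canonical__measure_function_Measure
   (@lebesgue_measure R \x m)%E (@measurable_rV_cons R n).

HB.instance Definition _ := Measure.copy leb_rV_step mu.

Let sf : sigma_finite setT leb_rV_step.
Proof.
have /sigma_finiteP[F [FT ndF Foo]] := sigma_finiteT (@lebesgue_measure R).
have /sigma_finiteP[G [GT ndG Goo]] := sigma_finiteT m.
exists (fun k => @rV_uncons R n @^-1` (F k `*` G k)).
  rewrite -preimage_bigcup; apply/esym/seteqP; split=> // x _.
  have [i _ Fi] : (\bigcup_i F i) (rV_uncons x).1 by rewrite -FT.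
  have [j _ Gj] : (\bigcup_i G i) (rV_uncons x).2 by rewrite -GT.
  exists (maxn i j) => //; split.
  - by move: Fi; exact/subsetPset/ndF/leq_maxl.
  - by move: Gj; exact/subsetPset/ndG/leq_maxr.
move=> k; have [mF F_oo] := Foo k; have [mG G_oo] := Goo k; split.
  rewrite -[X in measurable X]setTI.
  by apply: measurable_rV_uncons => //; exact: measurableX.
rewrite /leb_rV_step /pushforward -comp_preimage (_ : _ \o _ = id); last first.
  by apply/funext => x /=; rewrite rV_consK.
by rewrite preimage_id product_measure1E// lte_mul_pinfty// ge0_fin_numE.
Qed.

HB.instance Definition _ := Measure_isSigmaFinite.Build _ _ _ leb_rV_step sf.

End leb_rV_step.

Lemma leb_rV_sigma_finite_measure (R : realType) n :
  exists m : {sigma_finite_measure set 'rV[R]_n -> \bar R},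
    (m : set _ -> _) = @leb_rV R n.
Proof.
elim: n => [|n [m mE]]; first by exists (\d_ (0 : 'rV[R]_0)).
by exists (leb_rV_step m); rewrite /= -mE.
Qed.

Section leb_rV_measure.
Context (R : realType) (n : nat).

Let leb_rV0 : @leb_rV R n set0 = 0%E.
Proof. by have [m <-] := leb_rV_sigma_finite_measure R n; exact: measure0. Qed.

Let leb_rV_ge0 A : (0 <= @leb_rV R n A)%E.
Proof.
by have [m <-] := leb_rV_sigma_finite_measure R n; exact: measure_ge0.
Qed.

Let leb_rV_sigma_additive : semi_sigma_additive (@leb_rV R n).
Proof.
have [m <-] := leb_rV_sigma_finite_measure R n.
exact: measure_semi_sigma_additive.
Qed.

HB.instance Definition _ := isMeasure.Build _ _ _ (@leb_rV R n)
  leb_rV0 leb_rV_ge0 leb_rV_sigma_additive.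

Let leb_rV_sigma_finite : sigma_finite setT (@leb_rV R n).
Proof.
by have [m <-] := leb_rV_sigma_finite_measure R n; exact: sigma_finiteT.
Qed.

HB.instance Definition _ :=
  Measure_isSigmaFinite.Build _ _ _ (@leb_rV R n) leb_rV_sigma_finite.

End leb_rV_measure.

Lemma leb_rV_box (R : realType) n (A : 'I_n -> set R) :
  (forall i, measurable (A i)) ->
  leb_rV [set x : 'rV[R]_n | forall i, A i (x ord0 i)] =
  (\prod_(i < n) lebesgue_measure (A i))%E.
Proof.
elim: n A => [|n IH] A mA.
  by rewrite big_ord0 /= diracE mem_set//; case.
rewrite big_ord_recl -IH => [|i]; last exact: mA.
have mB : measurable
    [set x : 'rV[R]_n | forall i : 'I_n, A (lift ord0 i) (x ord0 i)].
  rewrite (_ : [set _ | _] = \bigcap_(i in [set: 'I_n])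
      ((fun x : 'rV[R]_n => x ord0 i) @^-1` A (lift ord0 i))); last first.
    by apply/seteqP; split=> x h i => [_|]; exact: h.
  apply: fin_bigcap_measurable => // i _; rewrite -[X in measurable X]setTI.
  exact: measurable_coord.
rewrite -[RHS]product_measure1E//; last exact: mA.
apply: (congr1 (product_measure1 lebesgue_measure (@leb_rV R n))).
apply/seteqP; split=> [[t x] /= h|[t x] [/= tA xA] i].
  split=> [|i] /=; first by have := h ord0; rewrite mxE unlift_none.
  by have := h (lift ord0 i); rewrite mxE liftK.
by rewrite mxE; case: unliftP => [j ->|->]//=; exact: xA.
Qed.

Section euclidean.
Context {R : realType} {n : nat}.
Implicit Types x y : 'rV[R]_n.

Definition dot x y : R := \sum_(i < n) x ord0 i * y ord0 i.

Definition enorm x : R := Num.sqrt (dot x x).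

Definition sphere : set 'rV[R]_n := [set x | enorm x = 1].

Definition unit_ball : set 'rV[R]_n := [set x | enorm x <= 1].

Definition direction x : 'rV[R]_n := (enorm x)^-1 *: x.

Lemma measurable_enorm : measurable_fun setT enorm.
Proof.
apply: (measurableT_comp (continuous_measurable_fun (@sqrt_continuous R))).
by apply: measurable_sum => i; apply: measurable_funM; exact: measurable_coord.
Qed.

Lemma measurable_unit_ball : measurable unit_ball.
Proof.
rewrite -[unit_ball]setTI; apply: measurable_fun_le => //.
exact: measurable_enorm.
Qed.

Lemma measurable_direction : measurable_fun setT direction.
Proof.
apply: measurable_fun_rV => i.
under eq_fun do rewrite mxE -powR_inv1 ?sqrtr_ge0//.
apply: measurable_funM; last exact: measurable_coord.
exact: (measurableT_comp (measurable_powR _) measurable_enorm).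
Qed.

Let ball_pushforward_mu : {measure set 'rV[R]_n -> \bar R} :=
  measure_function_pushforward__canonical__measure_function_Measure
    (mrestr leb_rV measurable_unit_ball) measurable_direction.

(* Polar coordinates: the surface measure of E in S^(n-1) is n times the
   Lebesgue measure of the truncated cone { r u | 0 < r <= 1, u in E }.
   ([direction 0] is 0, which is not on the sphere.) *)
Definition surface_measure : {measure set 'rV[R]_n -> \bar R} :=
  mscale n%:R%:nng ball_pushforward_mu.

Lemma surface_measureE (E : set 'rV[R]_n) :
  surface_measure E =
  (n%:R%:E * leb_rV [set x | E (direction x) /\ unit_ball x])%E.
Proof. by []. Qed.

End euclidean.

Section smooth.
Context {R : realType} {W : normedModType R}.

Fixpoint iter_derive (vs : seq W) (u : W -> R) : W -> R :=
  if vs is v :: vs' then fun x => 'D_v (iter_derive vs' u) x else u.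

(* C^infty on the open set U: all iterated directional derivatives exist and
   are continuous on U. *)
Definition smooth_on (U : set W) (u : W -> R) : Prop :=
  forall (vs : seq W) (x : W), U x ->
    {for x, continuous (iter_derive vs u)} /\
    forall v, derivable (iter_derive vs u) x v.

Definition test_function (U : set W) (eta : W -> R) : Prop :=
  let supp := closure [set x | eta x != 0] in
  [/\ smooth_on setT eta, compact supp & supp `<=` U].

End smooth.

Section distributions.
Context {R : realType} {n : nat}.
Local Notation E := 'rV[R]_n.
Implicit Types (U V Omega : set E) (i j : 'I_n).

Definition partial i (u : E -> R) : E -> R := fun x => 'D_(delta_mx ord0 i) u x.

(* A distribution is represented by its action on smooth functions; all those
   below come from square-integrable functions. *)
Definition functional := (E -> R) -> R.

Definition regular_distribution (u : E -> R) : functional :=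
  fun eta => \int[leb_rV]_x (u x * eta x).

Definition partial_distribution i (T : functional) : functional :=
  fun eta => - T (partial i eta).

Definition vanishes_on U (T : functional) : Prop :=
  forall eta, test_function U eta -> T eta = 0.

Definition exterior_derivative (F : 'I_n -> functional) i j : functional :=
  fun eta => partial_distribution i (F j) eta - partial_distribution j (F i) eta.

(* [u \_ Omega] is u on Omega, extended by zero. *)
Definition in_L2 Omega (u : E -> R) : Prop := u \_ Omega \in Lfun leb_rV 2%:E.

Definition in_L2_field Omega (f : E -> E) : Prop :=
  forall i, in_L2 Omega (fun x => f x ord0 i).

Definition zero_ext_distribution Omega (f : E -> E) : 'I_n -> functional :=
  fun i => regular_distribution ((fun x => f x ord0 i) \_ Omega).

Definition weak_gradient Omega (phi : E -> R) (f : E -> E) : Prop :=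
  forall i eta, test_function Omega eta ->
    partial_distribution i (regular_distribution (phi \_ Omega)) eta =
    zero_ext_distribution Omega f i eta.

Definition L2_dist Omega (u v : E -> R) : \bar R :=
  Lnorm leb_rV 2%:E (EFin \o (u \- v) \_ Omega).

(* The closure in H^1(Omega) of the space of test functions on Omega. *)
Definition in_H10 Omega (phi : E -> R) : Prop :=
  in_L2 Omega phi /\
  exists g : E -> E,
    [/\ in_L2_field Omega g, weak_gradient Omega phi g &
      forall e : R, 0 < e -> exists eta,
        [/\ test_function Omega eta,
            (L2_dist Omega phi eta < e%:E)%E &
            forall i, (L2_dist Omega (fun x => g x ord0 i) (partial i eta)
                       < e%:E)%E]].

(* Near each boundary point, Omega is the sublevel set of a local defining
   function with nonzero differential. *)
Definition smooth_boundary Omega : Prop :=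
  forall x, (closure Omega `\` interior Omega) x ->
  exists (U : set E) (rho : E -> R),
    [/\ open U, U x, smooth_on U rho, (exists v, 'D_v rho x != 0) &
        U `&` Omega = U `&` [set y | rho y < 0]].

Definition smooth_convex_domain Omega : Prop :=
  [/\ open Omega, Omega !=set0, connected Omega, convex_set Omega &
      smooth_boundary Omega].

Local Notation EE := (E * E)%type.

(* (z, theta) stands for the oriented line t |-> z + t theta *)
Definition line_manifold : set EE :=
  [set p | sphere p.2 /\ dot p.1 p.2 = 0].

Definition lines_meeting V : set EE :=
  [set p | line_manifold p /\ exists t : R, V (p.1 + t *: p.2)].

(* Functions on the manifold are functions on the ambient space, of which only
   the values on the manifold matter; smoothness is that of functions on an
   embedded submanifold, i.e. local smooth extendability. *)
Definition smooth_on_lines (psi : EE -> R) : Prop :=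
  forall p, line_manifold p ->
  exists (U : set EE) (g : EE -> R),
    [/\ open U, U p, smooth_on U g &
        forall q, U q -> line_manifold q -> psi q = g q].

Definition line_test_function (G : set EE) (psi : EE -> R) : Prop :=
  let supp := closure [set p | line_manifold p /\ psi p != 0] in
  [/\ smooth_on_lines psi, compact supp & supp `<=` G].

Definition Xray1_adjoint (psi : EE -> R) i : E -> R :=
  fun x => \int[surface_measure]_(theta in sphere)
    (theta ord0 i * psi (x - dot x theta *: theta, theta)).

Definition Xray1 (F : 'I_n -> functional) : (EE -> R) -> R :=
  fun psi => \sum_(i < n) F i (Xray1_adjoint psi i).

End distributions.

(* Main.v *)
Require Import Defs.
From mathcomp Require Import all_boot all_order all_algebra.
From mathcomp Require Import all_classical all_reals all_analysis.
From mathcomp Require Import measurable_realfun.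
From mathcomp Require Import ring lra.

(** The easy implication: a gradient of a test function has zero integral along every
    line, and an element of H^1_0 is a limit of test functions, while the adjoint
    X-ray transform of a test function on lines is bounded
    ([Xray_of_gradient]).

    For the converse, the field, extended by zero, is mollified. The mollified field
    [g] is smooth with compact support, its curl vanishes near a point [x0] of [V]
    ([closed_mollified]), and its integrals along all lines through points near [x0]
    vanish ([rays_vanish]: test functions on lines concentrated near a given
    direction).

    The heart is that [g] is then closed everywhere ([closed_everywhere]), by an
    elementary argument replacing microlocal analysis. Differentiating the vanishing
    line integrals transversally shows that for vectors [e], [w] the curl component
    [F e w] has zero integral along all lines of direction in the plane of [e] and [w]
    through points near [x0]. As [F e w] vanishes near [x0], its moments
    [\int t^{-m} F (x0 + t theta) dt] make sense; the derivative in [theta] of the moment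
    of order [m + 1] is a moment of order [m] of a derivative of [F], so by induction
    these moments are constant in [theta], and being homogeneous they vanish
    ([ray_moments]). A function of one variable supported away from 0 is determined by
    its inverse moments ([inverse_moments_eq0]), hence [F e w = 0] on the rays from
    [x0].

    A closed field with compact support is the gradient of its primitive along the
    first coordinate. This primitive vanishes outside any thickening of the convex set
    [Omega] that contains the support of [g]: from a point outside, one of the two
    half-lines parallel to the first axis misses the support, and in dimension at least 2
    the primitive vanishes beyond the support ([potential_support]). Hence the mollified
    fields are gradients of functions supported in a thin neighbourhood of [Omega]; a
    slight dilation about an interior point makes them test functions of [Omega]
    ([thicken_dilation]). As the mollification and the dilation tend to the identity,
    their gradients tend to the field in mean square ([mollify_affine], from the
    continuity of affine changes of variables in mean square), and so do the functions
    themselves, by boundedness of the primitive ([sqnorm_primitive]). The limit is the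
    potential in H^1_0 ([gradient_of_H10]). *)

Set Implicit Arguments.
Unset Strict Implicit.
Unset Printing Implicit Defensive.

Import Order.TTheory GRing.Theory Num.Theory.
Import numFieldNormedType.Exports.

Local Open Scope classical_set_scope.
Local Open Scope ring_scope.

(** * Lebesgue measure on R^n *)

Lemma affine_preimage_itv (R : realType) (c b u v : R) : 0 < c ->
  (fun x => c * x + b) @^-1` `]u, v]%classic = `](u - b) / c, (v - b) / c]%classic.
Proof.
move=> c0; apply/seteqP; split=> x /=; rewrite !in_itv/= ltr_pdivrMr// ler_pdivlMr//;
  by rewrite mulrC ltrBlDr lerBrDr.
Qed.

(** Both sides are measures in [A]; they agree on half-open intervals, and these
    determine a sigma-finite measure. *)
Lemma lebesgue_affine (R : realType) (c b : R) (A : set R) : c != 0 ->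
  measurable A ->
  lebesgue_measure ((fun x => c * x + b) @^-1` A) = (`|c|^-1%:E * lebesgue_measure A)%E.
Proof.
move=> c0 mA.
have mf : @measurable_fun _ _ (measurableTypeR R) (measurableTypeR R) setT
    (fun x : R => c * x + b).
  by apply: (@measurable_funD _ _ _ setT (fun x : R => c * x) (cst b)) => //;
    exact: (@measurable_funM _ _ _ setT (cst c) id).
have nc0 : 0 < `|c| by rewrite normr_gt0.
pose m0 : {measure set (measurableTypeR R) -> \bar R} :=
  measure_function_pushforward__canonical__measure_function_Measure
    (@lebesgue_measure R) mf.
pose m1 : {measure set (measurableTypeR R) -> \bar R} :=
  mscale (NngNum (normr_ge0 c)) m0.
have -> : lebesgue_measure A = m1 A.
  apply: lebesgue_measure_unique => // X [[u v] _ <-] /=.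
  rewrite /m1/= /mscale/= /pushforward.
  have [uv|vu] := ltP u v; last first.
    by rewrite set_itv_ge ?preimage_set0 ?measure0 ?mule0// bnd_simp -leNgt.
  have [cp|cn] := ltP 0 c.
    rewrite affine_preimage_itv// !lebesgue_measure_itv/= !lte_fin uv.
    rewrite ltr_pM2r ?invr_gt0// ltrD2r uv -!EFinD -EFinM gtr0_norm//.
    by rewrite -mulrBl opprB addrA subrK mulrC divfK.
  have {}cn : 0 < - c by rewrite oppr_gt0 lt_neqAle c0.
  rewrite (_ : _ @^-1` _ = `[(v - b) / c, (u - b) / c[%classic); last first.
    apply/seteqP; split=> x /=; rewrite !in_itv/= => /andP[h1 h2]; apply/andP; split.
    + by rewrite ler_ndivrMr -?oppr_gt0// mulrC; lra.
    + by rewrite ltr_ndivlMr -?oppr_gt0// mulrC; lra.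
    + by move: h2; rewrite ltr_ndivlMr -?oppr_gt0// mulrC; lra.
    + by move: h1; rewrite ler_ndivrMr -?oppr_gt0// mulrC; lra.
  rewrite !lebesgue_measure_itv/= !lte_fin uv ltr_nM2r ?invr_lt0 -?oppr_gt0//.
  rewrite ltrD2r uv -!EFinD -EFinM ltr0_norm -?oppr_gt0//.
  congr EFin; rewrite -mulrBl opprB addrA subrK.
  by rewrite mulrC mulrN divfK// opprB.
by rewrite /m1/= /mscale/= muleA -EFinM mulVf ?gt_eqF// mul1e.
Qed.

Lemma ge0_integral_affine1 (R : realType) (c b : R) (f : R -> \bar R) : c != 0 ->
  measurable_fun setT f -> (forall x, (0 <= f x)%E) ->
  (\int[lebesgue_measure]_x f (c * x + b)%R =
   `|c|^-1%:E * \int[lebesgue_measure]_x f x)%E.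
Proof.
move=> c0 mf f0.
have ma : @measurable_fun _ _ (measurableTypeR R) (measurableTypeR R) setT
    (fun x : R => c * x + b).
  by apply: (@measurable_funD _ _ _ setT (fun x : R => c * x) (cst b)) => //;
    exact: (@measurable_funM _ _ _ setT (cst c) id).
have ic0 : 0 <= `|c|^-1 by rewrite invr_ge0.
pose m0 : {measure set (measurableTypeR R) -> \bar R} :=
  measure_function_pushforward__canonical__measure_function_Measure
    (@lebesgue_measure R) ma.
pose m1 : {measure set (measurableTypeR R) -> \bar R} :=
  mscale (NngNum ic0) (@lebesgue_measure R).
transitivity (\int[m0]_x f x)%E.
  by rewrite ge0_integral_pushforward.
rewrite (@eq_measure_integral _ _ _ setT m1 m0) => [|A mA _].
  by rewrite ge0_integral_mscale.
exact: lebesgue_affine.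
Qed.

Section integral_rV.
Context {R : realType}.

(** Tonelli for the recursive definition of [leb_rV]: peeling off the first
    coordinate is what every induction on the dimension rests on. *)
Lemma ge0_integral_leb_rVS n (f : 'rV[R]_n.+1 -> \bar R) :
  measurable_fun setT f -> (forall x, (0 <= f x)%E) ->
  (\int[leb_rV]_x f x =
   \int[lebesgue_measure]_t \int[leb_rV]_x f (rV_cons (t, x)))%E.
Proof.
move=> mf f0.
have -> : (\int[leb_rV]_x f x = \int[lebesgue_measure \x @leb_rV R n]_p f (rV_cons p))%E.
  transitivity (\int[pushforward (@lebesgue_measure R \x @leb_rV R n)%E (@rV_cons R n)]_x f x)%E => //.
  by rewrite ge0_integral_pushforward//; exact: measurable_rV_cons.
rewrite fubini_tonelli1//.
by apply: measurableT_comp => //; exact: measurable_rV_cons.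
Qed.

Lemma measurable_fun_affine n (c : R) (b : 'rV[R]_n) :
  measurable_fun setT (fun x : 'rV[R]_n => c *: x + b).
Proof.
apply: measurable_fun_rV => i; under eq_fun do rewrite !mxE.
by apply: measurable_funD => //; apply: measurable_funM => //; exact: measurable_coord.
Qed.

Lemma ge0_integral_affine n (c : R) (b : 'rV[R]_n) (f : 'rV[R]_n -> \bar R) :
  c != 0 -> measurable_fun setT f -> (forall x, (0 <= f x)%E) ->
  (\int[leb_rV]_x f (c *: x + b)%R = (`|c| ^- n)%:E * \int[leb_rV]_x f x)%E.
Proof.
move=> c0; elim: n b f => [|n IH] b f mf f0.
  rewrite expr0 invr1 mul1e; apply: eq_integral => x _; congr f.
  by apply/rowP; case.
rewrite ge0_integral_leb_rVS; last 2 first.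
- exact: (measurableT_comp mf (@measurable_fun_affine _ c b)).
- by [].
pose b' : 'rV[R]_n := (rV_uncons b).2.
have E1 t x : c *: rV_cons (t, x) + b = rV_cons (c * t + b ord0 ord0, c *: x + b').
  apply/rowP => i; rewrite !mxE; case: unliftP => [j|] -> /=; last by [].
  by rewrite !mxE.
under eq_integral do under eq_integral do rewrite E1.
have mfc : measurable_fun setT (fun p => f (rV_cons p)).
  by apply: measurableT_comp => //; exact: measurable_rV_cons.
under eq_integral => t _.
  rewrite (IH b' (fun x => f (rV_cons (c * t + b ord0 ord0, x)))); last 2 first.
  - exact: (measurableT_comp mfc (pair1_measurable _)).
  - by [].
  over.
have mg : measurable_fun setT (fun t : R => \int[leb_rV]_x f (rV_cons (t, x)))%E.
  exact: (@measurable_fun_fubini_tonelli_F _ _ (measurableTypeR R) _ R leb_rV _ mfc).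
have mg' : measurable_fun setT
    (fun t : R => \int[leb_rV]_x f (rV_cons ((c * t + b ord0 ord0)%R, x)))%E.
  apply: (measurableT_comp mg) => //=.
  by apply: measurable_funD => //; apply: measurable_funM.
rewrite ge0_integralZl//; last first.
  by move=> t _; apply: integral_ge0.
rewrite (ge0_integral_affine1 (b ord0 ord0) (f := fun t => \int[leb_rV]_x f (rV_cons (t, x)))%E)//; last first.
  by move=> t; apply: integral_ge0.
rewrite muleA -EFinM [in RHS]ge0_integral_leb_rVS//; congr (_%:E * _)%E.
by rewrite exprS invfM mulrC.
Qed.


Lemma rV_ballE n (x : 'rV[R]_n) (e : R) (y : 'rV[R]_n) : 0 < e ->
  ball x e y <-> forall i, `|x ord0 i - y ord0 i| < e.
Proof.
move=> e0; split=> [[_ h] i|h]; first exact: h.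
by split=> // i j; rewrite ord1; exact: h.
Qed.

Lemma measurable_rV_ball n (x : 'rV[R]_n) (e : R) : measurable (ball x e).
Proof.
have [e0|e0] := ltP 0 e; last first.
  rewrite (_ : ball x e = set0) // -subset0 => y [e0' _].
  by move: e0; rewrite leNgt e0'.
rewrite (_ : ball x e = \bigcap_(i in [set: 'I_n])
   ((fun y : 'rV[R]_n => y ord0 i) @^-1` ball (x ord0 i) e)).
  apply: fin_bigcap_measurable => // i _; rewrite -[X in measurable X]setTI.
  by apply: measurable_coord => //; exact: measurable_ball.
apply/seteqP; split=> y.
  by move=> /(rV_ballE _ _ e0) h i _ /=; exact: h.
by move=> h; apply/rV_ballE => // i; exact: h.
Qed.

(** Borel sets are generated here by coordinates; open sets are recovered from
    them through a countable base, balls with rational centres. *)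
Lemma countable_base_measurable d (T : measurableType d) (I : countType)
    (B : I -> set T) (U : set T) :
  (forall i, measurable (B i)) ->
  (forall x, U x -> exists i, B i x /\ B i `<=` U) -> measurable U.
Proof.
move=> mB h.
rewrite (_ : U = \bigcup_(i in [set i | B i `<=` U]) B i).
  rewrite bigcup_mkcond; apply: countable_bigcupT_measurable => [|i].
    exact: countableP.
  by case: ifP.
apply/seteqP; split=> [x /h[i [Bx BU]]|x [i /= BU]]; first by exists i.
exact: BU.
Qed.

Let rball n (q : 'rV[rat]_n * nat) : set 'rV[R]_n :=
  ball (\row_i (ratr (q.1 ord0 i) : R) : 'rV[R]_n) q.2.+1%:R^-1.

Let rball_base n (x : 'rV[R]_n) (e : R) : 0 < e ->
  exists k, forall m, (k <= m)%N ->
    exists q, rball (q, m) x /\ rball (q, m) `<=` ball x e.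
Proof.
move=> e0.
have e20 : 0 < e / 2 by rewrite divr_gt0.
have [k _ ke] := near_infty_natSinv_lt (PosNum e20).
exists k => m km.
have m0 : 0 < m.+1%:R^-1 :> R by rewrite invr_gt0.
have h (i : 'I_n) : exists q : rat, `|ratr q - x ord0 i| < m.+1%:R^-1.
  have [] := @rat_in_itvoo R (x ord0 i) (x ord0 i + m.+1%:R^-1).
    by rewrite ltrDl.
  move=> q /[!in_itv]/= /andP[h1 h2]; exists q.
  by rewrite ger0_norm ?subr_ge0 1?ltW// ltrBlDl.
have [q hq] := choice h.
have rqx : rball (\row_i q i, m) x.
  by apply/rV_ballE => // i; rewrite !mxE; exact: hq.
exists (\row_i q i); split => // y hy.
apply: (@le_ball _ _ _ (m.+1%:R^-1 + m.+1%:R^-1)).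
  by rewrite (splitr e) lerD// ltW//; exact: (ke m km).
exact: ball_triangle (ball_sym rqx) hy.
Qed.

Lemma open_measurable_rV n (U : set 'rV[R]_n) : open U -> measurable U.
Proof.
move=> oU; apply: (countable_base_measurable (B := @rball n)).
  by move=> q; exact: measurable_rV_ball.
move=> x Ux; have /nbhs_ballP[e /= e0 eU] := open_nbhs_nbhs (conj oU Ux).
have [k /(_ k (leqnn _))[q [h1 h2]]] := rball_base x e0.
by exists (q, k); split => //; exact: subset_trans eU.
Qed.

Lemma open_measurable_rV2 n (U : set ('rV[R]_n * 'rV[R]_n)) :
  open U -> measurable U.
Proof.
move=> oU.
pose B (i : 'rV[rat]_n * 'rV[rat]_n * nat) :=
  rball (i.1.1, i.2) `*` rball (i.1.2, i.2).
apply: (countable_base_measurable (B := B)).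
  by move=> q; apply: measurableX; exact: measurable_rV_ball.
move=> x Ux; have /nbhs_ballP[e /= e0 eU] := open_nbhs_nbhs (conj oU Ux).
have [k hk] := rball_base x.1 e0.
have [l hl] := rball_base x.2 e0.
have [q1 [h1 h2]] := hk _ (leq_maxl k l).
have [q2 [h3 h4]] := hl _ (leq_maxr k l).
exists (q1, q2, maxn k l); split => // y [y1 y2]; apply: eU.
by split; [exact: h2|exact: h4].
Qed.

Lemma continuous_measurable_rV n (f : 'rV[R]_n -> R) :
  continuous f -> measurable_fun setT f.
Proof.
move=> cf; apply: (measurability _ (RGenOpens.measurableE R)).
move=> _ [_ [a [b ->] <-]]; rewrite setTI; apply: open_measurable_rV.
by move/continuousP : cf; apply; exact: interval_open.
Qed.

Definition cube n (M : R) : set 'rV[R]_n := [set x | forall i, `|x ord0 i| <= M].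

Lemma measurable_cube n M : measurable (@cube n M).
Proof.
rewrite (_ : cube M = \bigcap_(i in [set: 'I_n])
   ((fun y : 'rV[R]_n => y ord0 i) @^-1` `[- M, M]%classic)).
  apply: fin_bigcap_measurable => // i _; rewrite -[X in measurable X]setTI.
  by apply: measurable_coord => //; exact: measurable_itv.
apply/seteqP; split=> y h i; first by move=> _; rewrite /= in_itv/= -ler_norml; exact: h.
by have := h i I; rewrite /= in_itv/= -ler_norml.
Qed.

Lemma leb_rV_cube n M : (leb_rV (@cube n M) < +oo)%E.
Proof.
rewrite (_ : cube M = [set x : 'rV[R]_n | forall i, `[-M, M]%classic (x ord0 i)]).
  rewrite (@leb_rV_box R n (fun=> `[-M, M]%classic)) => [|i]; last exact: measurable_itv.
  set p := (\prod_(i < n) _)%E.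
  suff /andP[] : (0 <= p < +oo)%E by [].
  apply: (big_ind (fun z => (0 <= z < +oo)%E)) => [|x y|i _].
  - by rewrite lee_fin ler01 ltry.
  - move=> /andP[x0 xoo] /andP[y0 yoo]; rewrite mule_ge0//=.
    by rewrite lte_mul_pinfty// ge0_fin_numE.
  - rewrite measure_ge0/= lebesgue_measure_itv/=; case: ifP => // _.
    by rewrite -EFinD ltry.
by apply/seteqP; split=> y /= h i; have := h i; rewrite in_itv/= -ler_norml.
Qed.

Lemma ler_norm_coord n (x : 'rV[R]_n) i : `|x ord0 i| <= `|x|.
Proof.
rewrite [leRHS]/Num.norm /= mx_normrE.
exact: (@le_bigmax _ _ _ 0 (fun i => `|x i.1 i.2|) (ord0, i)).
Qed.

Lemma rV_norm_le n (x : 'rV[R]_n) M : 0 <= M -> (`|x| <= M) <-> cube M x.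
Proof.
move=> M0; split=> [xM i|xM]; first by rewrite (le_trans (ler_norm_coord _ _)).
rewrite [leLHS]/Num.norm /= mx_normrE.
by apply/bigmax_leP; split => // -[i j] _ /=; rewrite ord1; exact: xM.
Qed.

Lemma bounded_set_cube n (A : set 'rV[R]_n) :
  bounded_set A -> exists2 M, 0 < M & A `<=` cube M.
Proof.
move=> [M [_ AM]]; exists (`|M| + 1); first by rewrite ltr_wpDl.
move=> x Ax; apply/rV_norm_le; first by rewrite addr_ge0.
by apply: AM => //; rewrite (le_lt_trans (ler_norm _))// ltrDl.
Qed.

End integral_rV.

Section real_integrals.
Context {R : realType}.

Lemma integrable_bounded_support d (T : measurableType d)
    (mu : {measure set T -> \bar R}) (A : set T) (C : R) (f : T -> R) :
  measurable A -> (mu A < +oo)%E -> measurable_fun setT f ->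
  (forall x, A x -> `|f x| <= C) -> (forall x, ~ A x -> f x = 0) ->
  mu.-integrable setT (EFin \o f).
Proof.
move=> mA fA mf fC f0.
have -> : EFin \o f = (EFin \o f) \_ A.
  apply/funext => x /=; rewrite patchE; case: ifPn => // /negP.
  by rewrite inE => /f0 ->.
apply: (@iffLR _ _ (integrable_mkcond _ _)) => //.
apply: measurable_bounded_integrable => //.
  exact: measurable_funTS.
exists C; split; first exact: num_real.
by move=> M CM x Ax /=; rewrite (le_trans (fC _ Ax))// ltW.
Qed.

Section fubini.
Context d1 d2 (T1 : measurableType d1) (T2 : measurableType d2).
Variables (m1 : {sigma_finite_measure set T1 -> \bar R})
          (m2 : {sigma_finite_measure set T2 -> \bar R}).

(** Domination by a product is the form in which every function on a product
    space is seen to be integrable below. *)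
Lemma integrable_prod_bound (f : T1 * T2 -> R) (a : T1 -> R) (b : T2 -> R) :
  measurable_fun setT f ->
  m1.-integrable setT (EFin \o a) -> m2.-integrable setT (EFin \o b) ->
  (forall x y, `|f (x, y)| <= a x * b y) ->
  (m1 \x m2)%E.-integrable setT (EFin \o f).
Proof.
move=> mf ia ib fab; apply/integrable12ltyP; first exact/measurable_EFinP.
have /integrableP[ma iia] := ia; have /integrableP[mb iib] := ib.
apply: (@le_lt_trans _ _ (\int[m1]_x \int[m2]_y (`|a x|%:E * `|b y|%:E))%E).
  apply: ge0_le_integral => //.
  - by move=> x _; apply: integral_ge0.
  - apply: (@measurable_fun_fubini_tonelli_F _ _ _ _ _ m2 (fun z => `|(f z)%:E|)%E) => //.
    by apply: measurableT_comp => //; exact/measurable_EFinP.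
  - apply: (@measurable_fun_fubini_tonelli_F _ _ _ _ _ m2 (fun z => `|a z.1|%:E * `|b z.2|%:E)%E) => //.
    apply/measurable_EFinP; apply: measurable_funM.
      apply: measurableT_comp => //; apply: measurableT_comp => //.
        by move/measurable_EFinP : ma.
      apply: measurableT_comp => //; apply: measurableT_comp => //.
      by move/measurable_EFinP : mb.
  - move=> x _; apply: ge0_le_integral => //.
    + apply: measurableT_comp => //; apply/measurable_EFinP.
      exact: (measurableT_comp mf (pair1_measurable x)).
    + apply/measurable_EFinP; apply: measurable_funM => //.
      by apply: measurableT_comp => //; move/measurable_EFinP : mb.
    + move=> y _; rewrite -EFinM lee_fin (le_trans (fab _ _))//.
      by rewrite -normrM ler_norm.
rewrite (eq_integral (fun x => (`|a x|%:E * \int[m2]_y `|b y|%:E)%E)); last first.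
  move=> x _; rewrite ge0_integralZl//.
  exact: (measurableT_comp (@abse_measurable R setT) mb).
rewrite ge0_integralZr//; last 2 first.
- exact: (measurableT_comp (@abse_measurable R setT) ma).
- exact: integral_ge0.
by rewrite lte_mul_pinfty ?integral_ge0// ge0_fin_numE// integral_ge0.
Qed.

Lemma integrable_Rfubini (f : T1 * T2 -> R) :
  (m1 \x m2)%E.-integrable setT (EFin \o f) ->
  m1.-integrable setT (EFin \o (fun x => \int[m2]_y f (x, y))).
Proof.
move=> fi; have iF := integrable_fubini_F fi.
have [mF iFoo] := integrableP _ _ _ iF.
apply: le_integrable iF => //.
  by apply/measurable_EFinP; apply: measurableT_comp mF.
move=> x _ /=; rewrite /fubini_F /Rintegral.
by case: (\int[m2]_y _)%E => [r||] /=; rewrite ?normr0 ?leey.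
Qed.

Lemma Rintegral_fubini1 (f : T1 * T2 -> R) :
  (m1 \x m2)%E.-integrable setT (EFin \o f) ->
  \int[m1]_x \int[m2]_y f (x, y) = fine (\int[m1 \x m2]_z (f z)%:E)%E.
Proof.
move=> fi; have iF := integrable_fubini_F fi.
rewrite -(integral12_prod_meas1 fi); congr fine.
have iF' := integrable_Rfubini fi.
apply: ae_eq_integral => //; try exact: (measurable_int _ iF) ||
  exact: (measurable_int _ iF').
apply: filterS (integrable_ae measurableT iF) => x h _.
by rewrite /Rintegral fineK//; exact: h.
Qed.
End fubini.

Lemma Rintegral_fubini d1 d2 (T1 : measurableType d1) (T2 : measurableType d2)
  (m1 : {sigma_finite_measure set T1 -> \bar R})
  (m2 : {sigma_finite_measure set T2 -> \bar R}) (f : T1 * T2 -> R) :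
  (m1 \x m2)%E.-integrable setT (EFin \o f) ->
  \int[m1]_x \int[m2]_y f (x, y) = \int[m2]_y \int[m1]_x f (x, y).
Proof.
move=> fi; rewrite Rintegral_fubini1// -(integral21_prod_meas1 fi).
pose f' (z : T2 * T1) := f (z.2, z.1).
have mf : measurable_fun setT f by move/measurable_int/measurable_EFinP : fi.
have fi' : (m2 \x m1)%E.-integrable setT (EFin \o f').
  apply/integrable12ltyP.
    apply/measurable_EFinP; apply: measurableT_comp => //.
    exact/measurable_fun_pair.
  by apply/(integrable21ltyP _ _ (measurable_int _ fi)).
by rewrite -[RHS]/(\int[m2]_y \int[m1]_x f' (y, x)) Rintegral_fubini1// -(integral12_prod_meas1 fi').
Qed.

Lemma measurable_Rintegral d1 d2 (X : measurableType d1) (Y : measurableType d2)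
    (m : {sigma_finite_measure set Y -> \bar R}) (h : X * Y -> R) :
  measurable_fun setT h -> measurable_fun setT (fun x => \int[m]_y h (x, y)).
Proof.
move=> mh; have mhE : measurable_fun setT (EFin \o h) by exact/measurable_EFinP.
have mp := @measurable_fun_fubini_tonelli_F _ _ _ _ _ m _
  (measurable_funepos mhE) (fun p => funepos_ge0 _ p).
have mn := @measurable_fun_fubini_tonelli_F _ _ _ _ _ m _
  (measurable_funeneg mhE) (fun p => funeneg_ge0 _ p).
rewrite (_ : (fun x => _) = fine \o (fun x =>
  fubini_F m (EFin \o h)^\+ x - fubini_F m (EFin \o h)^\- x)%E).
  by apply: measurableT_comp => //; exact: emeasurable_funB.
apply/funext => x; rewrite /Rintegral integralE /= /fubini_F; congr (fine (_ - _)%E).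
  by apply: eq_integral => y _; rewrite !funeposE.
by apply: eq_integral => y _; rewrite !funenegE.
Qed.

Lemma integrable_affine n (c : R) (b : 'rV[R]_n) (f : 'rV[R]_n -> R) :
  c != 0 -> leb_rV.-integrable setT (EFin \o f) ->
  leb_rV.-integrable setT (EFin \o (fun x => f (c *: x + b))).
Proof.
move=> c0 fi; have [mf foo] := integrableP _ _ _ fi.
apply/integrableP; split.
  exact: (measurableT_comp mf (@measurable_fun_affine _ _ c b)).
rewrite (@ge0_integral_affine _ _ c b (fun x => `|(f x)%:E|%E))//.
  by rewrite lte_mul_pinfty ?lee_fin ?invr_ge0 ?exprn_ge0.
exact: measurableT_comp mf.
Qed.

Lemma Rintegral_affine n (c : R) (b : 'rV[R]_n) (f : 'rV[R]_n -> R) :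
  c != 0 -> leb_rV.-integrable setT (EFin \o f) ->
  \int[leb_rV]_x f (c *: x + b) = `|c| ^- n * \int[leb_rV]_x f x.
Proof.
move=> c0 fi; have [mf foo] := integrableP _ _ _ fi.
rewrite /Rintegral integralE [in RHS]integralE.
have nfi := integrable_pos_fin_num measurableT fi.
have pfi := integrable_neg_fin_num measurableT fi.
have -> : (\int[leb_rV]_x (fun x => (f (c *: x + b))%:E)^\+ x =
  (`|c| ^- n)%:E * \int[leb_rV]_x (fun x => (f x)%:E)^\+ x)%E.
  rewrite -(ge0_integral_affine b c0 (f := (fun x => (f x)%:E)^\+%E))//; last first.
    exact: measurable_funepos.
  by apply: eq_integral => x _; rewrite !funeposE.
have -> : (\int[leb_rV]_x (fun x => (f (c *: x + b))%:E)^\- x =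
  (`|c| ^- n)%:E * \int[leb_rV]_x (fun x => (f x)%:E)^\- x)%E.
  rewrite -(ge0_integral_affine b c0 (f := (fun x => (f x)%:E)^\-%E))//; last first.
    exact: measurable_funeneg.
  by apply: eq_integral => x _; rewrite !funenegE.
rewrite -muleBr//; last by rewrite fin_num_adde_defr.
by rewrite fineM//; rewrite fin_numB nfi pfi.
Qed.

Lemma integrable_affine1 (c b : R) (f : R -> R) :
  c != 0 -> lebesgue_measure.-integrable setT (EFin \o f) ->
  lebesgue_measure.-integrable setT (EFin \o (fun x => f (c * x + b))).
Proof.
move=> c0 fi; have [mf foo] := integrableP _ _ _ fi.
apply/integrableP; split.
  apply: (measurableT_comp mf) => //.
  by apply: measurable_funD => //; exact: measurable_funM.
rewrite (@ge0_integral_affine1 _ c b (fun x => `|(f x)%:E|%E))//.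
  by rewrite lte_mul_pinfty ?lee_fin ?invr_ge0.
exact: measurableT_comp mf.
Qed.

Lemma Rintegral_affine1 (c b : R) (f : R -> R) :
  c != 0 -> lebesgue_measure.-integrable setT (EFin \o f) ->
  \int[lebesgue_measure]_x f (c * x + b) = `|c|^-1 * \int[lebesgue_measure]_x f x.
Proof.
move=> c0 fi; have [mf foo] := integrableP _ _ _ fi.
rewrite /Rintegral integralE [in RHS]integralE.
have nfi := integrable_pos_fin_num measurableT fi.
have pfi := integrable_neg_fin_num measurableT fi.
have -> : (\int[lebesgue_measure]_x (fun x => (f (c * x + b))%:E)^\+ x =
  (`|c|^-1)%:E * \int[lebesgue_measure]_x (fun x => (f x)%:E)^\+ x)%E.
  rewrite -(ge0_integral_affine1 b c0 (f := (fun x => (f x)%:E)^\+%E))//; last first.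
    exact: measurable_funepos.
  by apply: eq_integral => x _; rewrite !funeposE.
have -> : (\int[lebesgue_measure]_x (fun x => (f (c * x + b))%:E)^\- x =
  (`|c|^-1)%:E * \int[lebesgue_measure]_x (fun x => (f x)%:E)^\- x)%E.
  rewrite -(ge0_integral_affine1 b c0 (f := (fun x => (f x)%:E)^\-%E))//; last first.
    exact: measurable_funeneg.
  by apply: eq_integral => x _; rewrite !funenegE.
rewrite -muleBr//; last by rewrite fin_num_adde_defr.
by rewrite fineM//; rewrite fin_numB nfi pfi.
Qed.

(** A nonempty open set contains a box. *)
Lemma leb_rV_open_gt0 n (U : set 'rV[R]_n) : open U -> U !=set0 ->
  (0 < leb_rV U)%E.
Proof.
move=> oU [x Ux]; have /nbhs_ballP[e /= e0 eU] := open_nbhs_nbhs (conj oU Ux).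
pose A (i : 'I_n) : set R := ball (x ord0 i) e.
have AU : [set y : 'rV[R]_n | forall i, A i (y ord0 i)] `<=` U.
  by move=> y h; apply: eU; apply/rV_ballE => // i; exact: h.
have mA : measurable [set y : 'rV[R]_n | forall i, A i (y ord0 i)].
  rewrite (_ : [set _ | _] = ball x e); first exact: measurable_rV_ball.
  by apply/seteqP; split=> y; [move=> h; apply/rV_ballE|move/(rV_ballE _ _ e0)].
apply: (@lt_le_trans _ _ (leb_rV [set y : 'rV[R]_n | forall i, A i (y ord0 i)])).
  rewrite (leb_rV_box (A := A)); last by move=> i; exact: measurable_ball.
  apply: (big_ind (fun z : \bar R => 0 < z)%E) => //.
  - by move=> u v u0 v0; exact: mule_gt0.
  - by move=> i _; rewrite /A lebesgue_measure_ball ?ltW// lte_fin mulrn_wgt0.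
by apply: le_measure => //; rewrite inE//; exact: open_measurable_rV.
Qed.

Lemma Rintegral_gt0 n (D : set 'rV[R]_n) (f : 'rV[R]_n -> R) (U : set 'rV[R]_n) :
  measurable D -> leb_rV.-integrable D (EFin \o f) ->
  (forall x, D x -> 0 <= f x) -> open U -> U !=set0 -> U `<=` D ->
  (forall x, U x -> 0 < f x) -> 0 < \int[leb_rV]_(x in D) f x.
Proof.
move=> mD fi f0 oU U0 UD fU.
rewrite lt_def Rintegral_ge0// andbT; apply/negP => /eqP.
rewrite /Rintegral => h.
have fin := integrable_fin_num mD fi.
have {}h : (\int[leb_rV]_(x in D) (f x)%:E = 0)%E by rewrite -(fineK fin) h.
have [mf _] := integrableP _ _ _ fi.
have : ae_eq leb_rV D (EFin \o f) (cst 0%E).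
  apply/ae_eq_integral_abs => //.
  by rewrite -{}h; apply: eq_integral => x; rewrite inE => Dx /=; rewrite ger0_norm// f0.
move=> [N [mN N0 DN]].
have UN : U `<=` N.
  move=> x Ux; apply: DN => /= /(_ (UD _ Ux)) [] fx0.
  by have := fU _ Ux; rewrite fx0 ltxx.
have := leb_rV_open_gt0 oU U0.
rewrite ltNge => /negP; apply; rewrite -N0.
by apply: le_measure => //; rewrite inE//; exact: open_measurable_rV.
Qed.

End real_integrals.

(** * Smooth functions *)

Notation smooth := (smooth_on setT).

Section smooth_algebra.
Context {R : realType}.

Lemma mean_value (f df : R -> R) (a b : R) :
  (forall s : R, is_derive s 1 f (df s)) ->
  exists c, `|c - a| <= `|b - a| /\ f b - f a = df c * (b - a).
Proof.
move=> fd.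
have cf : continuous f.
  by move=> s; apply/differentiable_continuous/derivable1_diffP; have [] := fd s.
have [ab|/ltW ba] := leP a b.
  have [|c /[!in_itv]/= /andP[ac cb] ->] := @MVT_segment R f df _ _ ab (fun s _ => fd s).
    exact: continuous_subspaceT.
  by exists c; rewrite !ger0_norm ?subr_ge0 ?lerD2r.
have [|c /[!in_itv]/= /andP[bc ca] E] := @MVT_segment R f df _ _ ba (fun s _ => fd s).
  exact: continuous_subspaceT.
exists c; split; last by rewrite -opprB E -mulrN opprB.
by rewrite !ler0_norm ?subr_le0// lerN2 lerD2r.
Qed.

Section directional.
Context {W : normedModType R}.
Implicit Types (u w : W -> R) (x v : W).

Let line_quotient u x v (t : R) :
  (fun h : R => h^-1 *: (((fun s => u (x + s *: v)) \o shift t) (h *: 1) - u (x + t *: v)))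
  = (fun h : R => h^-1 *: ((u \o shift (x + t *: v)) (h *: v) - u (x + t *: v))).
Proof.
apply/funext => h /=; congr (_ *: (u _ - _)).
by rewrite [h%:A]mulr1 scalerDl addrCA.
Qed.

Lemma derivable_line u x v (t : R) :
  derivable (fun s : R => u (x + s *: v)) t 1 <-> derivable u (x + t *: v) v.
Proof. by rewrite /derivable line_quotient. Qed.

Lemma derive_line u x v (t : R) :
  'D_1 (fun s : R => u (x + s *: v)) t = 'D_v u (x + t *: v).
Proof. by rewrite /derive line_quotient. Qed.

Lemma is_derive_line u x v (t d : R) :
  is_derive (x + t *: v) v u d -> is_derive t 1 (fun s : R => u (x + s *: v)) d.
Proof.
by move=> [du <-]; apply: DeriveDef; [exact/derivable_line|exact: derive_line].
Qed.

Lemma is_derive_line0 u x v (d : R) :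
  is_derive (0 : R) 1 (fun s : R => u (x + s *: v)) d -> is_derive x v u d.
Proof.
move=> [/derivable_line du]; rewrite derive_line => <-.
by move: du; rewrite scale0r addr0 => du; exact: derivableP.
Qed.

(** Smoothness is the greatest property of continuous functions that is stable
    under directional derivatives; this coinduction principle replaces inductions
    over lists of directions. *)
Lemma smooth_coind (P : (W -> R) -> Prop) :
  (forall u, P u -> continuous u /\
     forall v, (forall x, derivable u x v) /\ P (fun x => 'D_v u x)) ->
  forall u, P u -> smooth u.
Proof.
move=> Pd u Pu vs x _.
have Pvs : P (iter_derive vs u).
  by elim: vs => //= v vs /Pd[_ /(_ v)[]].
have [cu du] := Pd _ Pvs.
by split; [exact: cu|move=> v; have [] := du v].
Qed.

Lemma smooth_continuous u : smooth u -> continuous u.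
Proof. by move=> su x; have [] := su [::] x I. Qed.

Lemma smooth_derivable u x v : smooth u -> derivable u x v.
Proof. by move=> su; have [_] := su [::] x I; exact. Qed.

Lemma smooth_is_derive u x v : smooth u -> is_derive x v u ('D_v u x).
Proof. by move=> su; apply: derivableP; exact: smooth_derivable. Qed.

Lemma smooth_derive u v : smooth u -> smooth (fun x => 'D_v u x).
Proof.
move=> su vs x _; have := su (rcons vs v) x I.
suff -> : iter_derive (rcons vs v) u = iter_derive vs (fun x => 'D_v u x) by [].
by elim: vs => //= v' vs ->.
Qed.

Lemma smooth_onW (U : set W) u : smooth u -> smooth_on U u.
Proof. by move=> su vs x _; exact: su. Qed.

Opaque smooth_on.

(** A continuous function with smooth directional derivatives is smooth: this is how
    a potential inherits smoothness from its gradient. *)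
Lemma smooth_from_derive u : continuous u -> (forall x v, derivable u x v) ->
  (forall v, smooth (fun x => 'D_v u x)) -> smooth u.
Proof.
move=> cu du su; apply: (@smooth_coind (fun w => smooth w \/ w = u)).
  move=> w [sw|->]; split.
  - exact: smooth_continuous.
  - move=> v; split; [by move=> x; exact: smooth_derivable|left].
    exact: smooth_derive.
  - exact: cu.
  - by move=> v; split; [move=> x; exact: du|left; exact: su].
by right.
Qed.

Lemma smooth_cst (c : R) : smooth (fun _ : W => c).
Proof.
apply: (@smooth_coind (fun w => exists c, w = fun=> c)); last by exists c.
move=> w [a ->]; split; first exact: cst_continuous.
move=> v; split; first by move=> x; exact: derivable_cst.
by exists 0; apply/funext => x; rewrite derive_cst.
Qed.

(** Linearity in the direction is not part of the definition of directional
    derivatives; it follows from the continuity of one of the two derivatives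
    through the mean value theorem. *)
Lemma is_derive_dirD u x v (w : W) : smooth u ->
  is_derive x (v + w) u ('D_v u x + 'D_w u x).
Proof.
move=> su.
have sw := smooth_continuous (smooth_derive w su).
suff cv : (fun h : R => h^-1 *: ((u \o shift x) (h *: (v + w)) - u x)) @ 0^'
    --> 'D_v u x + 'D_w u x.
  by apply: DeriveDef; [apply/cvg_ex; exists ('D_v u x + 'D_w u x)|exact: cvg_lim].
rewrite (_ : (fun h : R => _) = (fun h : R =>
   h^-1 *: (u (h *: v + x) - u x) + h^-1 *: (u (x + h *: v + h *: w) - u (x + h *: v)))); last first.
  apply/funext => h /=; rewrite -scalerDr; congr (_ *: _).
  by rewrite scalerDr (addrC _ x) addrA (addrC (h *: v) x); ring.
apply: cvgD.
  by move: (@smooth_derivable u x v su); rewrite /derivable /derive.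
apply/cvgrPdist_lt => e e0.
have := sw x; move=> /cvgrPdist_lt/(_ _ e0)/nbhs_ballP[r /= r0 hr].
near=> h.
have h0 : h != 0 by near: h; exact: nbhs_dnbhs_neq.
have [c [ch E]] : exists c : R, `|c - 0| <= `|h - 0| /\
    u (x + h *: v + h *: w) - u (x + h *: v + 0 *: w) =
    'D_w u (x + h *: v + c *: w) * (h - 0).
  apply: (mean_value (f := fun s => u (x + h *: v + s *: w))) => s.
  by apply: is_derive_line; exact: smooth_is_derive.
rewrite !subr0 scale0r addr0 in ch E.
rewrite E -[_ *: _]/(_ * _) mulrCA mulVf// mulr1; apply: hr.
rewrite -ball_normE /= -addrA opprD addNKr normrN.
rewrite (le_lt_trans (ler_normD _ _))// !normrZ.
rewrite (@le_lt_trans _ _ (`|h| * (`|v| + `|w|)))//.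
  by rewrite mulrDr lerD2l ler_wpM2r.
rewrite (@le_lt_trans _ _ (`|h| * (`|v| + `|w| + 1)))//.
  by rewrite ler_wpM2l// lerDl.
rewrite -ltr_pdivlMr ?ltr_wpDl ?addr_ge0//.
near: h; apply: dnbhs0_lt.
by rewrite divr_gt0// ltr_wpDl ?addr_ge0.
Unshelve. all: by end_near. Qed.

Lemma smooth_deriveD u x v (w : W) : smooth u -> 'D_(v + w) u x = 'D_v u x + 'D_w u x.
Proof. by move=> su; have [_] := is_derive_dirD x v w su. Qed.

Lemma smooth_deriveZ u x (c : R) v : smooth u -> 'D_(c *: v) u x = c * 'D_v u x.
Proof.
move=> su.
have h1 : is_derive (0 : R) 1 (fun s : R => u (x + s *: v)) ('D_v u x).
  by apply: is_derive_line; rewrite scale0r addr0; exact: smooth_is_derive.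
have h2 : is_derive (0 : R) 1 (fun s : R => c * s) c.
  by apply: is_derive_eq; rewrite /GRing.scale/= mulr1.
have h3 : is_derive x (c *: v) u ('D_v u x * c).
  apply: is_derive_line0.
  rewrite (_ : (fun s : R => _) = (fun s : R => u (x + s *: v)) \o (fun s : R => c * s)).
    by apply: is_derive1_comp; rewrite mulr0.
  by apply/funext => s /=; rewrite scalerA mulrC.
by have [_ ->] := h3; rewrite mulrC.
Qed.

Lemma smooth_linear (q : W -> R) (c : R) : continuous q ->
  (forall x v (h : R), q (x + h *: v) = q x + h * q v) ->
  smooth (fun x => q x + c).
Proof.
move=> cq ql.
have dq x v : is_derive x v (fun x => q x + c) (q v).
  apply: is_derive_line0.
  rewrite (_ : (fun s : R => _) = (fun s : R => q v * s + (q x + c))); last first.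
    by apply/funext => s; rewrite ql; ring.
  have d1 : is_derive (0 : R) 1 (fun s : R => q v * s) (q v).
    by apply: is_derive_eq; rewrite /GRing.scale/= mulr1.
  have d2 := is_derive_cst (q x + c) (0 : R) 1.
  by apply: (is_derive_eq (is_deriveD d1 d2)); rewrite addr0.
apply: smooth_from_derive.
- by move=> x; apply: cvgD; [exact: cq|exact: cvg_cst].
- by move=> x v; have [] := dq x v.
- move=> v; rewrite (_ : (fun x => _) = fun=> q v); first exact: smooth_cst.
  by apply/funext => x; have [] := dq x v.
Qed.

End directional.

Section algebra.
Context {W : normedModType R}.
Implicit Types (u w : W -> R) (x v : W).

(** Generating all operations at once lets a single coinduction show that each of them
    preserves smoothness. *)
Inductive smooth_expr : (W -> R) -> Prop :=
| SEbase u : smooth u -> smooth_expr u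
| SEadd u w : smooth_expr u -> smooth_expr w -> smooth_expr (fun x => u x + w x)
| SEmul u w : smooth_expr u -> smooth_expr w -> smooth_expr (fun x => u x * w x)
| SEcomp (E : R -> R) u : smooth E -> smooth_expr u -> smooth_expr (E \o u).

Lemma smooth_expr_smooth u : smooth_expr u -> smooth u.
Proof.
apply: smooth_coind => {}u; elim => {u} [u su|u w _ [cu du] _ [cw dw]
    |u w eu [cu du] ew [cw dw]|E u sE eu [cu du]].
- split; first exact: smooth_continuous.
  move=> v; split; first by move=> x; exact: smooth_derivable.
  exact/SEbase/smooth_derive.
- split; first by move=> x; apply: cvgD; [exact: cu|exact: cw].
  move=> v; have [du1 du2] := du v; have [dw1 dw2] := dw v.
  split; first by move=> x; exact: derivableD.
  rewrite (_ : (fun x => _) = (fun x => 'D_v u x + 'D_v w x)); first exact: SEadd.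
  by apply/funext => x; rewrite deriveD.
- split; first by move=> x; apply: cvgM; [exact: cu|exact: cw].
  move=> v; have [du1 du2] := du v; have [dw1 dw2] := dw v.
  split; first by move=> x; exact: derivableM.
  rewrite (_ : (fun x => _) = (fun x => u x * 'D_v w x + w x * 'D_v u x)).
    by apply: SEadd; apply: SEmul.
  by apply/funext => x; rewrite deriveM.
- split.
    move=> x; apply: continuous_comp; first exact: cu.
    exact: (smooth_continuous sE).
  move=> v; have [du1 du2] := du v.
  have d x : is_derive x v (E \o u) ('D_1 E (u x) * 'D_v u x).
    apply: is_derive_line0.
    apply: (@is_derive1_comp _ E (fun s : R => u (x + s *: v))).
      by rewrite scale0r addr0; exact: smooth_is_derive.
    by apply: is_derive_line; rewrite scale0r addr0; exact: derivableP.
  split; first by move=> x; have [] := d x.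
  rewrite (_ : (fun x => _) = (fun x => ((fun y => 'D_1 E y) \o u) x * 'D_v u x)).
    apply: SEmul du2; apply: SEcomp eu; exact: smooth_derive.
  by apply/funext => x; exact: (@derive_val _ _ _ _ _ _ _ (d x)).
Qed.

Lemma smoothD u w : smooth u -> smooth w -> smooth (fun x => u x + w x).
Proof. by move=> su sw; apply/smooth_expr_smooth/SEadd; exact: SEbase. Qed.

Lemma smoothM u w : smooth u -> smooth w -> smooth (fun x => u x * w x).
Proof. by move=> su sw; apply/smooth_expr_smooth/SEmul; exact: SEbase. Qed.

Lemma smooth_comp (E : R -> R) u : smooth E -> smooth u -> smooth (E \o u).
Proof. by move=> sE su; apply/smooth_expr_smooth/SEcomp => //; exact: SEbase. Qed.

Lemma smoothZ (c : R) u : smooth u -> smooth (fun x => c * u x).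
Proof. by apply: smoothM; exact: smooth_cst. Qed.

Lemma smoothN u : smooth u -> smooth (fun x => - u x).
Proof.
move=> su; rewrite (_ : (fun x => _) = fun x => -1 * u x); first exact: smoothZ.
by apply/funext => x; rewrite mulN1r.
Qed.

Lemma smoothB u w : smooth u -> smooth w -> smooth (fun x => u x - w x).
Proof. by move=> su sw; apply: smoothD su _; exact: smoothN. Qed.

Lemma smooth_sum (I : Type) (s : seq I) (F : I -> W -> R) :
  (forall i, smooth (F i)) -> smooth (fun x => \sum_(i <- s) F i x).
Proof.
move=> sF; elim: s => [|i s IH].
  by rewrite (_ : (fun x => _) = fun=> 0); [exact: smooth_cst|apply/funext => x; rewrite big_nil].
rewrite (_ : (fun x => _) = fun x => F i x + \sum_(i <- s) F i x).
  exact: (smoothD (sF i) IH).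
by apply/funext => x; exact: big_cons.
Qed.

Lemma smooth_prod (I : Type) (s : seq I) (F : I -> W -> R) :
  (forall i, smooth (F i)) -> smooth (fun x => \prod_(i <- s) F i x).
Proof.
move=> sF; elim: s => [|i s IH].
  by rewrite (_ : (fun x => _) = fun=> 1); [exact: smooth_cst|apply/funext => x; rewrite big_nil].
rewrite (_ : (fun x => _) = fun x => F i x * \prod_(i <- s) F i x).
  exact: (smoothM (sF i) IH).
by apply/funext => x; exact: big_cons.
Qed.

Lemma derive_eq0_open (U : set W) u : open U -> (forall x, U x -> u x = 0) ->
  forall x v, U x -> 'D_v u x = 0.
Proof.
move=> oU u0 x v Ux.
have [->|v0] := eqVneq v 0; first by rewrite derive0.
rewrite (@near_eq_derive _ _ _ u (cst 0))//; first by rewrite derive_cst.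
by near=> y; apply/u0; near: y; exact: open_nbhs_nbhs.
Unshelve. all: by end_near. Qed.

End algebra.

Lemma smooth_comp_affine (W W' : normedModType R) (A L : W -> W') (u : W' -> R) :
  continuous A -> (forall x v (h : R), A (x + h *: v) = A x + h *: L v) ->
  smooth u -> smooth (u \o A).
Proof.
move=> cA AL su.
apply: (@smooth_coind _ (fun w => exists2 u, smooth u & w = u \o A)); last by exists u.
move=> w [{}u {}su ->]; split.
  by move=> x; apply: continuous_comp; [exact: cA|exact: smooth_continuous].
have d x v : is_derive x v (u \o A) ('D_(L v) u (A x)).
  apply: is_derive_line0.
  rewrite (_ : (fun s : R => _) = (fun s : R => u (A x + s *: L v))).
    by apply: is_derive_line; rewrite scale0r addr0; exact: smooth_is_derive.
  by apply/funext => s /=; rewrite AL.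
move=> v; split; first by move=> x; have [] := d x v.
exists (fun y => 'D_(L v) u y); first exact: smooth_derive.
by apply/funext => x; have [_ ->] := d x v.
Qed.

Lemma derive_comp_affine (W W' : normedModType R) (A L : W -> W') (u : W' -> R) x v :
  (forall x v (h : R), A (x + h *: v) = A x + h *: L v) ->
  'D_v (u \o A) x = 'D_(L v) u (A x).
Proof.
move=> AL; have h (f : W -> R) : 'D_v f x = 'D_1 (fun s : R => f (x + s *: v)) 0.
  by rewrite derive_line scale0r addr0.
have h' (f : W' -> R) y w : 'D_w f y = 'D_1 (fun s : R => f (y + s *: w)) 0.
  by rewrite derive_line scale0r addr0.
by rewrite h h'; congr (derive _ 0 (1 : R)); apply/funext => s /=; rewrite AL.
Qed.

Lemma smooth_id : smooth (@id R).
Proof.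
rewrite (_ : id = fun x : R => id x + 0); last by apply/funext => x; rewrite addr0.
by apply: smooth_linear => [x|//]; exact: cvg_id.
Qed.

Section bump.

(** The derivatives of [exp(-1/x)] stay in this family: hence the polynomial factor. *)
Definition flat_exp (p : {poly R}) (x : R) : R :=
  if 0 < x then p.[x^-1] * expR (- x^-1) else 0.

Let expR_ge_pow (n : nat) (y : R) : 0 <= y -> y ^+ n <= n`!%:R * expR y.
Proof.
move=> y0; case: n => [|n].
  by rewrite expr0 fact0 mul1r -expR0 ler_expR.
have := expR_ge1Dxn n y0 => h.
have f0 : (0 : R) < n.+1`!%:R by rewrite ltr0n fact_gt0.
by rewrite mulrC -ler_pdivrMr// (le_trans _ h)// lerDr.
Qed.

Let poly_exp_bounded (p : {poly R}) :
  exists C : R, forall y, 0 <= y -> `|p.[y]| * expR (- y) <= C.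
Proof.
exists (\sum_(i < size p) `|p`_i| * i`!%:R) => y y0.
rewrite horner_coef (le_trans (ler_wpM2r (expR_ge0 _) (ler_norm_sum _ _ _)))//.
rewrite mulr_suml ler_sum// => i _.
rewrite normrM -mulrA ler_wpM2l// normrX ger0_norm//.
by rewrite expRN ler_pdivrMr ?expR_gt0// expR_ge_pow.
Qed.

Let flat_exp_sqr (p : {poly R}) : exists C : R, forall x, `|flat_exp p x| <= C * x ^+ 2.
Proof.
have [C hC] := poly_exp_bounded (p * 'X^2).
have C0 : 0 <= C by rewrite (le_trans _ (hC 0 (lexx _)))// mulr_ge0 ?expR_ge0.
exists C => x; rewrite /flat_exp; case: ifPn => x0; last first.
  by rewrite normr0 mulr_ge0// sqr_ge0.
have := hC x^-1; rewrite invr_ge0 ltW// => /(_ isT).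
rewrite hornerM hornerXn [`|_ * x^-1 ^+ 2|]normrM normrX [`|x^-1|]gtr0_norm ?invr_gt0//.
rewrite [`|_ * expR _|]normrM [`|expR _|]ger0_norm ?expR_ge0// mulrAC exprVn.
by rewrite ler_pdivrMr// exprn_gt0.
Qed.

Let is_derive_flat_exp (p : {poly R}) (x : R) :
  is_derive x 1 (flat_exp p) (flat_exp ((p - p^`()) * 'X^2) x).
Proof.
have [x0|x0|->] := ltgtP x 0.
- apply: (@near_eq_is_derive _ _ _ (cst 0)).
    near=> y; rewrite /flat_exp ifF//; apply/negbTE; rewrite -leNgt ltW//.
    by near: y; exact: lt_nbhsl.
  rewrite /flat_exp ifF; first exact: is_derive_cst.
  by apply/negbTE; rewrite -leNgt ltW.
- apply: (@near_eq_is_derive _ _ _ (fun y : R => p.[y^-1] * expR (- y^-1))).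
    near=> y; rewrite /flat_exp ifT//.
    by near: y; exact: lt_nbhsr.
  have xn0 : x != 0 by rewrite gt_eqF.
  have dV : is_derive x 1 (fun y : R => y^-1) (- x ^- 2).
    have := @is_deriveV R id x 1 1 xn0 (is_derive_id _ _).
    by rewrite /GRing.scale /= mulr1.
  have d1 : is_derive x 1 (fun y : R => p.[y^-1]) (p^`().[x^-1] * - x ^- 2).
    exact: (@is_derive1_comp _ (horner p) (fun y => y^-1)).
  have d2 : is_derive x 1 (fun y : R => expR (- y^-1)) (expR (- x^-1) * x ^- 2).
    apply: (@is_derive1_comp _ expR (fun y => - y^-1)).
    by rewrite -[X in is_derive _ _ _ X]opprK; apply: is_deriveN.
  rewrite /flat_exp x0 hornerM hornerXn hornerD hornerN exprVn.
  apply: (is_derive_eq (is_deriveM d1 d2)).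
  by rewrite /GRing.scale/=; ring.
have [C hC] := flat_exp_sqr p.
have f0 q : flat_exp q 0 = 0 by rewrite /flat_exp ltxx.
rewrite f0.
suff cv : (fun h : R => h^-1 *: ((flat_exp p \o shift 0) (h *: 1) - flat_exp p 0)) @ 0^' --> (0 : R).
  by apply: DeriveDef; [apply/cvg_ex; exists 0|exact: cvg_lim].
apply/cvgrPdist_lt => e e0; near=> h.
have h0 : h != 0 by near: h; exact: nbhs_dnbhs_neq.
rewrite f0 sub0r normrN subr0 /= addr0 [h%:A]mulr1 -[_ *: _]/(_ * _).
rewrite normrM normfV ltr_pdivrMl ?normr_gt0// (le_lt_trans (hC h))//.
have -> : h ^+ 2 = `|h| * `|h| by rewrite -normrM -expr2 ger0_norm// sqr_ge0.
rewrite mulrA mulrC ltr_pM2l ?normr_gt0//.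
rewrite (@le_lt_trans _ _ ((`|C| + 1) * `|h|))//.
  by rewrite ler_wpM2r// (le_trans (ler_norm _))// lerDl.
rewrite -ltr_pdivlMl ?ltr_wpDl//.
near: h; apply: dnbhs0_lt.
by rewrite mulr_gt0// invr_gt0 ltr_wpDl.
Unshelve. all: by end_near. Qed.

Lemma smooth_flat_exp (p : {poly R}) : smooth (flat_exp p).
Proof.
apply: (@smooth_coind _ (fun w => exists c q, w = fun x => c * flat_exp q x)); last first.
  by exists 1, p; apply/funext => x; rewrite mul1r.
move=> w [c [q ->]]; split.
  move=> x; apply: cvgMr.
  by apply/differentiable_continuous/derivable1_diffP; have [] := is_derive_flat_exp q x.
move=> v.
have d x : is_derive x v (fun x => c * flat_exp q x) (v * c * flat_exp ((q - q^`()) * 'X^2) x).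
  apply: is_derive_line0.
  have h1 : is_derive (0 : R) 1 (fun s : R => x + s *: v) v.
    have h := is_deriveD (is_derive_cst x (0 : R) 1)
      (is_deriveM (is_derive_id (0 : R) 1) (is_derive_cst v (0 : R) 1)).
    by apply: (is_derive_eq h); rewrite /GRing.scale/= mul0r !add0r mulr1.
  have h2 : is_derive (0 : R) 1 (fun s : R => flat_exp q (x + s *: v))
      (flat_exp ((q - q^`()) * 'X^2) x * v).
    apply: (@is_derive1_comp _ (flat_exp q) (fun s : R => x + s *: v)).
    by rewrite scale0r addr0; exact: is_derive_flat_exp.
  by apply: (is_derive_eq (is_deriveZ c h2)); rewrite /GRing.scale/=; ring.
split; first by move=> x; have [] := d x.
exists (v * c), ((q - q^`()) * 'X^2); apply/funext => x.
exact: (@derive_val _ _ _ _ _ _ _ (d x)).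
Qed.

Definition bump (x : R) : R := flat_exp 1 (1 + x) * flat_exp 1 (1 - x).

Lemma smooth_bump : smooth bump.
Proof.
have h (g : R -> R) : smooth g -> smooth (fun x => flat_exp 1 (g x)).
  exact: (smooth_comp (smooth_flat_exp 1)).
by apply: smoothM; apply: h; [apply: smoothD|apply: smoothB];
  (exact: smooth_cst || exact: smooth_id).
Qed.

Lemma bump_ge0 x : 0 <= bump x.
Proof.
rewrite /bump /flat_exp; case: ifP => _; case: ifP => _; rewrite ?mul0r ?mulr0//.
by rewrite !hornerC !mul1r mulr_ge0 ?expR_ge0.
Qed.

Lemma bump_gt0 x : `|x| < 1 -> 0 < bump x.
Proof.
rewrite ltr_norml => /andP[h1 h2]; rewrite /bump /flat_exp !ifT ?subr_gt0//.
  by rewrite !hornerC !mul1r mulr_gt0 ?expR_gt0.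
by rewrite addrC -ltrBlDr sub0r.
Qed.

Lemma bump_eq0 x : 1 <= `|x| -> bump x = 0.
Proof.
rewrite ler_normr /bump /flat_exp => /orP[h|h].
  by rewrite [X in _ * X]ifF ?mulr0//; apply/negbTE; rewrite -leNgt subr_le0.
by rewrite ifF ?mul0r//; apply/negbTE; rewrite -leNgt -lerBrDl sub0r lerNr.
Qed.

End bump.
End smooth_algebra.

(** * Compactly supported smooth functions and mollification *)

Section integral_tools.
Context {R : realType} d (Y : measurableType d) (mu : {measure set Y -> \bar R}).
Local Notation intg f := (mu.-integrable setT (EFin \o f)).

Lemma integrable_measurable (f : Y -> R) : intg f -> measurable_fun setT f.
Proof. by move/measurable_int/measurable_EFinP. Qed.

Lemma integrable_le (f g : Y -> R) : measurable_fun setT f ->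
  (forall y, `|f y| <= g y) -> intg g -> intg f.
Proof.
move=> mf fg; apply: le_integrable => //; first exact/measurable_EFinP.
by move=> y _ /=; rewrite lee_fin (le_trans (fg y))// ler_norm.
Qed.

Lemma integrable_mul_bounded (f g : Y -> R) (C : R) : intg f ->
  measurable_fun setT g -> (forall y, `|g y| <= C) -> intg (fun y => f y * g y).
Proof.
move=> fi mg gC; apply: (@integrable_le _ (fun y => C * `|f y|)).
- exact: measurable_funM (integrable_measurable fi) mg.
- by move=> y; rewrite normrM mulrC ler_wpM2r.
- exact: (@integrableZl _ _ _ mu setT measurableT C (fun y => `|f y|%:E) (integrable_norm fi)).
Qed.

Lemma integrableD_R (f g : Y -> R) : intg f -> intg g -> intg (fun y => f y + g y).
Proof.
by move=> fi gi; exact: (@integrableD _ _ _ mu setT measurableT (EFin \o f) (EFin \o g)).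
Qed.

Lemma integrableB_R (f g : Y -> R) : intg f -> intg g -> intg (fun y => f y - g y).
Proof.
by move=> fi gi; exact: (@integrableB _ _ _ mu setT measurableT (EFin \o f) (EFin \o g)).
Qed.

Lemma integrableZ_R (c : R) (f : Y -> R) : intg f -> intg (fun y => c * f y).
Proof. by move=> fi; exact: (@integrableZl _ _ _ mu setT measurableT c (EFin \o f)). Qed.

Lemma integrable_norm_R (f : Y -> R) : intg f -> intg (fun y => `|f y|).
Proof. exact: integrable_norm. Qed.

Lemma integrable_sum_R (I : Type) (s : seq I) (F : I -> Y -> R) :
  (forall i, intg (F i)) -> intg (fun y => \sum_(i <- s) F i y).
Proof.
move=> Fi; elim: s => [|i s IH].
  rewrite (_ : _ \o _ = cst 0%E); first exact: integrable0.
  by apply/funext => y /=; rewrite big_nil.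
rewrite (_ : _ \o _ = EFin \o (fun y => F i y + \sum_(i <- s) F i y)).
  exact: integrableD_R.
by apply/funext => y /=; rewrite big_cons.
Qed.

Lemma Rintegral_sum (I : Type) (s : seq I) (F : I -> Y -> R) :
  (forall i, intg (F i)) ->
  \int[mu]_y (\sum_(i <- s) F i y) = \sum_(i <- s) \int[mu]_y F i y.
Proof.
move=> Fi; elim: s => [|i s IH].
  rewrite big_nil; under eq_Rintegral do rewrite big_nil.
  by rewrite Rintegral_cst// mul0r.
under eq_Rintegral do rewrite big_cons.
by rewrite RintegralD// ?IH ?big_cons//; exact: integrable_sum_R.
Qed.

Lemma Rintegral_eq0 (f : Y -> R) : (forall y, f y = 0) -> \int[mu]_y f y = 0.
Proof.
move=> f0; have -> : f = cst 0 by apply/funext.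
by rewrite Rintegral_cst// mul0r.
Qed.

Lemma ler_norm_Rintegral (f g : Y -> R) : intg f -> intg g ->
  (forall y, `|f y| <= g y) -> `|\int[mu]_y f y| <= \int[mu]_y g y.
Proof.
move=> fi gi fg; rewrite (le_trans (le_normr_Rintegral _ _))//.
by apply: le_Rintegral => //; exact: integrable_norm_R.
Qed.

(** Differentiation under the integral sign, with a dominating function that is
    uniform over a neighbourhood of the parameter. *)
Lemma derive_under_Rintegral (h h' : R -> Y -> R) (G : Y -> R) (r : R) : 0 < r ->
  (forall s, `|s| < r -> intg (h s)) ->
  (forall (s : R) y, `|s| < r -> is_derive s 1 (h ^~ y) (h' s y)) ->
  intg G -> (forall s y, `|s| < r -> `|h' s y| <= G y) ->
  is_derive (0 : R) 1 (fun s => \int[mu]_y h s y) (\int[mu]_y h' 0 y).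
Proof.
move=> r0 ih dh iG hG.
have I0 : `]- r, r[%classic (0 : R) by rewrite /= in_itv/= oppr_lt0 r0.
have Ir s : `]- r, r[%classic s -> `|s| < r by rewrite /= in_itv/= -ltr_norml.
have E s y : `]- r, r[%classic s -> partial1of2 h s y = h' s y.
  by move=> /Ir sr; rewrite partial1of2E; have [] := dh s y sr.
have G0 y : 0 <= G y by rewrite (le_trans _ (hG 0 y _))// normr0.
have H1 s : `]- r, r[%classic s -> intg (h s) by move/Ir/ih.
have H2 s y : `]- r, r[%classic s -> setT y -> derivable (h ^~ y) s 1.
  by move=> /Ir sr _; have [] := dh s y sr.
have H3 s y : `]- r, r[%classic s -> setT y -> `|partial1of2 h s y| <= G y.
  by move=> si _; rewrite E//; apply: hG; exact: Ir.
apply: DeriveDef.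
  exact: (@derivable_under_integral _ _ _ mu h setT measurableT 0 (- r) r I0 H1 H2 G G0 iG H3).
rewrite -derive1E (@differentiation_under_integral _ _ _ mu h setT measurableT 0 (- r) r I0 H1 H2 G G0 iG H3).
by apply: eq_Rintegral => y _; exact: E.
Qed.

End integral_tools.

Lemma lipschitz_continuousW (R : realType) (W : normedModType R) (u : W -> R) (L : R) :
  (forall x y, `|u x - u y| <= L * `|x - y|) -> continuous u.
Proof.
move=> uL x; apply/cvgrPdist_lt => e e0; near=> z.
rewrite (le_lt_trans (uL _ _))// (@le_lt_trans _ _ ((`|L| + 1) * `|x - z|))//.
  by rewrite ler_wpM2r// (le_trans (ler_norm _))// lerDl.
rewrite mulrC -ltr_pdivlMr ?ltr_wpDl//.
near: z; apply/nbhs_ballP; exists (e / (`|L| + 1)) => /=.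
  by rewrite divr_gt0// ltr_wpDl.
by move=> z; rewrite -ball_normE.
Unshelve. all: by end_near. Qed.

Section compactly_supported.
Context {R : realType} {n : nat}.
Local Notation E := 'rV[R]_n.
Implicit Types (u : E -> R) (x v : E).

Lemma continuous_coord (i : 'I_n) : continuous (fun x : E => x ord0 i).
Proof. exact: coord_continuous. Qed.

Lemma closed_cube M : closed (@cube R n M).
Proof.
rewrite (_ : cube M = \bigcap_(i in [set: 'I_n])
   ((fun y : 'rV[R]_n => y ord0 i) @^-1` [set r | `|r| <= M])).
  apply: closed_bigI => i _; apply: closed_comp.
    by move=> x _; exact: continuous_coord.
  apply: (@closed_comp _ _ (fun r : R => `|r|) [set r | r <= M]).
    by move=> x _; exact: norm_continuous.
  exact: closed_le.
by apply/seteqP; split=> y h i; [move=> _|]; exact: h.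
Qed.

Lemma compact_cube M : compact (@cube R n M).
Proof.
apply: bounded_closed_compact; last exact: closed_cube.
exists `|M|; split; first exact: num_real.
move=> N MN x xM; apply: (rV_norm_le _ _).2.
  by rewrite (le_trans _ (ltW MN)).
by move=> i; rewrite (le_trans (xM i))// (le_trans (ler_norm _) (ltW MN)).
Qed.

Definition csmooth (M : R) u := smooth u /\ forall x, ~ cube M x -> u x = 0.

Lemma csmooth_derive M u v : csmooth M u -> csmooth M (fun x => 'D_v u x).
Proof.
move=> [su u0]; split; first exact: smooth_derive.
move=> x xM; apply: (@derive_eq0_open _ _ (~` cube M)) => //.
by rewrite openC; exact: closed_cube.
Qed.

Lemma csmooth_bounded M u : csmooth M u -> exists2 C : R, 0 <= C & forall x, `|u x| <= C.
Proof.
move=> [su u0]; have [[x0 x0M]|nM] := pselect (@cube R n M !=set0); last first.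
  exists 0 => // x; rewrite u0 ?normr0// => xM; apply: nM; by exists x.
have cn : {within @cube R n M, continuous (fun x => `|u x|)}.
  apply: continuous_subspaceT => x.
  apply: continuous_comp; first exact: (smooth_continuous su).
  exact: norm_continuous.
have [c cM h] := compact_EVT_max (ex_intro _ _ x0M) (@compact_cube M) cn.
exists `|u c| => // x.
have [xM|/u0->] := pselect (cube M x); last by rewrite normr0.
by apply: h; rewrite inE.
Qed.

Lemma smooth_measurable u : smooth u -> measurable_fun setT u.
Proof. by move=> su; apply: continuous_measurable_rV; exact: smooth_continuous. Qed.

Lemma csmooth_integrable M u : csmooth M u -> leb_rV.-integrable setT (EFin \o u).
Proof.
move=> cu; have [C _ uC] := csmooth_bounded cu.
apply: (@integrable_bounded_support _ _ _ _ (cube M) C) => //.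
- exact: measurable_cube.
- exact: leb_rV_cube.
- by case: cu => su _; exact: smooth_measurable.
- by case: cu.
Qed.

Lemma smooth_coord i : smooth (fun x : E => x ord0 i).
Proof.
rewrite (_ : (fun x => _) = fun x : E => x ord0 i + 0); last first.
  by apply/funext => x; rewrite addr0.
apply: smooth_linear; first exact: continuous_coord.
by move=> x v h; rewrite !mxE.
Qed.

Lemma row_sum_coord v : v = \sum_(i < n) v ord0 i *: delta_mx ord0 i.
Proof. by rewrite [LHS]row_sum_delta. Qed.

Lemma smooth_derive_partial u x v : smooth u ->
  'D_v u x = \sum_(i < n) v ord0 i * partial i u x.
Proof.
move=> su; rewrite {1}(row_sum_coord v).
elim/big_ind2: _ => [|a b w c <- <-|i _].
- by rewrite derive0.
- exact: smooth_deriveD.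
- exact: smooth_deriveZ.
Qed.

Lemma smooth_mean_value u x v : smooth u ->
  exists c : R, `|c| <= 1 /\ u (x + v) - u x = 'D_v u (x + c *: v).
Proof.
move=> su.
have [c [h1 h2]] := @mean_value R (fun s => u (x + s *: v)) _ 0 1
  (fun s => is_derive_line (smooth_is_derive (x + s *: v) v su)).
exists c; rewrite !subr0 in h1 h2; rewrite normr1 in h1; split => //.
by move: h2; rewrite scale1r scale0r addr0 mulr1.
Qed.

Lemma csmooth_lipschitz M u : csmooth M u ->
  exists2 L : R, 0 <= L & forall x y, `|u x - u y| <= L * `|x - y|.
Proof.
move=> cu; have su := cu.1.
have hC i := csmooth_bounded (csmooth_derive (delta_mx ord0 i) cu).
have /choice[C hC'] : forall i : 'I_n, exists C : R, 0 <= C /\ forall x, `|partial i u x| <= C.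
  by move=> i; have [C C0 h] := hC i; exists C.
exists (\sum_i C i); first by apply: sumr_ge0 => i _; have [] := hC' i.
move=> x y; have [c [_]] := @smooth_mean_value u y (x - y) su.
rewrite [y + (x - y)]addrC subrK => ->.
rewrite smooth_derive_partial// (le_trans (ler_norm_sum _ _ _))// mulr_suml.
apply: ler_sum => i _; rewrite normrM mulrC ler_pM//; first by have [] := hC' i.
by have := ler_norm_coord (x - y) i.
Qed.

Definition conv (f rho : E -> R) x : R := \int[leb_rV]_y (f y * rho (x - y)).

Section convolution.
Variables (f : E -> R) (fi : leb_rV.-integrable setT (EFin \o f)).

Lemma measurable_sub_left x : measurable_fun setT (fun y : E => x - y).
Proof.
rewrite (_ : (fun y => _) = fun y => (-1) *: y + x); first exact: measurable_fun_affine.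
by apply/funext => y; rewrite scaleN1r addrC.
Qed.

Lemma conv_integrable M rho x : csmooth M rho ->
  leb_rV.-integrable setT (EFin \o (fun y => f y * rho (x - y))).
Proof.
move=> cr; have [C _ hC] := csmooth_bounded cr.
apply: (integrable_mul_bounded (C := C)) => //.
apply: measurableT_comp; last exact: measurable_sub_left.
by apply: smooth_measurable; case: cr.
Qed.

Lemma is_derive_conv M rho x v : csmooth M rho ->
  is_derive x v (conv f rho) (conv f (fun z => 'D_v rho z) x).
Proof.
move=> cr; have cdr := csmooth_derive v cr.
have [C C0 hC] := csmooth_bounded cdr.
apply: is_derive_line0; rewrite /conv.
have E0 : \int[leb_rV]_y (f y * 'D_v rho (x - y)) =
   \int[leb_rV]_y (f y * 'D_v rho (x + (0 : R) *: v - y)).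
  by apply: eq_Rintegral => y _; rewrite scale0r addr0.
rewrite E0.
apply: (@derive_under_Rintegral _ _ _ _ (fun s y => f y * rho (x + s *: v - y))
  (fun s y => f y * 'D_v rho (x + s *: v - y)) (fun y => C * `|f y|) 1).
- exact: ltr01.
- by move=> s _; exact: conv_integrable cr.
- move=> s y _.
  have h : is_derive s 1 (fun s : R => rho (x + s *: v - y)) ('D_v rho (x + s *: v - y)).
    rewrite (_ : (fun s => _) = (fun s : R => rho ((x - y) + s *: v))); last first.
      by apply/funext => t; rewrite addrAC.
    by rewrite addrAC; apply: is_derive_line; apply: smooth_is_derive; case: cr.
  exact: (is_deriveZ (f y) h).
- by apply: integrableZ_R; exact: integrable_norm_R.
- by move=> s y _; rewrite normrM mulrC ler_wpM2r.
Qed.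

Lemma continuous_conv M rho : csmooth M rho -> continuous (conv f rho).
Proof.
move=> cr; have [L L0 hL] := csmooth_lipschitz cr.
pose A := \int[leb_rV]_y `|f y|.
apply: (@lipschitz_continuousW _ _ _ (A * L)) => x z.
rewrite /conv -RintegralB//; [|exact: conv_integrable cr|exact: conv_integrable cr].
rewrite -mulrA mulrC -RintegralZl//; last exact: integrable_norm_R.
apply: ler_norm_Rintegral.
- by apply: integrableB_R; exact: conv_integrable cr.
- by apply: integrableZ_R; exact: integrable_norm_R.
- move=> y; rewrite -mulrBr normrM mulrC ler_wpM2r// (le_trans (hL _ _))//.
  by rewrite opprB addrA subrK.
Qed.

(** The derivatives of [conv f rho] are convolutions with the derivatives of [rho],
    so the class of all such convolutions is closed under differentiation. *)
Lemma smooth_conv M rho : csmooth M rho -> smooth (conv f rho).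
Proof.
move=> cr; apply: (@smooth_coind _ _ (fun w => exists2 rho, csmooth M rho & w = conv f rho)).
  move=> w [{}rho {}cr ->]; split; first exact: continuous_conv cr.
  move=> v; split; first by move=> x; have [] := is_derive_conv x v cr.
  exists (fun z => 'D_v rho z); first exact: csmooth_derive.
  by apply/funext => x; exact: (@derive_val _ _ _ _ _ _ _ (is_derive_conv x v cr)).
by exists rho.
Qed.

Lemma csmooth_conv M N rho : csmooth M rho -> (forall x, ~ cube N x -> f x = 0) ->
  csmooth (N + M) (conv f rho).
Proof.
move=> cr f0; split; first exact: smooth_conv cr.
move=> x xNM; apply: Rintegral_eq0 => y.
have [yN|/f0->] := pselect (cube N y); last by rewrite mul0r.
have [_ r0] := cr; rewrite r0 ?mulr0// => xyM; apply: xNM => i.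
rewrite -(subrK (y ord0 i) (x ord0 i)) addrC (le_trans (ler_normD _ _))// lerD//.
by have := xyM i; rewrite !mxE.
Qed.

End convolution.

Lemma smooth_bump_scaled (q : E -> R) (c : R) : smooth q ->
  smooth (fun x => bump (q x / c)).
Proof.
move=> sq; apply: (smooth_comp smooth_bump (u := fun x => q x / c)).
rewrite (_ : (fun x => _) = fun x => c^-1 * q x); first exact: smoothZ.
by apply/funext => x; rewrite mulrC.
Qed.

Definition prod_bump (e : R) x : R := \prod_(i < n) bump (x ord0 i / e).

Lemma prod_bump_ge0 e x : 0 <= prod_bump e x.
Proof. by apply: prodr_ge0 => i _; exact: bump_ge0. Qed.

Lemma prod_bump_gt0 e x : 0 < e -> (forall i, `|x ord0 i| < e) -> 0 < prod_bump e x.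
Proof.
move=> e0 xe; apply: prodr_gt0 => i _; apply: bump_gt0.
by rewrite normrM normfV (gtr0_norm e0) ltr_pdivrMr// mul1r.
Qed.

Lemma prod_bump_eq0 e x i : 0 < e -> e <= `|x ord0 i| -> prod_bump e x = 0.
Proof.
move=> e0 xe; rewrite /prod_bump (bigD1 i)//= bump_eq0 ?mul0r//.
by rewrite normrM normfV (gtr0_norm e0) ler_pdivlMr// mul1r.
Qed.

Lemma csmooth_prod_bump e : 0 < e -> csmooth e (prod_bump e).
Proof.
move=> e0; split.
  by apply: smooth_prod => i; apply: smooth_bump_scaled; exact: smooth_coord.
move=> x /existsNP[i /negP]; rewrite -ltNge => /ltW; exact: prod_bump_eq0.
Qed.

Definition mollifier (e : R) x : R :=
  (\int[leb_rV]_y prod_bump e y)^-1 * prod_bump e x.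

Lemma prod_bump_integral_gt0 e : 0 < e -> 0 < \int[leb_rV]_(y in [set: E]) prod_bump e y.
Proof.
move=> e0; apply: (@Rintegral_gt0 _ _ _ _ (ball (0 : E) e)) => //.
- by apply: csmooth_integrable; exact: csmooth_prod_bump.
- by move=> x _; exact: prod_bump_ge0.
- exact: ball_open.
- by exists 0; exact: ballxx.
- move=> x /(rV_ballE _ _ e0) h; apply: prod_bump_gt0 => // i.
  by have := h i; rewrite mxE sub0r normrN.
Qed.

Lemma csmooth_mollifier e : 0 < e -> csmooth e (mollifier e).
Proof.
move=> e0; have [s0 h] := csmooth_prod_bump e0; split; first exact: smoothZ.
by move=> x /h; rewrite /mollifier => ->; rewrite mulr0.
Qed.

Lemma mollifier_ge0 e x : 0 < e -> 0 <= mollifier e x.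
Proof.
move=> e0; rewrite mulr_ge0 ?prod_bump_ge0// invr_ge0 ltW//.
exact: prod_bump_integral_gt0.
Qed.

Lemma mollifier_integral e : 0 < e -> \int[leb_rV]_(y in [set: E]) mollifier e y = 1.
Proof.
move=> e0; rewrite RintegralZl ?mulVf//.
- by rewrite gt_eqF// prod_bump_integral_gt0.
- by apply: csmooth_integrable; exact: csmooth_prod_bump.
Qed.

Lemma test_function_csmooth (U : set E) u : test_function U u ->
  exists2 M, 0 < M & csmooth M u.
Proof.
move=> [su cu _]; have [M M0 uM] := bounded_set_cube (compact_bounded cu).
exists M => //; split=> // x xM; apply/eqP; apply: contra_notT xM => ux.
by apply: uM; exact: subset_closure.
Qed.

Lemma csmooth_test_function M (U : set E) u : csmooth M u ->
  closure [set x | u x != 0] `<=` U -> test_function U u.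
Proof.
move=> [su u0] uU; split => //.
apply: (subclosed_compact _ (@compact_cube M)); first exact: closed_closure.
rewrite closureE => x; apply; split; first exact: closed_cube.
by move=> y /= /eqP uy; apply: contrapT => /u0.
Qed.

End compactly_supported.

(** * Vanishing of a function from its weighted line integrals *)

Section line_integrals.
Context {R : realType}.
Local Notation mu := (@lebesgue_measure R).

Lemma near0_norm_lt (e : R) : 0 < e -> \forall s \near (0 : R), `|s| < e.
Proof.
move=> e0; apply/nbhs_ballP; exists e => //= s.
by rewrite -ball_normE /= sub0r normrN.
Qed.

Lemma measurable_inv : measurable_fun setT (@GRing.inv R).
Proof.
have c0 : ~` [set (0 : R)] = [set x | x != 0].
  by apply/seteqP; split=> x /= /eqP.
rewrite -(setUv [set 0]); apply/measurable_funU => //; first exact: measurableC.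
split; first exact: measurable_fun_set1.
rewrite c0; apply: open_continuous_measurable_fun; first exact: open_neq.
by move=> x; rewrite inE/= => x0; exact: inv_continuous.
Qed.

Lemma integrable_bounded_itv (f : R -> R) (C T : R) : measurable_fun setT f ->
  (forall t, `|f t| <= C) -> (forall t, T < `|t| -> f t = 0) ->
  mu.-integrable setT (EFin \o f).
Proof.
move=> mf fC f0.
pose A : set R := `[- T, T]%classic.
have h : (mu A < +oo)%E.
  by rewrite lebesgue_measure_itv/=; case: ifP => // _; rewrite -EFinD ltry.
apply: (@integrable_bounded_support _ _ _ mu A C) => //.
- exact: (measurable_itv `[- T, T]).
- by move=> t; rewrite /A /= in_itv/= -ler_norml => /negP; rewrite -ltNge; exact: f0.
Qed.

Lemma integrable_itv_cst (C T : R) :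
  mu.-integrable setT (EFin \o (fun t => if `|t| <= T then C else 0)).
Proof.
apply: (@integrable_bounded_itv _ `|C| T).
- apply: measurable_fun_ifT => //.
  by apply: measurable_fun_ler => //; exact: measurableT_comp.
- by move=> t; case: ifP => _; rewrite ?normr0.
- by move=> t; rewrite ltNge => /negbTE ->.
Qed.

Context {n : nat}.
Local Notation E := 'rV[R]_n.
Implicit Types (u : E -> R) (x v theta w : E).

Lemma measurable_line x theta : measurable_fun setT (fun t : R => x + t *: theta).
Proof.
apply: measurable_fun_rV => i; under eq_fun do rewrite !mxE.
by apply: measurable_funD => //; exact: measurable_funM.
Qed.

Lemma line_support M u x theta (t : R) : csmooth M u ->
  `|M| + `|x| < `|t| * `|theta| -> u (x + t *: theta) = 0.
Proof.
move=> [_ u0] h; apply: u0 => xM.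
have {}xM : `|x + t *: theta| <= `|M|.
  apply: (rV_norm_le _ _).2 => // i.
  by rewrite (le_trans (xM i))// ler_norm.
move: h; rewrite ltNge -normrZ => /negP; apply.
by rewrite -[X in `|X|](addKr x) addrC (le_trans (ler_normB _ _))// lerD2r.
Qed.

Lemma integrable_line (K : R) (k : R -> R) M u x theta :
  measurable_fun setT k -> (forall t, `|k t| <= K) -> csmooth M u -> theta != 0 ->
  mu.-integrable setT (EFin \o (fun t => k t * u (x + t *: theta))).
Proof.
move=> mk kK cu th0; have [C C0 uC] := csmooth_bounded cu.
have nth0 : 0 < `|theta| by rewrite normr_gt0.
apply: (@integrable_bounded_itv _ (K * C) ((`|M| + `|x|) / `|theta|)).
- apply: measurable_funM => //; apply: measurableT_comp; last exact: measurable_line.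
  by case: cu => su _; exact: smooth_measurable.
- by move=> t; rewrite normrM ler_pM.
- move=> t; rewrite ltr_pdivrMr// => h.
  by rewrite (line_support cu) ?mulr0.
Qed.

(** The integral is differentiated both in the base point and in the direction. The
    weight is any bounded measurable function, so that negative powers of [t], cut off
    near 0, can be used; the integrals extend over a bounded set of parameters as long
    as the direction stays away from 0. *)
Lemma is_derive_line_integral (K : R) (k : R -> R) M u x v theta w :
  measurable_fun setT k -> (forall t, `|k t| <= K) -> csmooth M u -> theta != 0 ->
  is_derive (0 : R) 1
    (fun s : R => \int[mu]_t (k t * u (x + s *: v + t *: (theta + s *: w))))
    (\int[mu]_t (k t * ('D_v u (x + t *: theta) + t * 'D_w u (x + t *: theta)))).
Proof.
move=> mk kK cu th0; have su := cu.1.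
have [C1 C10 h1] := csmooth_bounded (csmooth_derive v cu).
have [C2 C20 h2] := csmooth_bounded (csmooth_derive w cu).
have nth0 : 0 < `|theta| by rewrite normr_gt0.
have K0 : 0 <= K by rewrite (le_trans _ (kK 0)).
pose r := Num.min 1 (`|theta| / 2 / (`|w| + 1)).
have w1 : 0 < `|w| + 1 by rewrite ltr_wpDl.
have r0 : 0 < r by rewrite lt_min ltr01/= !divr_gt0.
pose T := (`|M| + (`|x| + `|v|)) / (`|theta| / 2).
have thr s : `|s| < r -> `|theta| / 2 <= `|theta + s *: w|.
  rewrite lt_min => /andP[_]; rewrite ltr_pdivlMr// => hs.
  have : `|theta| <= `|theta + s *: w| + `|s| * `|w|.
    by rewrite -normrZ -{1}(addrK (s *: w) theta) ler_normB.
  have : `|s| * `|w| <= `|theta| / 2.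
    by rewrite (le_trans _ (ltW hs))// ler_wpM2l// lerDl.
  lra.
have supp (u' : E -> R) s t : csmooth M u' -> `|s| < r -> T < `|t| ->
    u' (x + s *: v + t *: (theta + s *: w)) = 0.
  move=> cu' sr Tt; apply: (line_support cu').
  apply: (@le_lt_trans _ _ (`|M| + (`|x| + `|v|))).
    rewrite lerD2l (le_trans (ler_normD _ _))// lerD2l normrZ ler_piMl//.
    by move: sr; rewrite lt_min => /andP[/ltW].
  move: Tt; rewrite ltr_pdivrMr ?divr_gt0// => /lt_le_trans; apply.
  by rewrite ler_wpM2l// thr.
pose p s t := x + s *: v + t *: (theta + s *: w).
have pE s t : p s t = (x + t *: theta) + s *: (v + t *: w).
  by rewrite /p !scalerDr !scalerA (mulrC s t) addrACA !addrA.
have -> : \int[mu]_t (k t * ('D_v u (x + t *: theta) + t * 'D_w u (x + t *: theta)))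
   = \int[mu]_t (k t * ('D_v u (p 0 t) + t * 'D_w u (p 0 t))).
  by apply: eq_Rintegral => t _; rewrite pE scale0r addr0.
apply: (@derive_under_Rintegral _ _ _ mu (fun s t => k t * u (p s t))
  (fun s t => k t * ('D_v u (p s t) + t * 'D_w u (p s t)))
  (fun t => if `|t| <= T then K * (C1 + T * C2) else 0) r r0).
- move=> s sr; apply: (integrable_line (x + s *: v) mk kK cu).
  by rewrite -normr_gt0 (lt_le_trans _ (thr _ sr))// divr_gt0.
- move=> s t sr.
  have h : is_derive s 1 (fun s => u (p s t)) ('D_v u (p s t) + t * 'D_w u (p s t)).
    rewrite (_ : (fun s => _) = (fun s => u ((x + t *: theta) + s *: (v + t *: w)))); last first.
      by apply/funext => s'; rewrite pE.
    apply: is_derive_line; rewrite -pE -smooth_deriveZ// -smooth_deriveD//.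
    exact: smooth_is_derive.
  exact: (is_deriveZ (k t) h).
- exact: integrable_itv_cst.
- move=> s t sr; case: ifPn => [tT|]; last first.
    rewrite -ltNge => Tt; rewrite (supp _ _ _ (csmooth_derive v cu) sr Tt).
    by rewrite (supp _ _ _ (csmooth_derive w cu) sr Tt) !(mulr0,addr0) normr0.
  rewrite normrM ler_pM// (le_trans (ler_normD _ _))// lerD//.
  by rewrite normrM ler_pM.
Qed.

(** If [h a > 0], high powers of a polynomial in [1/t] that exceeds 1 exactly near
    [t = a] make the integral positive. *)
Lemma inverse_moments_eq0 (h : R -> R) (C rho T : R) : continuous h ->
  (forall t, `|h t| <= C) -> 0 < rho -> (forall t, `|t| < rho -> h t = 0) ->
  (forall t, T < `|t| -> h t = 0) ->
  (forall m, \int[mu]_t (t ^- m * h t) = 0) -> forall a, h a <= 0.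
Proof.
move=> ch hC rho0 h0 hT hm a; rewrite leNgt; apply/negP => ha.
have mh : measurable_fun setT h by exact: continuous_measurable_fun.
have C0 : 0 <= C by rewrite (le_trans _ (hC 0)).
have im m : mu.-integrable setT (EFin \o (fun t => t ^- m * h t)).
  apply: (@integrable_bounded_itv _ (rho ^- m * C) T).
  - apply: measurable_funM => //; apply: (measurableT_comp measurable_inv).
    exact: measurable_funX.
  - move=> t; have [tr|tr] := ltP `|t| rho.
      by rewrite h0// mulr0 normr0 mulr_ge0// invr_ge0 exprn_ge0// ltW.
    have t0 : 0 < `|t| by exact: lt_le_trans tr.
    rewrite normrM ler_pM// normfV normrX lef_pV2 ?posrE ?exprn_gt0//.
    by rewrite lerXn2r// nnegrE// ltW.
  - by move=> t /hT ->; rewrite mulr0.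
have ih : mu.-integrable setT (EFin \o h).
  by move: (im 0); congr (is_true (integrable _ _ (EFin \o _))); apply/funext => t; rewrite expr0 invr1 mul1r.
have ar : rho <= `|a| by rewrite leNgt; apply/negP => /h0 e; rewrite e ltxx in ha.
have a0 : a != 0 by rewrite -normr_gt0 (lt_le_trans rho0).
have hpoly (p : {poly R}) : mu.-integrable setT (EFin \o (fun t => p.[t^-1] * h t)) /\
    \int[mu]_t (p.[t^-1] * h t) = 0.
  have -> : (fun t => p.[t^-1] * h t) = (fun t => \sum_(i < size p) p`_i * (t ^- i * h t)).
    apply/funext => t; rewrite horner_coef mulr_suml; apply: eq_bigr => i _.
    by rewrite exprVn mulrA.
  have iz (i : 'I_(size p)) : mu.-integrable setT (EFin \o (fun t => p`_i * (t ^- i * h t))).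
    exact: integrableZ_R.
  split; first exact: integrable_sum_R.
  rewrite Rintegral_sum// big1// => i _.
  by rewrite RintegralZl// hm mulr0.
have := ch a; move=> /cvgrPdist_lt/(_ _ (divr_gt0 ha (@ltr0Sn R 1)))/nbhs_ballP[e1 /= e10 he1].
have av0 : a^-1 != 0 by rewrite invr_eq0.
have := inv_continuous av0 => /cvgrPdist_lt/(_ _ e10)/nbhs_ballP[d /= d0 hd].
have d20 : 0 < d / 2 / 2 by rewrite !divr_gt0.
have := inv_continuous a0 => /cvgrPdist_lt/(_ _ d20)/nbhs_ballP[e2 /= e20 he2].
have hpos t : `|a^-1 - t^-1| <= d / 2 -> h a / 2 <= h t.
  move=> ht; have : `|a - t| < e1.
      have := hd t^-1; rewrite /= -ball_normE /= !invrK; apply.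
    by rewrite (le_lt_trans ht)// ltr_pdivrMr// ltr_pMr// ltr1n.
  move=> at1; have := he1 t at1; rewrite ltr_norml => /andP[_]; lra.
pose S := 2 / rho.
have S0 : 0 < S by rewrite divr_gt0.
pose q (t : R) := 1 + ((d / 2) ^+ 2 - (a^-1 - t^-1) ^+ 2) / S ^+ 2.
pose p : {poly R} := 1 + (S ^- 2)%:P * (((d / 2) ^+ 2)%:P - (a^-1%:P - 'X) ^+ 2).
have pE t : p.[t^-1] = q t.
  by rewrite /p !(hornerD, hornerM, hornerN, hornerC, hornerX, horner_exp) /q mulrC.
pose eta := 3 / 4 * (d / 2) ^+ 2 / S ^+ 2.
have eta0 : 0 < eta by rewrite !(divr_gt0,mulr_gt0,exprn_gt0).
pose A := \int[mu]_t `|h t|.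
pose B : set R := ball a e2.
have sq (x y : R) : `|x| <= y -> x ^+ 2 <= y ^+ 2.
  by move=> xy; rewrite -[x ^+ 2]real_normK ?num_real// lerXn2r// nnegrE (le_trans _ xy).
have S20 : 0 < S ^+ 2 by rewrite exprn_gt0.
have d2 : 0 < d / 2 by rewrite divr_gt0.
have q_in t : `|a^-1 - t^-1| <= d / 2 -> 1 <= q t.
  by move=> /sq ht; rewrite lerDl divr_ge0 ?(ltW S20)// subr_ge0.
have q_B t : B t -> 1 + eta <= q t.
  move=> /he2 /= /ltW /sq ht; rewrite lerD2l ler_wpM2r ?invr_ge0 ?(ltW S20)//.
  move: ht; rewrite exprMn; lra.
have q_out t : rho <= `|t| -> d / 2 <= `|a^-1 - t^-1| -> `|q t| <= 1.
  move=> tr ht.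
  have t0 : 0 < `|t| by exact: lt_le_trans tr.
  have X1 : (d / 2) ^+ 2 <= (a^-1 - t^-1) ^+ 2.
    by rewrite -[leRHS]real_normK ?num_real//; apply: sq; rewrite (ger0_norm (ltW d2)).
  have X2 : (a^-1 - t^-1) ^+ 2 <= S ^+ 2.
    apply: sq; rewrite (le_trans (ler_normB _ _))// !normfV /S mulrDl mul1r.
    by rewrite lerD// lef_pV2// posrE normr_gt0.
  have D20 : 0 <= (d / 2) ^+ 2 by rewrite sqr_ge0.
  rewrite ler_norml; apply/andP; split.
    rewrite -lerBlDl ler_pdivlMr//; lra.
  by rewrite -lerBrDl subrr ler_pdivrMr// mul0r subr_le0.
have mB : measurable B by exact: measurable_ball.
have muB : (mu B < +oo)%E by rewrite lebesgue_measure_ball ?ltW// ltry.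
have iB : mu.-integrable setT (EFin \o (\1_B : R -> R)).
  apply: (@integrable_bounded_support _ _ _ mu B 1).
  - exact: mB.
  - exact: muB.
  - exact: measurable_indic.
  - by move=> t _; rewrite indicE; case: (t \in B); rewrite ?normr1 ?normr0.
  - by move=> t tB; rewrite indicE memNset.
have intB : \int[mu]_t (\1_B t : R) = e2 *+ 2.
  have muBE : mu B = (e2 *+ 2)%:E by rewrite lebesgue_measure_ball ?ltW.
  rewrite /Rintegral integral_indic ?setIT//.
  exact: (congr1 fine muBE).
have key N : (1 + eta) ^+ N * (h a / 2) * (e2 *+ 2) <= A.
  have [ipN intpN] := hpoly (p ^+ N).
  rewrite -subr_le0 -[leRHS]intpN -intB /A -RintegralZl//.
  have iB' := integrableZ_R ((1 + eta) ^+ N * (h a / 2)) iB.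
  have inh := integrable_norm_R ih.
  rewrite -RintegralB//; apply: le_Rintegral => //; first exact: integrableB_R.
  move=> t _; rewrite horner_exp pE indicE.
  have [tB|tB] := boolP (t \in B).
    rewrite mulr1 lerBlDr (le_trans _ (_ : q t ^+ N * h t <= _)) ?lerDl//.
    rewrite inE in tB; apply: ler_pM => //.
    - by rewrite exprn_ge0// addr_ge0// ltW.
    - by rewrite divr_ge0// ltW.
    - have e10' : 0 <= 1 + eta by exact: (addr_ge0 ler01 (ltW eta0)).
      rewrite lerXn2r ?nnegrE//; last exact: q_B.
      exact: (le_trans e10' (q_B _ tB)).
    - apply: hpos; have := he2 _ tB => /= /ltW /le_trans; apply.
      by rewrite ler_pdivrMr// ler_pMr// ler1n.
  rewrite mulr0 sub0r.
  have [ht|/ltW ht] := leP `|a^-1 - t^-1| (d / 2).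
    have ht0 : 0 <= h t by rewrite (le_trans _ (hpos _ ht))// divr_ge0// ltW.
    rewrite (@le_trans _ _ 0)// ?oppr_le0// mulr_ge0// exprn_ge0//.
    by rewrite (le_trans _ (q_in _ ht)).
  have [tr|tr] := ltP `|t| rho; first by rewrite h0// mulr0 normr0 oppr0.
  rewrite lerNl (le_trans (ler_norm _))// normrN normrM normrX ler_piMl//.
  by rewrite exprn_ile1// q_out.
have bern N : 1 + eta *+ N <= (1 + eta) ^+ N.
  elim: N => [|N IH]; first by rewrite expr0 mulr0n addr0.
  rewrite exprS (@le_trans _ _ ((1 + eta) * (1 + eta *+ N)))//.
    rewrite -subr_ge0 (_ : _ - _ = eta * (eta *+ N)); last by rewrite mulrS; ring.
    by rewrite mulr_ge0 ?mulrn_wge0// ltW.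
  by rewrite ler_wpM2l// (addr_ge0 ler01 (ltW eta0)).
pose c := h a / 2 * (e2 *+ 2).
have c0 : 0 < c by rewrite mulr_gt0 ?divr_gt0// mulrn_wgt0.
have ce0 : 0 < c * eta by rewrite mulr_gt0.
have [N hN] : exists N : nat, A < c * eta * N%:R.
  exists (Num.bound `|A / (c * eta)|).
  rewrite mulrC -ltr_pdivrMr// (le_lt_trans (ler_norm _))//.
  by apply: archi_boundP.
have := key N; rewrite leNgt => /negP; apply.
rewrite -mulrA -/c (lt_le_trans hN)// -mulrA mulrC mulr_natr ler_pM2r//.
by rewrite (le_trans _ (bern N))// lerDr.
Qed.

(** ** Moments along the rays of a plane *)
Section moments.
Variables (M r : R) (U : E -> R) (e w : E).
Hypotheses (r0 : 0 < r) (cU : csmooth M U) (U0 : forall x, `|x| < r -> U x = 0).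
Hypothesis ew : forall a b : R, a *: e + b *: w = 0 -> a = 0 /\ b = 0.
Hypothesis Uline : forall x, `|x| < r -> forall a b : R, a *: e + b *: w != 0 ->
  \int[mu]_t U (x + t *: (a *: e + b *: w)) = 0.

Let cUvs vs : csmooth M (iter_derive vs U).
Proof. by elim: vs => [//|v vs IH]; exact: csmooth_derive. Qed.

Let Uvs0 vs x : `|x| < r -> iter_derive vs U x = 0.
Proof.
elim: vs x => [|v vs IH] x xr; first exact: U0.
apply: (@derive_eq0_open _ _ (ball (0 : E) r)).
- exact: ball_open.
- by move=> y; rewrite -ball_normE/= sub0r normrN; exact: IH.
- by rewrite -ball_normE/= sub0r normrN.
Qed.

(** Line integrals vanishing for all base points near 0 can be differentiated in the
    base point, so every derivative of [U] inherits the hypothesis. *)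
Let line0 vs x : `|x| < r -> forall a b : R, a *: e + b *: w != 0 ->
  \int[mu]_t iter_derive vs U (x + t *: (a *: e + b *: w)) = 0.
Proof.
elim: vs x => [|v vs IH] x xr a b th0; first exact: Uline.
set theta := _ + _ in th0 IH *.
have k1 (t : R) : `|cst 1 t : R| <= 1 by rewrite normr1.
have d := @is_derive_line_integral 1 (cst 1) M (iter_derive vs U) x v theta 0
  (measurable_cst _) k1 (cUvs vs) th0.
have E1 : \int[mu]_t iter_derive (v :: vs) U (x + t *: theta) =
  \int[mu]_t (cst 1 t * ('D_v (iter_derive vs U) (x + t *: theta) +
       t * 'D_0 (iter_derive vs U) (x + t *: theta))).
  by apply: eq_Rintegral => t _; rewrite derive0 mulr0 addr0 /= mul1r.
rewrite E1; have [_ <-] := d.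
rewrite (@near_eq_derive _ _ _ _ (cst 0)); first by rewrite derive_cst.
near=> s; rewrite /= -[RHS](IH (x + s *: v) _ a b th0); last first.
  rewrite (le_lt_trans (ler_normD _ _))// -ltrBrDl normrZ.
  rewrite (@le_lt_trans _ _ (`|s| * (`|v| + 1)))//.
    by rewrite ler_wpM2l// lerDl.
  rewrite -ltr_pdivlMr ?ltr_wpDl//.
  near: s; apply: near0_norm_lt.
  by rewrite divr_gt0 ?subr_gt0// ltr_wpDl.
by apply: eq_Rintegral => t _; rewrite mul1r scaler0 addr0.
Unshelve. all: by end_near. Qed.

(* The weight [t ^- m] cut off near 0, where the integrand vanishes anyway. *)
Let wt (rho : R) m (t : R) : R := if `|t| < rho then 0 else t ^- m.

Let wt_bounded rho m t : 0 < rho -> `|wt rho m t| <= rho ^- m.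
Proof.
move=> rho0; rewrite /wt; case: ltP => h.
  by rewrite normr0 invr_ge0 exprn_ge0// ltW.
have t0 : 0 < `|t| by exact: lt_le_trans h.
rewrite normfV normrX lef_pV2 ?posrE ?exprn_gt0//.
by rewrite lerXn2r// nnegrE// ltW.
Qed.

Let measurable_wt rho m : measurable_fun setT (wt rho m).
Proof.
apply: measurable_fun_ifT => //.
  by apply: measurable_fun_ltr => //; exact: measurableT_comp.
apply: (measurableT_comp measurable_inv).
by apply: measurable_funX.
Qed.

Let wtE rho m (theta : E) t vs : rho * `|theta| <= r ->
  t ^- m * iter_derive vs U (t *: theta) = wt rho m t * iter_derive vs U (t *: theta).
Proof.
move=> h; rewrite /wt; case: ltP => // tr; rewrite mul0r Uvs0 ?mulr0//.
rewrite normrZ.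
have [->|th0] := eqVneq theta 0; first by rewrite normr0 mulr0.
by rewrite (lt_le_trans _ h)// ltr_pM2r// normr_gt0.
Qed.

Let moment vs m (theta : E) : R := \int[mu]_t (t ^- m * iter_derive vs U (t *: theta)).

(** Differentiating in the direction lowers the order of the moment by one and
    adds one derivative to [U]. *)
Let moment_derive vs m theta v : theta != 0 ->
  is_derive (0 : R) 1 (fun s : R => moment vs m.+1 (theta + s *: v))
    (moment (v :: vs) m theta).
Proof.
move=> th0.
pose rho := r / (`|theta| + `|v| + 1).
have D0 : 0 < `|theta| + `|v| + 1 by rewrite ltr_wpDl ?addr_ge0.
have rho0 : 0 < rho by rewrite divr_gt0.
have hr s : `|s| <= 1 -> rho * `|theta + s *: v| <= r.
  move=> s1; rewrite /rho mulrAC ler_pdivrMr// ler_pM2l//.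
  rewrite (le_trans (ler_normD _ _))// -addrA lerD2l normrZ.
  by rewrite (@le_trans _ _ `|v|)// ?ler_piMl// lerDl.
have d := @is_derive_line_integral (rho ^- m.+1) (wt rho m.+1) M (iter_derive vs U) 0 0 theta v
  (@measurable_wt rho m.+1) (fun t => wt_bounded m.+1 t rho0) (cUvs vs) th0.
have -> : moment (v :: vs) m theta = \int[mu]_t (wt rho m.+1 t * ('D_0 (iter_derive vs U) (0 + t *: theta) +
       t * 'D_v (iter_derive vs U) (0 + t *: theta))).
  apply: eq_Rintegral => t _; rewrite derive0 !add0r.
  have := hr 0; rewrite normr0 ler01 scale0r addr0 => /(_ isT) h.
  have [->|t0] := eqVneq t 0.
    rewrite scale0r mul0r mulr0.
    have := Uvs0 (v :: vs) (x := 0); rewrite normr0 => /(_ r0) /= ->.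
    by rewrite mulr0.
  rewrite (wtE m t (v :: vs) h) /wt; case: ifP => _; first by rewrite !mul0r.
  rewrite /= mulrA; have -> : t ^- m.+1 * t = t ^- m by rewrite exprS invfM mulrAC mulVf// mul1r.
  by [].
apply: (near_eq_is_derive _ d).
near=> s; apply: eq_Rintegral => t _.
rewrite scaler0 addr0 add0r; apply/esym/wtE/hr.
by apply: ltW; near: s; exact: near0_norm_lt.
Unshelve. all: by end_near. Qed.

Let moment_scale vs m theta (c : R) : theta != 0 -> c != 0 ->
  moment vs m (c *: theta) = c ^+ m * `|c|^-1 * moment vs m theta.
Proof.
move=> th0 c0.
pose rho := r / `|theta|.
have nth0 : 0 < `|theta| by rewrite normr_gt0.
have h : rho * `|theta| <= r by rewrite /rho divfK// gt_eqF.
have fi : mu.-integrable setT (EFin \o (fun t => t ^- m * iter_derive vs U (t *: theta))).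
  rewrite (_ : (fun t => _) = (fun t => wt rho m t * iter_derive vs U (0 + t *: theta))).
    apply: (integrable_line 0 (@measurable_wt rho m) _ (cUvs vs) th0).
    by move=> t; apply: wt_bounded; rewrite divr_gt0.
  by apply/funext => t; rewrite (wtE m t vs h) add0r.
rewrite -mulrA -(Rintegral_affine1 0 c0 fi) -RintegralZl//; last first.
  exact: (integrable_affine1 0 c0 fi).
apply: eq_Rintegral => t _; rewrite addr0 scalerA mulrA; congr (_ * _ ).
  by rewrite exprMn invfM mulrA mulfV ?mul1r// expf_neq0.
by rewrite mulrC.
Qed.

(** By induction on [m] the moment of order [m + 1] has zero derivative in the direction.
    It is therefore the same at all multiples [c theta], since each of them is joined to
    a fixed transverse vector by a segment avoiding 0. It is also homogeneous, with factor
    [c ^ (m + 1) / |c|]: scaling by -1 shows that it vanishes for [m = 0], scaling by 2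
    for [m > 0]. *)
Let moment0 m : forall vs a b, a *: e + b *: w != 0 -> moment vs m (a *: e + b *: w) = 0.
Proof.
elim: m => [|m IH] vs a b th0.
  rewrite -[RHS](@line0 vs 0 _ _ _ th0) ?normr0//.
  by apply: eq_Rintegral => t _; rewrite expr0 invr1 mul1r add0r.
set theta := _ + _ in th0 *.
pose theta' := (- b) *: e + a *: w.
have ab : a ^+ 2 + b ^+ 2 != 0.
  apply: contra_neq th0 => /eqP; rewrite paddr_eq0 ?sqr_ge0// !sqrf_eq0.
  by move=> /andP[/eqP a0 /eqP b0]; rewrite /theta a0 b0 !scale0r addr0.
(* the line through a multiple of theta and theta' avoids the origin *)
have path c : c != 0 -> moment vs m.+1 (c *: theta) = moment vs m.+1 theta'.
  move=> c0.
  pose g s : E := c *: theta + s *: (theta' - c *: theta).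
  pose al s := (1 - s) * c * a - s * b.
  pose be s := (1 - s) * c * b + s * a.
  have gE s : g s = al s *: e + be s *: w.
    rewrite /g /theta /theta' /al /be !(scalerBr, scalerDr, scalerA, scalerBl, scalerDl, scalerN).
    apply/rowP => i; rewrite !mxE; ring.
  have g0 s : g s != 0.
    apply/eqP; rewrite gE => /ew[h1 h2].
    have : (1 - s) * c * (a ^+ 2 + b ^+ 2) = 0.
      rewrite -[RHS](mulr0 a) -h1 -[X in _ = X]addr0 -(mulr0 b) -h2 /al /be; ring.
    move=> /eqP; rewrite !mulf_eq0 (negbTE c0) (negbTE ab) !orbF subr_eq0 => /eqP s1.
    move: h1 h2; rewrite /al /be -s1 subrr !mul0r !mul1r sub0r add0r => /eqP.
    rewrite oppr_eq0 => /eqP b0 a0.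
    by move: ab; rewrite a0 b0 expr0n/= addr0 eqxx.
  rewrite (_ : c *: theta = g 0); last by rewrite /g scale0r addr0.
  rewrite (_ : theta' = g 1); last by rewrite /g scale1r addrC subrK.
  apply: (@is_derive_0_is_cst _ (fun s => moment vs m.+1 (g s))) => s.
  have := @moment_derive vs m (g s) (theta' - c *: theta) (g0 s).
  have -> : moment (theta' - c *: theta :: vs) m (g s) = 0.
    by rewrite gE; apply: IH; rewrite -gE; exact: g0.
  move=> d.
  have -> : (fun s => moment vs m.+1 (g s)) =
     (fun s' => moment vs m.+1 (g s + s' *: (theta' - c *: theta))) \o (fun s' => s' - s).
    apply/funext => s' /=; congr moment.
    by rewrite /g; apply/rowP => i; rewrite !mxE; ring.
  rewrite -[X in is_derive _ _ _ X](mul0r 1).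
  apply: is_derive1_comp; first by rewrite subrr.
  by apply: (is_derive_eq (is_deriveB (is_derive_id s 1) (is_derive_cst s s 1))); rewrite subr0.
have M1 : moment vs m.+1 theta = moment vs m.+1 theta'.
  by rewrite -[in LHS](scale1r theta); exact: (path 1 (oner_neq0 _)).
have sc c : c != 0 -> moment vs m.+1 theta = c ^+ m.+1 * `|c|^-1 * moment vs m.+1 theta.
  by move=> c0; rewrite -(moment_scale vs m.+1 th0 c0) (path c c0).
case: m {IH M1 path} sc => [|m] sc.
  have := sc (-1); rewrite oppr_eq0 oner_neq0 => /(_ isT).
  by rewrite normrN normr1 invr1 expr1 mulr1 => h; lra.
have := sc 2; rewrite pnatr_eq0 => /(_ isT).
rewrite ger0_norm// exprSr mulfK ?pnatr_eq0// => /eqP.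
rewrite -subr_eq0 -{1}[moment _ _ _]mul1r -mulrBl mulf_eq0 => /orP[|/eqP //].
rewrite subr_eq0 => /eqP h.
have : (1 : R) < 2 ^+ m.+1 by rewrite exprn_egt1// ltr1n.
by rewrite -h ltxx.
Qed.

Lemma ray_moments m : \int[mu]_t (t ^- m * U (t *: e)) = 0.
Proof.
have e0 : 1 *: e + 0 *: w != 0.
  by apply/eqP => /ew[/eqP]; rewrite oner_eq0.
by have := moment0 m [::] e0; rewrite scale1r scale0r addr0.
Qed.

End moments.

(** All inverse moments of [t |-> U (t e)] vanish, so this function is at most 0,
    and so is its opposite. *)
Lemma ray_vanish (M r : R) (U : E -> R) (e w : E) : 0 < r -> csmooth M U ->
  (forall x, `|x| < r -> U x = 0) ->
  (forall a b : R, a *: e + b *: w = 0 -> a = 0 /\ b = 0) ->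
  (forall x, `|x| < r -> forall a b : R, a *: e + b *: w != 0 ->
     \int[mu]_t U (x + t *: (a *: e + b *: w)) = 0) ->
  U e = 0.
Proof.
move=> r0 cU U0 ew Ul.
have e0 : e != 0.
  apply/eqP => e0; have := ew 1 0; rewrite e0 !scaler0 scale0r addr0.
  by move=> /(_ erefl)[/eqP]; rewrite oner_eq0.
have ne0 : 0 < `|e| by rewrite normr_gt0.
have le0 V : csmooth M V -> (forall x, `|x| < r -> V x = 0) ->
  (forall x, `|x| < r -> forall a b : R, a *: e + b *: w != 0 ->
     \int[mu]_t V (x + t *: (a *: e + b *: w)) = 0) -> V e <= 0.
  move=> cV V0 Vl; have [C _ hC] := csmooth_bounded cV.
  rewrite -(scale1r e).
  apply: (@inverse_moments_eq0 (fun t => V (t *: e)) C (r / `|e|) (`|M| / `|e|)).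
  - move=> t; apply: (@continuous_comp _ _ _ (fun t : R => t *: e) V).
      exact: scalel_continuous.
    by apply: smooth_continuous; case: cV.
  - by move=> t; exact: hC.
  - by rewrite divr_gt0.
  - by move=> t; rewrite ltr_pdivlMr// => tr; apply: V0; rewrite normrZ.
  - move=> t; rewrite ltr_pdivrMr// => tr; rewrite -[t *: e]add0r.
    by apply: (line_support cV); rewrite normr0 addr0.
  - exact: (@ray_moments M r V e w).
apply/eqP; rewrite eq_le le0//= -oppr_le0.
apply: (le0 (fun x => - U x)).
- split; first by apply: smoothN; case: cU.
  by move=> x xM; rewrite cU.2// oppr0.
- by move=> x xr; rewrite U0// oppr0.
- move=> x xr a b ab.
  rewrite -[RHS](mulr0 (-1)) -(Ul x xr a b ab) -RintegralZl//; last first.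
    have := @integrable_line 1 (cst 1) M U x _ (measurable_cst _) _ cU ab.
    rewrite (_ : (fun t => _) = (fun t => U (x + t *: (a *: e + b *: w)))); last first.
      by apply/funext => t; rewrite /= mul1r.
    by apply => t; rewrite normr1.
  by apply: eq_Rintegral => t _; rewrite mulN1r.
Qed.

End line_integrals.

(** * Closed near a point and invisible there implies closed everywhere *)

Lemma continuous_affine (R : realType) (W : normedModType R) (c : R) (b : W) :
  continuous (fun x => c *: x + b).
Proof.
move=> x; apply: cvgD; last exact: cvg_cst.
exact: scaler_continuous.
Qed.

Section vector_fields.
Context {R : realType} {n : nat}.
Local Notation E := 'rV[R]_n.
Local Notation mu := (@lebesgue_measure R).
Implicit Types (x y v w : E) (g : 'I_n -> E -> R).

(** The one-form [g] evaluated on the constant vector [v]. *)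
Definition along g v x : R := \sum_(j < n) v ord0 j * g j x.

Lemma csmoothB M (u1 u2 : E -> R) : csmooth M u1 -> csmooth M u2 ->
  csmooth M (fun x => u1 x - u2 x).
Proof.
move=> [s1 z1] [s2 z2]; split; first exact: smoothB.
by move=> x xM; rewrite z1// z2// subr0.
Qed.

Lemma csmooth_along M g v : (forall i, csmooth M (g i)) -> csmooth M (along g v).
Proof.
move=> cg; split.
  apply: (@smooth_sum _ _ _ _ (fun j x => v ord0 j * g j x)) => j.
  by apply: smoothZ; case: (cg j).
by move=> x xM; rewrite /along big1// => j _; case: (cg j) => _ ->//; rewrite mulr0.
Qed.

Lemma csmooth_shift M (u : E -> R) x0 : csmooth M u ->
  csmooth (M + `|x0|) (fun x => u (x0 + x)).
Proof.
move=> [su u0]; split.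
  apply: (@smooth_comp_affine _ _ _ (fun x => x0 + x) id _ _ _ su).
    rewrite (_ : (fun x => _) = (fun x => 1 *: x + x0)); first exact: continuous_affine.
    by apply/funext => x; rewrite scale1r addrC.
  by move=> x v h; rewrite addrA.
move=> x xM; apply: u0 => h; apply: xM => i.
rewrite -(addKr (x0 ord0 i) (x ord0 i)) addrC (le_trans (ler_normB _ _))//.
by rewrite lerD ?ler_norm_coord//; have := h i; rewrite mxE.
Qed.

Lemma line_const_integrable M (u : E -> R) x v : csmooth M u -> v != 0 ->
  mu.-integrable setT (EFin \o (fun t => u (x + t *: v))).
Proof.
move=> cu v0.
have -> : (fun t => u (x + t *: v)) = (fun t => cst 1 t * u (x + t *: v)).
  by apply/funext => t; rewrite mul1r.
by apply: (integrable_line (K := 1) x _ _ cu v0) => // t; rewrite normr1.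
Qed.

(** The double sum makes the antisymmetrization in [v] and [w] visible as the curl. *)
Lemma derive_along M (g : 'I_n -> E -> R) v w x : (forall i, csmooth M (g i)) ->
  'D_v (along g w) x = \sum_i \sum_j v ord0 i * (w ord0 j * partial i (g j) x).
Proof.
move=> cg; rewrite smooth_derive_partial; last by case: (csmooth_along w cg).
apply: eq_bigr => i _; rewrite -mulr_sumr; congr (_ * _).
rewrite /partial (_ : along g w = \sum_j (w ord0 j *: g j)); last first.
  by apply/funext => z; rewrite /along fct_sumE.
rewrite derive_sum; last first.
  by move=> j; apply: derivableZ; apply: smooth_derivable; case: (cg j).
by apply: eq_bigr => j _; rewrite deriveZ//; apply: smooth_derivable; case: (cg j).
Qed.

Section closed.
Variables (M r : R) (g : 'I_n -> E -> R) (x0 : E).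
Hypotheses (r0 : 0 < r) (cg : forall i, csmooth M (g i)).
Hypothesis closed0 : forall x, `|x - x0| < r -> forall i j,
  partial i (g j) x = partial j (g i) x.
Hypothesis rays0 : forall x, `|x - x0| < r -> forall v, v != 0 ->
  \int[mu]_t along g v (x + t *: v) = 0.

Let T v w x := 'D_v (along g w) x.

Let TE v w x : T v w x = \sum_i \sum_j v ord0 i * (w ord0 j * partial i (g j) x).
Proof. exact: derive_along. Qed.

Let Tlin1 a b v v' w x : T (a *: v + b *: v') w x = a * T v w x + b * T v' w x.
Proof.
have s := (csmooth_along w cg).1.
by rewrite /T smooth_deriveD// !smooth_deriveZ.
Qed.

Let Tlin2 a b v w w' x : T v (a *: w + b *: w') x = a * T v w x + b * T v w' x.
Proof.
rewrite !TE !mulr_sumr -big_split; apply: eq_bigr => i _ /=.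
rewrite !mulr_sumr -big_split; apply: eq_bigr => j _ /=.
by rewrite !mxE; ring.
Qed.

Let F e w x := T e w x - T w e x.

Let cF e w : csmooth M (F e w).
Proof.
by apply: csmoothB; apply: csmooth_derive; exact: csmooth_along.
Qed.

Let F0 e w x : `|x - x0| < r -> F e w x = 0.
Proof.
move=> xr; rewrite /F !TE; apply/eqP; rewrite subr_eq0; apply/eqP.
rewrite exchange_big; apply: eq_bigr => i _; apply: eq_bigr => j _ /=.
by rewrite (closed0 xr) mulrCA.
Qed.

(* Differentiate the vanishing line integrals transversally, and use that
   the derivative of a compactly supported function along a line integrates
   to zero. *)
Let ray_curl v th x : `|x - x0| < r -> th != 0 ->
  \int[mu]_t F v th (x + t *: th) = 0.
Proof.
move=> xr th0.
have k1 (t : R) : `|cst 1 t : R| <= 1 by rewrite normr1.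
have cgt := csmooth_along th cg; have cgv := csmooth_along v cg.
have i1 := line_const_integrable x (csmooth_derive v cgt) th0.
have i2 := line_const_integrable x (csmooth_derive th cgv) th0.
rewrite [LHS](RintegralB measurableT i1 i2).
have d1 := @is_derive_line_integral R n 1 (cst 1) M _ x v th 0
  (measurable_cst _) k1 cgt th0.
have d2 := @is_derive_line_integral R n 1 (cst 1) M _ x th th 0
  (measurable_cst _) k1 cgv th0.
have E1 u : csmooth M u -> forall v', \int[mu]_t 'D_v' u (x + t *: th) =
  \int[mu]_t (cst 1 t * ('D_v' u (x + t *: th) + t * 'D_0 u (x + t *: th))).
  by move=> cu v'; apply: eq_Rintegral => t _; rewrite derive0 mulr0 addr0 /= mul1r.
rewrite (E1 _ cgt v) (E1 _ cgv th) -(@derive_val _ _ _ _ _ _ _ d1) -(@derive_val _ _ _ _ _ _ _ d2).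
rewrite [X in X - _](@near_eq_derive _ _ _ _ (cst 0)); last first.
  near=> s; rewrite /= -[RHS](rays0 (x := x + s *: v) _ th0).
    by apply: eq_Rintegral => t _; rewrite mul1r scaler0 addr0.
  rewrite addrAC (le_lt_trans (ler_normD _ _))// -ltrBrDl normrZ.
  rewrite (@le_lt_trans _ _ (`|s| * (`|v| + 1)))//.
    by rewrite ler_wpM2l// lerDl.
  rewrite -ltr_pdivlMr ?ltr_wpDl//.
  near: s; apply: near0_norm_lt.
  by rewrite divr_gt0 ?subr_gt0// ltr_wpDl.
rewrite derive_cst sub0r.
rewrite (_ : (fun s : R => _) = cst (\int[mu]_t along g v (x + t *: th))); last first.
  apply/funext => s.
  have i3 := line_const_integrable x cgv th0.
  have := Rintegral_affine1 s (oner_neq0 R) i3.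
  rewrite normr1 invr1 mul1r /= => <-; apply: eq_Rintegral => t _ /=.
  by rewrite mul1r mul1r scaler0 addr0 scalerDl -addrA (addrC (t *: th)).
by rewrite derive_cst oppr0.
Unshelve. all: by end_near. Qed.

(** On the plane of [e] and [w], [F e w] satisfies the hypotheses of [ray_vanish]
    at [x]: the field is closed near [x] and the line integrals of [F] vanish for all
    lines in the plane. If [e] and [w] are dependent, [F e w] is 0 by antisymmetry. *)
Let F_ray e w x : `|x - x0| < r -> F e w (x + e) = 0.
Proof.
move=> xr.
have [ew|] := pselect (forall a b : R, a *: e + b *: w = 0 -> a = 0 /\ b = 0); last first.
  move=> /existsNP[a /existsNP[b /not_implyP[ab0 nab]]].
  have h (c : R) : c != 0 -> c * F e w (x + e) = 0 -> F e w (x + e) = 0.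
    by move=> c0 /eqP; rewrite mulf_eq0 (negbTE c0) => /eqP.
  have Tz1 v y : T 0 v y = 0 by rewrite /T derive0.
  have Tz2 v y : T v 0 y = 0.
    by have := Tlin2 0 0 v 0 0 y; rewrite !scale0r !mul0r !addr0.
  have ha : a * F e w (x + e) = 0.
    have h1 : a * T e w (x + e) + b * T w w (x + e) = 0 by rewrite -Tlin1 ab0 Tz1.
    have h2 : a * T w e (x + e) + b * T w w (x + e) = 0 by rewrite -Tlin2 ab0 Tz2.
    by rewrite /F mulrBr; lra.
  have hb : b * F e w (x + e) = 0.
    have h1 : a * T e e (x + e) + b * T w e (x + e) = 0 by rewrite -Tlin1 ab0 Tz1.
    have h2 : a * T e e (x + e) + b * T e w (x + e) = 0 by rewrite -Tlin2 ab0 Tz2.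
    by rewrite /F mulrBr; lra.
  have [a0|a0] := eqVneq a 0; last exact: h ha.
  have [b0|b0] := eqVneq b 0; last exact: h hb.
  by case: nab.
pose r' := r - `|x - x0|.
have near y : `|y| < r' -> `|x + y - x0| < r.
  by move=> yr; rewrite addrAC (le_lt_trans (ler_normD _ _))// -ltrBrDl.
apply: (@ray_vanish R n _ r' (fun y => F e w (x + y)) e w).
- by rewrite subr_gt0.
- exact: csmooth_shift (cF e w).
- by move=> y /near; exact: F0.
- exact: ew.
- move=> y /near xyr a b th0.
  have h1 := ray_curl e xyr th0; have h2 := ray_curl w xyr th0.
  have iF : mu.-integrable setT
      (EFin \o (fun t => F e w (x + (y + t *: (a *: e + b *: w))))).
    rewrite (_ : (fun t => _) = (fun t => F e w ((x + y) + t *: (a *: e + b *: w)))).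
      exact: (line_const_integrable (x + y) (cF e w) th0).
    by apply/funext => t; rewrite addrA.
  have hb : b * \int[mu]_t F e w (x + (y + t *: (a *: e + b *: w))) = 0.
    rewrite -(RintegralZl b measurableT iF) -[RHS]h1.
    by apply: eq_Rintegral => t _; rewrite addrA /F Tlin2 Tlin1; ring.
  have ha : (- a) * \int[mu]_t F e w (x + (y + t *: (a *: e + b *: w))) = 0.
    rewrite -(RintegralZl (- a) measurableT iF) -[RHS]h2.
    by apply: eq_Rintegral => t _; rewrite addrA /F Tlin2 Tlin1; ring.
  have [b0|b0] := eqVneq b 0; last first.
    by move: hb => /eqP; rewrite mulf_eq0 (negbTE b0) => /eqP.
  have [a0|a0] := eqVneq a 0.
    by exfalso; move/eqP: th0; apply; rewrite a0 b0 !scale0r addr0.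
  by move: ha => /eqP; rewrite mulf_eq0 oppr_eq0 (negbTE a0) => /eqP.
Qed.

(** Each point [x] is reached from a base point [x0 + s d_i] near [x0] by the vector
    [e = x - x0 - s d_i], at which [F_ray] gives the curl on [e] and any [w]. Moving
    [s] varies [e] in the direction [d_i], and subtracting isolates the component
    [(i, j)]. *)
Lemma closed_everywhere x i j : partial i (g j) x = partial j (g i) x.
Proof.
pose di : E := delta_mx ord0 i; pose dj : E := delta_mx ord0 j.
have h (s : R) : `|s| < r -> F (x - x0 - s *: di) dj x = 0.
  move=> sr; set e := x - x0 - s *: di.
  have hx : (x0 + s *: di) + e = x by apply/rowP => k; rewrite !mxE; ring.
  have hs : `|x0 + s *: di - x0| < r.
    rewrite addrAC subrr add0r normrZ (le_lt_trans _ sr)// ler_piMr//.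
    apply: (rV_norm_le _ _).2 => // k.
    by rewrite !mxE; case: (_ && _); rewrite ?normr0 ?normr1.
  by have := F_ray e dj hs; rewrite hx.
have r20 : 0 < r / 2 by rewrite divr_gt0.
have h1 : F (x - x0 - (r / 2) *: di) dj x = 0.
  by apply: h; rewrite gtr0_norm// ltr_pdivrMr// ltr_pMr// ltr1n.
have h0 : F (x - x0) dj x = 0.
  have := h 0; rewrite normr0 => /(_ r0) <-; congr (F _ dj x).
  by rewrite scale0r subr0.
have : (r / 2) * F di dj x = 0.
  have e1 : x - x0 - (r / 2) *: di = 1 *: (x - x0) + (- (r / 2)) *: di.
    by rewrite scale1r scaleNr.
  move: h1; rewrite e1 /F Tlin1 Tlin2; move: h0; rewrite /F; lra.
move=> /eqP; rewrite mulf_eq0 (gt_eqF r20) orFb /F /T.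
have along_delta k : along g (delta_mx ord0 k) = g k.
  apply/funext => z; rewrite /along (bigD1 k)//= big1 ?addr0; last first.
    by move=> l lk; rewrite mxE eqxx (negbTE lk) mul0r.
  by rewrite mxE !eqxx mul1r.
by rewrite !along_delta subr_eq0 => /eqP.
Qed.

End closed.
End vector_fields.

(** * The X-ray pairing *)

Section sphere_integral.
Context {R : realType} {n : nat}.
Local Notation E := 'rV[R]_n.
Implicit Types (x y theta : E).

Lemma enorm_ge0 x : 0 <= enorm x.
Proof. exact: sqrtr_ge0. Qed.

Lemma dot_ge0 x : 0 <= dot x x.
Proof. by apply: sumr_ge0 => i _; rewrite -expr2 sqr_ge0. Qed.

Lemma enorm_sqr x : enorm x ^+ 2 = dot x x.
Proof. by rewrite /enorm sqr_sqrtr// dot_ge0. Qed.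

Lemma coord_le_enorm x i : `|x ord0 i| <= enorm x.
Proof.
rewrite -(@ler_pXn2r _ 2)// ?nnegrE ?enorm_ge0// enorm_sqr real_normK ?num_real//.
rewrite /dot (bigD1 i)//= -expr2 lerDl; apply: sumr_ge0 => j _.
by rewrite -expr2 sqr_ge0.
Qed.

Lemma norm_le_enorm x : `|x| <= enorm x.
Proof.
by apply: (rV_norm_le _ (enorm_ge0 x)).2 => i; exact: coord_le_enorm.
Qed.

Lemma enorm_gt0 x : x != 0 -> 0 < enorm x.
Proof. by move=> x0; rewrite (lt_le_trans _ (norm_le_enorm x))// normr_gt0. Qed.

Lemma enormZ (c : R) x : enorm (c *: x) = `|c| * enorm x.
Proof.
rewrite /enorm (_ : dot (c *: x) (c *: x) = c ^+ 2 * dot x x).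
  by rewrite sqrtrM ?sqr_ge0// sqrtr_sqr.
by rewrite /dot mulr_sumr; apply: eq_bigr => i _; rewrite !mxE; ring.
Qed.

Lemma enorm_direction x : x != 0 -> enorm (direction x) = 1.
Proof.
move=> /enorm_gt0 x0; rewrite /direction enormZ ger0_norm ?invr_ge0 ?enorm_ge0//.
by rewrite mulVf// gt_eqF.
Qed.

Lemma norm_sphere_ge theta : enorm theta = 1 -> 1 <= n%:R * `|theta|.
Proof.
move=> t1.
have h : 1 <= n%:R * `|theta| ^+ 2.
  have t2 : dot theta theta = 1 by rewrite -enorm_sqr t1 expr1n.
  rewrite -[leLHS]t2 /dot.
  rewrite (_ : n%:R * _ = \sum_(i < n) `|theta| ^+ 2); last first.
    by rewrite sumr_const card_ord mulr_natl.
  apply: ler_sum => i _; rewrite -expr2 -[leLHS]real_normK ?num_real//.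
  by rewrite lerXn2r ?nnegrE// ler_norm_coord.
have le1 : `|theta| <= 1 by rewrite -t1 norm_le_enorm.
rewrite (le_trans h)// ler_wpM2l// expr2 ler_piMr//.
Qed.

Lemma continuous_dot : continuous (fun p : E * E => dot p.1 p.2).
Proof.
rewrite /dot (_ : (fun p => _) = \sum_(i < n) (fun p : E * E => p.1 ord0 i * p.2 ord0 i)); last first.
  by apply/funext => p; rewrite fct_sumE.
elim/big_ind: _ => [|f g cf cg|i _].
- exact: cst_continuous.
- by move=> p; apply: cvgD; [exact: cf|exact: cg].
- move=> p; apply: cvgM.
    apply: (@continuous_comp _ _ _ (fun p : E * E => p.1) (fun x : E => x ord0 i)).
      exact: cvg_fst.
    exact: continuous_coord.
  apply: (@continuous_comp _ _ _ (fun p : E * E => p.2) (fun x : E => x ord0 i)).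
    exact: cvg_snd.
  exact: continuous_coord.
Qed.

(** The punctured unit ball: the cone over the whole sphere in the definition of
    [surface_measure]. *)
Definition polar_dom : set E := unit_ball `&` direction @^-1` sphere.

Lemma polar_domE y : polar_dom y <-> unit_ball y /\ y != 0.
Proof.
split=> [[yB ys]|[yB /enorm_direction y0]]; last by split.
split => //; apply: contraPneq ys => -> /=.
rewrite /sphere /= /direction scaler0 /enorm (_ : dot 0 0 = 0) ?sqrtr0.
  by move/esym/eqP; rewrite oner_eq0.
by rewrite /dot big1// => i _; rewrite mxE mul0r.
Qed.

Lemma measurable_sphere : measurable (@sphere R n).
Proof.
rewrite (_ : sphere = enorm @^-1` [set 1])//.
by rewrite -[X in measurable X]setTI; apply: measurable_enorm => //; exact: measurable_set1.
Qed.

Lemma measurable_polar_dom : measurable polar_dom.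
Proof.
apply: measurableI; first exact: measurable_unit_ball.
rewrite -[X in measurable X]setTI; apply: measurable_direction => //.
exact: measurable_sphere.
Qed.

Lemma polar_dom_fin : (leb_rV polar_dom < +oo)%E.
Proof.
apply: (le_lt_trans _ (@leb_rV_cube R n 1)); apply: le_measure.
- by rewrite inE; exact: measurable_polar_dom.
- by rewrite inE; exact: measurable_cube.
- by move=> y [yB _] i; rewrite (le_trans (coord_le_enorm y i)).
Qed.

Let ge0_surface_integral (h : E -> \bar R) : measurable_fun setT h ->
  (forall y, (0 <= h y)%E) ->
  (\int[surface_measure]_(theta in sphere) h theta =
   n%:R%:E * \int[leb_rV]_(y in polar_dom) h (direction y))%E.
Proof.
move=> mh h0.
rewrite ge0_integral_mscale//; last 2 first.
- exact: measurable_sphere.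
- exact: measurable_funTS.
congr (_ * _)%E.
have mN : measurable (~` (@unit_ball R n)) by apply: measurableC; exact: measurable_unit_ball.
transitivity (\int[mrestr leb_rV (@measurable_unit_ball R n)]_(y in direction @^-1` sphere) h (direction y))%E.
  rewrite ge0_integral_pushforward//.
  - exact: measurable_direction.
  - exact: measurable_sphere.
  - exact: measurable_funTS.
have mP : measurable (direction @^-1` (@sphere R n)).
  rewrite -[X in measurable X]setTI; apply: measurable_direction => //.
  exact: measurable_sphere.
have mhd : measurable_fun setT (h \o direction).
  exact: measurableT_comp mh (@measurable_direction R n).
rewrite (ge0_negligible_integral mN mP)//; last 2 first.
- exact: measurable_funTS mhd.
- by rewrite /= /mrestr setIC setICr measure0.
rewrite (_ : _ `\` _ = polar_dom); last first.
  by rewrite /polar_dom setDE setCK setIC.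
apply: eq_measure_integral => A mA Ap.
rewrite /= /mrestr setIidl// => y /Ap[]//.
Qed.

Lemma surface_Rintegral (h : E -> R) :
  measurable_fun setT h ->
  leb_rV.-integrable setT (EFin \o (fun y => \1_polar_dom y * h (direction y))) ->
  \int[surface_measure]_(theta in sphere) h theta =
  n%:R * \int[leb_rV]_y (\1_polar_dom y * h (direction y)).
Proof.
move=> mh ih.
have E1 : (\int[leb_rV]_y (\1_polar_dom y * h (direction y))%:E =
    \int[leb_rV]_(y in polar_dom) (h (direction y))%:E)%E.
  rewrite [RHS]integral_mkcond; apply: eq_integral => y _.
  by rewrite patchE indicE; case: ifP => _; rewrite ?mul1r ?mul0r.
have ih' : leb_rV.-integrable polar_dom (EFin \o (h \o direction)).
  apply/(integrable_mkcond _ measurable_polar_dom).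
  move: ih; congr (is_true (integrable _ _ _)); apply/funext => y /=.
  by rewrite patchE indicE; case: ifP => _; rewrite ?mul1r ?mul0r.
rewrite /Rintegral E1 integralE [in RHS]integralE.
have mE : measurable_fun setT (EFin \o h) by exact/measurable_EFinP.
rewrite !ge0_surface_integral//; [|exact: measurable_funeneg|exact: measurable_funepos].
have p1 := integrable_pos_fin_num measurable_polar_dom ih'.
have p2 := integrable_neg_fin_num measurable_polar_dom ih'.
have -> : (\int[leb_rV]_(y in polar_dom) (EFin \o h)^\+ (direction y) =
  \int[leb_rV]_(y in polar_dom) (EFin \o (h \o direction))^\+ y)%E.
  by apply: eq_integral => y _; rewrite !funeposE.
have -> : (\int[leb_rV]_(y in polar_dom) (EFin \o h)^\- (direction y) =
  \int[leb_rV]_(y in polar_dom) (EFin \o (h \o direction))^\- y)%E.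
  by apply: eq_integral => y _; rewrite !funenegE.
rewrite -muleBr//; last by rewrite fin_num_adde_defr.
by rewrite fineM// fin_numB p1 p2.
Qed.

End sphere_integral.

Section line_functions.
Context {R : realType} {n : nat}.
Local Notation E := 'rV[R]_n.
Local Notation mu := (@lebesgue_measure R).
Implicit Types (x y z theta : E) (u : E -> R) (k : R -> R).

(** As a function of the pair (point, direction) this is smooth on the whole ambient
    space, because the weight has bounded support; so it serves as a
    factor of test functions on the manifold of lines. *)
Definition line_average x1 k u (p : E * E) : R :=
  \int[mu]_t (k t * u (x1 + t *: p.2 - p.1)).

Definition line_weight k := measurable_fun setT k /\
  exists K T : R, [/\ 0 <= K, 0 <= T, forall t, `|k t| <= K & forall t, T < `|t| -> k t = 0].

Lemma line_weightX k : line_weight k -> line_weight (fun t => t * k t).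
Proof.
move=> [mk [K [T [K0 T0 kK kT]]]]; split; first exact: measurable_funM.
exists (T * K), T; split; rewrite ?mulr_ge0//.
- move=> t; have [tT|tT] := leP `|t| T; first by rewrite normrM ler_pM.
  by rewrite kT// mulr0 normr0 mulr_ge0.
- by move=> t /kT ->; rewrite mulr0.
Qed.

Lemma line_average_integrable x1 M k u (p : E * E) : line_weight k -> csmooth M u ->
  mu.-integrable setT (EFin \o (fun t => k t * u (x1 + t *: p.2 - p.1))).
Proof.
move=> [mk [K [T [K0 T0 kK kT]]]] cu; have [C C0 uC] := csmooth_bounded cu.
apply: (@integrable_bounded_itv R _ (K * C) T).
- apply: measurable_funM => //.
  rewrite (_ : (fun t => _) = (fun t => u ((x1 - p.1) + t *: p.2))).
    apply: measurableT_comp; last exact: measurable_line.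
    by case: cu => su _; exact: smooth_measurable.
  by apply/funext => t; rewrite addrAC.
- by move=> t; rewrite normrM ler_pM.
- by move=> t /kT ->; rewrite mul0r.
Qed.

Lemma continuous_line_average x1 M k u : line_weight k -> csmooth M u ->
  continuous (line_average x1 k u).
Proof.
move=> wk cu; have [L L0 hL] := csmooth_lipschitz cu.
have [mk [K [T [K0 T0 kK kT]]]] := wk.
pose G (t : R) := if `|t| <= T then K * L * (T + 1) else 0.
apply: (@lipschitz_continuousW _ _ _ (\int[mu]_t G t)) => p q.
have i1 := line_average_integrable x1 p wk cu.
have i2 := line_average_integrable x1 q wk cu.
rewrite /line_average -RintegralB// mulrC -RintegralZl//; last exact: integrable_itv_cst.
apply: ler_norm_Rintegral.
- exact: integrableB_R.
- by apply: integrableZ_R; exact: integrable_itv_cst.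
- move=> t; rewrite /G; case: ifPn => [tT|]; last first.
    by rewrite -ltNge => /kT ->; rewrite !mul0r subrr normr0 mulr0.
  rewrite -mulrBr normrM.
  have -> : `|p - q| * (K * L * (T + 1)) = K * (L * ((T + 1) * `|p - q|)) by ring.
  rewrite ler_pM// (le_trans (hL _ _))// ler_wpM2l//.
  have -> : x1 + t *: p.2 - p.1 - (x1 + t *: q.2 - q.1) = t *: (p.2 - q.2) - (p.1 - q.1).
    by apply/rowP => i; rewrite !mxE; ring.
  have h1 : `|p.1 - q.1| <= `|p - q|.
    by rewrite [leRHS]prod_normE /= le_max lexx.
  have h2 : `|p.2 - q.2| <= `|p - q|.
    by rewrite [leRHS]prod_normE /= le_max lexx orbT.
  rewrite (le_trans (ler_normB _ _))// mulrDl mul1r lerD// normrZ.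
  by rewrite ler_pM.
Qed.

Lemma is_derive_line_average x1 M k u (p v : E * E) : line_weight k -> csmooth M u ->
  is_derive p v (line_average x1 k u)
    (line_average x1 (fun t => t * k t) (fun x => 'D_(v.2) u x) p +
     line_average x1 k (fun x => 'D_(- v.1) u x) p).
Proof.
move=> wk cu; have su := cu.1.
have [mk [K [T [K0 T0 kK kT]]]] := wk.
have c2 := csmooth_derive v.2 cu; have c1 := csmooth_derive (- v.1) cu.
have [C2 C20 h2] := csmooth_bounded c2; have [C1 C10 h1] := csmooth_bounded c1.
pose P s t := x1 + t *: (p + s *: v).2 - (p + s *: v).1.
have PE s t : P s t = (x1 + t *: p.2 - p.1) + s *: (t *: v.2 + - v.1).
  by apply/rowP => i; rewrite !mxE; ring.
have -> : line_average x1 (fun t => t * k t) (fun x => 'D_(v.2) u x) p +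
     line_average x1 k (fun x => 'D_(- v.1) u x) p =
   \int[mu]_t (k t * (t * 'D_(v.2) u (P 0 t) + 'D_(- v.1) u (P 0 t))).
  rewrite /line_average -(RintegralD measurableT
    (line_average_integrable x1 p (line_weightX wk) c2)
    (line_average_integrable x1 p wk c1)).
  by apply: eq_Rintegral => t _; rewrite PE scale0r addr0; ring.
apply: is_derive_line0; rewrite /line_average.
apply: (@derive_under_Rintegral _ _ _ mu (fun s t => k t * u (P s t))
  (fun s t => k t * (t * 'D_(v.2) u (P s t) + 'D_(- v.1) u (P s t)))
  (fun t => if `|t| <= T then K * (T * C2 + C1) else 0) 1).
- exact: ltr01.
- by move=> s _; exact: (line_average_integrable x1 (p + s *: v) wk cu).
- move=> s t _.
  have h : is_derive s 1 (fun s => u (P s t)) (t * 'D_(v.2) u (P s t) + 'D_(- v.1) u (P s t)).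
    rewrite (_ : (fun s => _) = (fun s => u ((x1 + t *: p.2 - p.1) + s *: (t *: v.2 + - v.1)))); last first.
      by apply/funext => s'; rewrite PE.
    apply: is_derive_line; rewrite -PE -smooth_deriveZ// -smooth_deriveD//.
    exact: smooth_is_derive.
  exact: (is_deriveZ (k t) h).
- exact: integrable_itv_cst.
- move=> s t _; case: ifPn => [tT|]; last first.
    by rewrite -ltNge => /kT ->; rewrite mul0r normr0.
  rewrite normrM ler_pM// (le_trans (ler_normD _ _))// lerD//.
  by rewrite normrM ler_pM.
Qed.

Inductive line_averages x1 : (E * E -> R) -> Prop :=
| LAbase M k u : line_weight k -> csmooth M u -> line_averages x1 (line_average x1 k u)
| LAadd f g : line_averages x1 f -> line_averages x1 g -> line_averages x1 (fun p => f p + g p).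

Lemma smooth_line_average x1 M k u : line_weight k -> csmooth M u ->
  smooth (line_average x1 k u).
Proof.
move=> wk cu; apply: (@smooth_coind _ _ (line_averages x1)); last exact: LAbase wk cu.
move=> w; elim => {w k u M wk cu} [M k u wk cu|f g _ [cf df] _ [cg dg]].
  split; first exact: continuous_line_average wk cu.
  move=> v; split; first by move=> p; have [] := is_derive_line_average x1 p v wk cu.
  rewrite (_ : (fun p => _) = (fun p => line_average x1 (fun t => t * k t) (fun x => 'D_(v.2) u x) p +
     line_average x1 k (fun x => 'D_(- v.1) u x) p)).
    apply: LAadd.
      exact: LAbase (line_weightX wk) (csmooth_derive v.2 cu).
    exact: LAbase wk (csmooth_derive (- v.1) cu).
  by apply/funext => p; exact: (@derive_val _ _ _ _ _ _ _ (is_derive_line_average x1 p v wk cu)).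
split; first by move=> p; apply: cvgD; [exact: cf|exact: cg].
move=> v; have [df1 df2] := df v; have [dg1 dg2] := dg v.
split; first by move=> p; exact: derivableD.
rewrite (_ : (fun p => _) = (fun p => 'D_v f p + 'D_v g p)); first exact: LAadd.
by apply/funext => p; rewrite deriveD.
Qed.

End line_functions.

Section pairing.
Context {R : realType} {n : nat}.
Local Notation E := 'rV[R]_n.
Implicit Types (x y theta : E) (psi : E * E -> R).

Lemma measurable_fun_dot d (T : measurableType d) (f g : T -> E) :
  measurable_fun setT f -> measurable_fun setT g ->
  measurable_fun setT (fun t => dot (f t) (g t)).
Proof.
move=> mf mg; apply: measurable_sum => i; apply: measurable_funM.
- exact: (measurableT_comp (measurable_coord i) mf).
- exact: (measurableT_comp (measurable_coord i) mg).
Qed.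

Lemma dot_sum_le x y : `|dot x y| <= n%:R * (`|x| * `|y|).
Proof.
rewrite (le_trans (ler_norm_sum _ _ _))//.
rewrite (_ : n%:R * _ = \sum_(i < n) (`|x| * `|y|)); last first.
  by rewrite sumr_const card_ord mulr_natl.
by apply: ler_sum => i _; rewrite normrM ler_pM// ler_norm_coord.
Qed.

Lemma dotBl x y z : dot (x - y) z = dot x z - dot y z.
Proof.
by rewrite /dot -sumrB; apply: eq_bigr => i _; rewrite !mxE mulrBl.
Qed.

Lemma dotZl (c : R) x y : dot (c *: x) y = c * dot x y.
Proof. by rewrite /dot mulr_sumr; apply: eq_bigr => i _; rewrite !mxE mulrA. Qed.

(** The line through [x] with direction [theta], in the parametrization of the
    manifold of lines. *)
Definition line_through x theta : E * E := (x - dot x theta *: theta, theta).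

Lemma line_throughP x theta : sphere theta -> line_manifold (line_through x theta).
Proof.
move=> t1; split => //=.
by rewrite dotBl dotZl -[dot theta theta]enorm_sqr t1 expr1n mulr1 subrr.
Qed.

Lemma measurable_line_through d (T : measurableType d) (f g : T -> E) :
  measurable_fun setT f -> measurable_fun setT g ->
  measurable_fun setT (fun t => line_through (f t) (g t)).
Proof.
move=> mf mg; apply/measurable_fun_pair => //=.
apply: measurable_fun_rV => i; under eq_fun do rewrite !mxE.
apply: measurable_funB; first exact: (measurableT_comp (measurable_coord i) mf).
apply: measurable_funM; first exact: measurable_fun_dot.
exact: (measurableT_comp (measurable_coord i) mg).
Qed.

Section bounded_psi.
Variables (psi : E * E -> R) (C : R).
Let psi0 := psi \_ line_manifold.
Hypotheses (mpsi : measurable_fun setT psi0) (psiC : forall p, `|psi0 p| <= C).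

Let D := @polar_dom R n.

Let dir1 y i : `|\1_D y * direction y ord0 i| <= \1_D y.
Proof.
rewrite indicE; have [|] := boolP (y \in D); last by rewrite mul0r normr0.
rewrite inE mul1r => -[_ y1]; rewrite (le_trans (coord_le_enorm _ _))//.
by rewrite [leLHS]y1.
Qed.

Let integrable_D : leb_rV.-integrable setT (EFin \o (fun y : E => \1_D y * C)).
Proof.
have mD := @measurable_polar_dom R n.
apply: (@integrable_bounded_support _ _ _ _ D C) => //.
- exact: polar_dom_fin.
- by apply: measurable_funM => //; exact: measurable_indic.
- move=> y Dy; rewrite indicE mem_set// mul1r ger0_norm//.
  exact: le_trans (psiC (0, 0)).
- by move=> y Dy; rewrite indicE memNset// mul0r.
Qed.

Let kern i (p : E * E) : R :=
  \1_D p.2 * direction p.2 ord0 i * psi0 (line_through p.1 (direction p.2)).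

Let measurable_kern i : measurable_fun setT (kern i).
Proof.
have md : measurable_fun setT (fun p : E * E => direction p.2).
  exact: measurableT_comp (@measurable_direction R n) measurable_snd.
apply: measurable_funM; first apply: measurable_funM.
- apply: (measurableT_comp _ measurable_snd).
  by apply: measurable_indic; exact: measurable_polar_dom.
- exact: (measurableT_comp (measurable_coord i) md).
- exact: (measurableT_comp mpsi (measurable_line_through measurable_fst md)).
Qed.

Let kern_le i x y : `|kern i (x, y)| <= \1_D y * C.
Proof. by rewrite normrM ler_pM// dir1. Qed.

Lemma Xray1_adjointE i x : Xray1_adjoint psi i x = n%:R * \int[leb_rV]_y kern i (x, y).
Proof.
have mline : measurable_fun setT (fun theta : E => theta ord0 i * psi0 (line_through x theta)).
  apply: measurable_funM; first exact: measurable_coord.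
  by apply: (measurableT_comp mpsi); exact: measurable_line_through.
rewrite /Xray1_adjoint.
transitivity (\int[surface_measure]_(theta in sphere)
    (theta ord0 i * psi0 (line_through x theta))).
  apply: eq_Rintegral => theta; rewrite inE => t1.
  by rewrite /psi0 patchE mem_set//; exact: line_throughP.
rewrite surface_Rintegral//; first by congr (_ * _); apply: eq_Rintegral => y _; rewrite mulrA.
apply: (integrable_le _ _ integrable_D).
  apply: measurable_funM; first by apply: measurable_indic; exact: measurable_polar_dom.
  exact: measurableT_comp mline (@measurable_direction R n).
by move=> y; rewrite mulrA; exact: (kern_le i x y).
Qed.

Lemma measurable_Xray1_adjoint i : measurable_fun setT (Xray1_adjoint psi i).
Proof.
rewrite (_ : Xray1_adjoint psi i = fun x => n%:R * \int[leb_rV]_y kern i (x, y)).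
  apply: measurable_funM => //.
  exact: (@measurable_Rintegral R _ _ E E (@leb_rV R n) _ (measurable_kern i)).
by apply/funext => x; exact: Xray1_adjointE.
Qed.

Lemma Xray1_adjoint_bounded : exists B, forall i x, `|Xray1_adjoint psi i x| <= B.
Proof.
exists (n%:R * \int[leb_rV]_y (\1_D y * C)) => i x.
rewrite Xray1_adjointE normrM ger0_norm// ler_wpM2l//.
apply: ler_norm_Rintegral (integrable_D) _ => //.
apply: integrable_le integrable_D => //.
exact: (measurableT_comp (measurable_kern i) (measurable_pair1 x)).
Qed.

Variable ft : 'I_n -> E -> R.
Hypothesis ift : forall i, leb_rV.-integrable setT (EFin \o ft i).

(** Fubini: pairing with the adjoint is integrating over directions [theta] the
    pairing of the component of the field along [theta] with a function that is
    constant along [theta]. *)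
Lemma Xray_pairing :
  \sum_i \int[leb_rV]_x (ft i x * Xray1_adjoint psi i x) =
  n%:R * \int[leb_rV]_y (\1_D y * \int[leb_rV]_x
     (along ft (direction y) x * psi0 (line_through x (direction y)))).
Proof.
pose F i (p : E * E) := ft i p.1 * kern i p.
have mF i : measurable_fun setT (F i).
  apply: measurable_funM => //.
  exact: measurableT_comp (integrable_measurable (ift i)) measurable_fst.
have iF i : (leb_rV \x leb_rV)%E.-integrable setT (EFin \o F i).
  apply: (integrable_prod_bound (mF i) (integrable_norm_R (ift i)) integrable_D).
  by move=> x y; rewrite normrM ler_wpM2l// kern_le.
have iF' i : (leb_rV \x leb_rV)%E.-integrable setT (EFin \o (fun p => F i (p.2, p.1))).
  apply: (integrable_prod_bound _ integrable_D (integrable_norm_R (ift i))).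
    apply: measurableT_comp => //; apply/measurable_fun_pair.
      exact: measurable_snd.
    exact: measurable_fst.
  by move=> x y; rewrite mulrC normrM ler_wpM2l// kern_le.
transitivity (n%:R * \sum_i \int[leb_rV]_y \int[leb_rV]_x F i (x, y)).
  rewrite mulr_sumr; apply: eq_bigr => i _; rewrite -Rintegral_fubini//.
  rewrite -RintegralZl//; last exact: integrable_Rfubini (iF i).
  apply: eq_Rintegral => x _; rewrite Xray1_adjointE mulrCA; congr (_ * _).
  rewrite -RintegralZl//.
  by apply: (integrable_le _ (kern_le i x) integrable_D); exact: (measurableT_comp (measurable_kern i) (pair1_measurable x)).
congr (_ * _); rewrite -Rintegral_sum; last by move=> i; exact: integrable_Rfubini (iF' i).
apply: eq_Rintegral => y _.
have mpl : measurable_fun setT (fun x => psi0 (line_through x (direction y))).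
  by apply: (measurableT_comp mpsi); exact: measurable_line_through.
have iG i : leb_rV.-integrable setT (EFin \o (fun x => direction y ord0 i * ft i x * psi0 (line_through x (direction y)))).
  by apply: (integrable_mul_bounded (C := C)) => //; exact: integrableZ_R.
rewrite /along; under [in RHS]eq_Rintegral do rewrite mulr_suml.
rewrite Rintegral_sum// mulr_sumr; apply: eq_bigr => i _.
rewrite -RintegralZl//; apply: eq_Rintegral => x _.
by rewrite /F /kern /=; ring.
Qed.

End bounded_psi.
End pairing.

(** * Line integrals of the mollified field *)

Lemma continuous_dup_snd (T U : topologicalType) : continuous (fun p : T * U => (p.2, p.2)).
Proof. by move=> p; apply: cvg_pair; exact: cvg_snd. Qed.

Lemma continuous_pair1 (T U : topologicalType) (x : T) : continuous (fun y : U => (x, y)).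
Proof. by move=> p; apply: cvg_pair; [exact: cvg_cst|exact: cvg_id]. Qed.

Lemma continuous_snd_shift (R : realType) (W : normedModType R) (c : W) :
  continuous (fun p : W * W => p.2 - c).
Proof. by move=> p; apply: cvgB; [exact: cvg_snd|exact: cvg_cst]. Qed.

Lemma continuous_dup (T : topologicalType) : continuous (fun x : T => (x, x)).
Proof. by move=> p; apply: cvg_pair; exact: cvg_id. Qed.

Section line_manifold.
Context {R : realType} {n : nat}.
Local Notation E := 'rV[R]_n.

Lemma continuous_measurable_rV2 (f : E * E -> R) :
  continuous f -> measurable_fun setT f.
Proof.
move=> cf; apply: (measurability _ (RGenOpens.measurableE R)).
move=> _ [_ [a [b ->] <-]]; rewrite setTI; apply: open_measurable_rV2.
by move/continuousP : cf; apply; exact: interval_open.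
Qed.

Lemma closed_line_manifold : closed (@line_manifold R n).
Proof.
rewrite (_ : line_manifold =
    (fun p : E * E => dot p.2 p.2) @^-1` [set 1] `&`
    (fun p : E * E => dot p.1 p.2) @^-1` [set 0]).
  apply: closedI; apply: closed_comp; try exact: closed_eq.
    move=> p _; apply: (@continuous_comp _ _ _ (fun p : E * E => (p.2, p.2)) (fun p : E * E => dot p.1 p.2)).
      exact: continuous_dup_snd.
    exact: continuous_dot.
  by move=> p _; exact: continuous_dot.
apply/seteqP; split=> p [h1 h2]; split => //.
  by rewrite /= -enorm_sqr h1 expr1n.
by rewrite /sphere /= /enorm h1 sqrtr1.
Qed.

Lemma measurable_line_manifold : measurable (@line_manifold R n).
Proof.
rewrite -[X in measurable X]setCK; apply: measurableC; apply: open_measurable_rV2.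
by rewrite openC; exact: closed_line_manifold.
Qed.

Lemma continuous_enorm : continuous (@enorm R n).
Proof.
move=> x; apply: (@continuous_comp _ _ _ (fun x : E => dot x x) Num.sqrt).
  apply: (@continuous_comp _ _ _ (fun x : E => (x, x)) (fun p => dot p.1 p.2)).
    exact: continuous_dup.
  exact: continuous_dot.
exact: sqrt_continuous.
Qed.

End line_manifold.

Lemma continuous_scale_inv (R : realType) (W : normedModType R) (q : W -> R) (x : W) :
  {for x, continuous q} -> q x != 0 -> {for x, continuous (fun y => (q y)^-1 *: y)}.
Proof.
move=> cq q0; apply: cvgZ; last exact: cvg_id.
exact: (cvgV q0 cq).
Qed.

Lemma continuous_at_open_ball (R : realType) (W : normedModType R) (F : W -> W)
    (U : set W) (c : W) (e : R) :
  open U -> (forall x, U x -> {for x, continuous F}) ->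
  open (U `&` [set x | `|F x - c| < e]).
Proof.
move=> oU cF; rewrite openE => x [Ux /= Fx]; apply: filterI; first exact: open_nbhs_nbhs.
have e0 : 0 < e - `|F x - c| by rewrite subr_gt0.
have /cvgrPdist_lt/(_ _ e0) := cF x Ux; apply: filterS => y /= h.
rewrite -[F y](subrK (F x)) -addrA (le_lt_trans (ler_normD _ _))//.
by rewrite -ltrBrDr distrC.
Qed.

Lemma continuous_gt0_near (R : realType) (W : normedModType R) (F : W -> R) (x : W) :
  {for x, continuous F} -> 0 < F x ->
  exists2 r, 0 < r & forall y, `|y - x| < r -> 0 < F y.
Proof.
move=> cF Fx0; have /cvgrPdist_lt/(_ _ Fx0)/nbhs_ballP[r /= r0 h] := cF.
exists r => // y yr; have := h y; rewrite -ball_normE /= distrC => /(_ yr).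
by rewrite ltr_distlC subrr => /andP[].
Qed.

Lemma line_integral_scale (R : realType) n M (g : 'I_n -> 'rV[R]_n -> R) (c : R) theta x :
  (forall i, csmooth M (g i)) -> c != 0 -> theta != 0 ->
  \int[@lebesgue_measure R]_t along g (c *: theta) (x + t *: (c *: theta)) =
  c * `|c|^-1 * \int[@lebesgue_measure R]_t along g theta (x + t *: theta).
Proof.
move=> cg c0 t0.
have iL := line_const_integrable x (csmooth_along theta cg) t0.
have h := Rintegral_affine1 0 c0 iL; have ih := integrable_affine1 0 c0 iL.
rewrite -mulrA -h -(RintegralZl c measurableT ih).
apply: eq_Rintegral => t _.
rewrite addr0 scalerA [t * c]mulrC /along mulr_sumr; apply: eq_bigr => i _.
by rewrite mxE mulrA.
Qed.

(** If [Lk] did not vanish at [theta1], a bump around [theta1] would make the integral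
    nonzero, as the directions close to [theta1] fill an open cone. *)
Lemma sphere_average_eq0 (R : realType) n (Lk : 'rV[R]_n -> R) theta1 :
  smooth Lk ->
  (forall d, 0 < d -> \int[leb_rV]_y (\1_polar_dom y *
    (prod_bump d (direction y - theta1) * Lk (direction y))) = 0) ->
  enorm theta1 = 1 -> Lk theta1 = 0.
Proof.
move=> smooth_Lk pairing t1; apply/eqP/negPn/negP => L0.
set s := Num.sg (Lk theta1).
have sL : 0 < s * Lk theta1 by rewrite /s -normrEsg normr_gt0.
have s1 : `|s| <= 1 by rewrite normr_sg; case: eqP.
have cL : continuous (fun theta => s * Lk theta).
  exact: smooth_continuous (smoothZ s smooth_Lk).
have [r r0 hr] := continuous_gt0_near (cL theta1) sL.
pose U := [set y : 'rV[R]_n | 0 < enorm y < 1] `&` [set y | `|direction y - theta1| < r].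
have oU : open U.
  apply: continuous_at_open_ball.
    rewrite (_ : [set y | _] = @enorm R n @^-1` [set` `]0, 1[]).
      move/continuousP : (@continuous_enorm R n); apply; exact: interval_open.
    by apply/seteqP; split => y /=; rewrite in_itv.
  move=> y /andP[y0 _]; apply: continuous_scale_inv; first exact: continuous_enorm.
  by rewrite gt_eqF.
have d12 : direction (2^-1 *: theta1) = theta1.
  by rewrite /direction enormZ t1 mulr1 ger0_norm ?invr_ge0// scalerA mulVf// ?scale1r// invr_eq0.
have U0 : U !=set0.
  exists (2^-1 *: theta1); split; last by rewrite /= d12 subrr normr0.
  by rewrite /= enormZ t1 mulr1 ger0_norm ?invr_ge0// invr_gt0 ltr0n invf_lt1// ltr1n.
have UP y : U y -> polar_dom y.
  move=> [/andP[y0 y1] _]; apply/polar_domE; split; first exact: ltW.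
  by apply: contraTneq y0 => ->; rewrite -(scale0r y) enormZ normr0 mul0r ltxx.
pose F theta := prod_bump r (theta - theta1) * Lk theta.
have F0 theta : 0 <= s * F theta.
  rewrite /F mulrCA; have [tr|tr] := ltP `|theta - theta1| r.
    by rewrite mulr_ge0 ?prod_bump_ge0// ltW// hr.
  rewrite (_ : prod_bump _ _ = 0) ?mul0r//.
  apply: contrapT => nz; move: tr; apply/negP; rewrite -ltNge.
  have : ball (0 : 'rV[R]_n) r (theta - theta1).
    apply/rV_ballE => // i; rewrite mxE sub0r normrN ltNge.
    by apply: contra_notN nz; exact: prod_bump_eq0.
  by rewrite -ball_normE /= sub0r normrN.
have [cb cb0] : csmooth (r + `|theta1|) (fun theta => prod_bump r (theta - theta1)).
  rewrite -(normrN theta1).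
  have := csmooth_shift (- theta1) (csmooth_prod_bump (n := n) r0).
  by congr csmooth; apply/funext => x; rewrite addrC.
have cF : csmooth (r + `|theta1|) F.
  split; first exact: smoothM cb smooth_Lk.
  by move=> x /cb0; rewrite /F => ->; rewrite mul0r.
have [C C0 hC] := csmooth_bounded cF.
pose h (y : 'rV[R]_n) := \1_polar_dom y * F (direction y).
have ih : leb_rV.-integrable setT (EFin \o h).
  apply: (@integrable_bounded_support _ _ _ _ polar_dom C).
  - exact: measurable_polar_dom.
  - exact: polar_dom_fin.
  - apply: measurable_funM; first exact: measurable_indic measurable_polar_dom.
    apply: (measurableT_comp _ (@measurable_direction R n)).
    by apply: smooth_measurable; case: cF.
  - move=> y yP; rewrite /h indicE mem_set// mul1r; exact: hC.
  - by move=> y yP; rewrite /h indicE memNset// mul0r.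
have : 0 < \int[leb_rV]_(y in [set: 'rV[R]_n]) (s * h y).
  apply: (@Rintegral_gt0 _ _ _ _ U).
  - exact: measurableT.
  - exact: integrableZ_R.
  - by move=> y _; rewrite /h mulrCA mulr_ge0// indicE; case: (_ \in _).
  - exact: oU.
  - exact: U0.
  - exact: subsetT.
  - move=> y Uy; rewrite /h indicE mem_set ?mul1r; last exact: UP.
    case: Uy => _ /= yr; rewrite /F mulrCA mulr_gt0 ?hr// prod_bump_gt0// => i.
    exact: le_lt_trans (ler_norm_coord _ _) yr.
by rewrite (RintegralZl s measurableT ih) (pairing _ r0) mulr0 ltxx.
Qed.


Lemma sphere_neq0 (R : realType) n (theta : 'rV[R]_n) : enorm theta = 1 -> theta != 0.
Proof.
move=> t1; apply/eqP => t0; move: t1.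
rewrite t0 /enorm /dot big1 ?sqrtr0 => [/esym/eqP|j _]; first by rewrite oner_eq0.
by rewrite mxE mul0r.
Qed.

Section rays_vanish.
Context {R : realType} {n : nat}.
Local Notation E := 'rV[R]_n.
Local Notation mu := (@lebesgue_measure R).
Implicit Types (x theta : E).

Variables (V : set E) (ft : 'I_n -> E -> R) (M0 e : R) (x1 : E).
Hypotheses (M00 : 0 < M0) (e0 : 0 < e).
Hypothesis ift : forall i, leb_rV.-integrable setT (EFin \o ft i).
Hypothesis ft0 : forall i x, ~ cube M0 x -> ft i x = 0.
Hypothesis xV : forall y, `|y - x1| <= 2 * e -> V y.
Hypothesis Xft0 : forall psi, line_test_function (lines_meeting V) psi ->
  \sum_i \int[leb_rV]_x (ft i x * Xray1_adjoint psi i x) = 0.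

Let rho := @mollifier R n e.
Let crho : csmooth e rho := csmooth_mollifier e0.
Let g i := conv (ft i) rho.
Let cg i : csmooth (M0 + e) (g i).
Proof. by apply: csmooth_conv => //; exact: ft0. Qed.

(* Length of the segments outside which nothing is seen from the lines near x1. *)
Let T := n%:R * (M0 + M0 + `|x1| + e).
Let T0 : 0 <= T. Proof. by rewrite mulr_ge0// !addr_ge0// ltW. Qed.
Let k (t : R) : R := if `|t| <= T then 1 else 0.

Let wk : line_weight k.
Proof.
split.
  apply: measurable_fun_ifT => //.
  by apply: measurable_fun_ler => //; exact: measurableT_comp.
exists 1, T; split => //.
- by move=> t; rewrite /k; case: ifP => _; rewrite ?normr1 ?normr0.
- by move=> t; rewrite ltNge /k => /negbTE ->.
Qed.

Let far theta (a t : R) x : enorm theta = 1 -> `|x| <= M0 -> `|a| <= n%:R * M0 ->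
  T < `|t| -> `|e| + `|x1 - x| < `|t + a| * `|theta|.
Proof.
move=> t1 xM aM tT.
have n1 := norm_sphere_ge t1.
have n0 : 0 < n%:R :> R.
  by rewrite lt_def ler0n andbT; apply/eqP => n0; move: n1; rewrite n0 mul0r ler10.
have h1 : n%:R * (M0 + `|x1| + e) < `|t + a|.
  have h : `|t| <= `|t + a| + `|a| by rewrite -{1}(addrK a t) ler_normB.
  move: tT; rewrite /T; lra.
have h2 : `|x1 - x| <= `|x1| + M0 by rewrite (le_trans (ler_normB _ _))// lerD2l.
rewrite (gtr0_norm e0).
apply: (@le_lt_trans _ _ (M0 + `|x1| + e)); first by lra.
rewrite -(ltr_pM2l n0) (lt_le_trans h1)// mulrCA ler_peMr//.
Qed.

Let Lk (theta : E) := \sum_i theta ord0 i * line_average x1 k (g i) (0, theta).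

Let Lk_full theta : enorm theta = 1 ->
  Lk theta = \int[mu]_t along g theta (x1 + t *: theta).
Proof.
move=> t1; rewrite /Lk /along Rintegral_sum; last first.
  move=> i; apply: integrableZ_R; apply: (line_const_integrable x1 (cg i)).
  exact: sphere_neq0.
apply: eq_bigr => i _; rewrite RintegralZl//; last first.
  apply: (line_const_integrable x1 (cg i)).
  exact: sphere_neq0.
congr (_ * _); apply: eq_Rintegral => t _; rewrite subr0 /k; case: ifPn => [|tT]; rewrite ?mul1r// mul0r.
apply/esym/(line_support (cg i)); rewrite -ltNge in tT.
have n1 := norm_sphere_ge t1.
have n0 : 0 < n%:R :> R.
  by rewrite lt_def ler0n andbT; apply/eqP => n0; move: n1; rewrite n0 mul0r ler10.
rewrite (gtr0_norm (addr_gt0 M00 e0)) -(ltr_pM2l n0).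
apply: (@le_lt_trans _ _ T); first by rewrite /T ler_wpM2l//; move: M00; lra.
by rewrite (lt_le_trans tT)// mulrCA ler_peMr.
Qed.

Let smooth_Lk : smooth Lk.
Proof.
apply: (@smooth_sum _ _ _ _ (fun i (theta : E) => theta ord0 i * line_average x1 k (g i) (0, theta))) => i.
apply: smoothM; first exact: smooth_coord.
apply: (@smooth_comp_affine _ _ _ (fun th : E => (0 : E, th)) (fun v => (0, v)) _ _ _
  (smooth_line_average x1 wk (cg i))).
- exact: continuous_pair1.
- by move=> x v h; rewrite -[(0, x) + _]/(0 + h *: 0, x + h *: v) scaler0 addr0.
Qed.

Let line_rho theta x : enorm theta = 1 -> `|x| <= M0 ->
  line_average x1 k rho (line_through x theta) = \int[mu]_t rho (x1 - x + t *: theta).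
Proof.
move=> t1 xM; set a := dot x theta.
have th0 := sphere_neq0 t1.
have aM : `|a| <= n%:R * M0.
  rewrite (le_trans (dot_sum_le _ _))// ler_wpM2l// -[leRHS]mulr1 ler_pM//.
  by rewrite -t1 norm_le_enorm.
have h := Rintegral_affine1 a (oner_neq0 R) (line_const_integrable (x1 - x) crho th0).
rewrite normr1 invr1 mul1r in h; rewrite -h.
apply: eq_Rintegral => t _; rewrite mul1r /=.
have -> : x1 + t *: theta - (x - a *: theta) = x1 - x + (t + a) *: theta.
  by apply/rowP => i; rewrite !mxE; ring.
rewrite /k; case: ifPn => [_|tT]; first by rewrite mul1r.
rewrite mul0r -ltNge in tT *; apply/esym/(line_support crho).
exact: (far t1 xM aM tT).
Qed.

(* By Fubini, smearing the
   line integral of the field by [rho] is integrating the mollified field. *)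
Let inner theta : enorm theta = 1 ->
  leb_rV.-integrable setT (EFin \o
    (fun x => along ft theta x * \int[mu]_t rho (x1 - x + t *: theta))) /\
  \int[leb_rV]_x (along ft theta x * \int[mu]_t rho (x1 - x + t *: theta)) = Lk theta.
Proof.
move=> t1; rewrite /Lk.
have th0 := sphere_neq0 t1.
have [C C0 hC] := csmooth_bounded crho.
pose F i (p : E * R) := ft i p.1 * (k p.2 * rho (x1 + p.2 *: theta - p.1)).
have mF i : @measurable_fun _ _ (E * measurableTypeR R)%type R setT (F i).
  apply: measurable_funM.
    exact: measurableT_comp (integrable_measurable (ift i)) measurable_fst.
  apply: measurable_funM; first exact: measurableT_comp wk.1 measurable_snd.
  apply: measurableT_comp; first by apply: smooth_measurable; case: crho.
  apply: measurable_fun_rV => j; under eq_fun do rewrite !mxE.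
  apply: measurable_funB; first apply: measurable_funD => //.
    exact: measurable_funM.
  exact: (measurableT_comp (measurable_coord j) measurable_fst).
have iF i : (leb_rV \x mu)%E.-integrable setT (EFin \o F i).
  apply: (integrable_prod_bound (mF i) (integrable_norm_R (ift i)) (integrable_itv_cst C T)).
  move=> x t; rewrite normrM ler_wpM2l// normrM /k; case: ifP => _.
    by rewrite normr1 mul1r.
  by rewrite normr0 mul0r.
have kE x : `|x| <= M0 -> \int[mu]_t rho (x1 - x + t *: theta) =
    \int[mu]_t (k t * rho (x1 + t *: theta - x)).
  move=> xM; apply: eq_Rintegral => t _.
  rewrite (_ : x1 + _ - x = x1 - x + t *: theta); last by rewrite addrAC.
  rewrite /k; case: ifPn => [|tT]; rewrite ?mul1r// mul0r.
  rewrite -ltNge in tT; apply: (line_support crho).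
  rewrite -(addr0 t); apply: (far t1 xM _ tT).
  by rewrite normr0 mulr_ge0// ltW.
have -> : (fun x => along ft theta x * \int[mu]_t rho (x1 - x + t *: theta)) =
    (fun x => \sum_i theta ord0 i * \int[mu]_t F i (x, t)).
  apply/funext => x; rewrite /along mulr_suml; apply: eq_bigr => i _.
  have [xM|xM] := pselect (cube M0 x); last first.
    rewrite ft0// mulr0 mul0r; rewrite Rintegral_eq0 ?mulr0// => t.
    by rewrite /F /= ft0// mul0r.
  rewrite kE; last by apply: (rV_norm_le _ (ltW M00)).2.
  rewrite -mulrA; congr (_ * _); rewrite -RintegralZl//.
  by move: (line_average_integrable x1 (x, theta) wk crho).
have iT i : leb_rV.-integrable setT
    (EFin \o (fun x => theta ord0 i * \int[mu]_t F i (x, t))).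
  exact: (integrableZ_R _ (integrable_Rfubini (iF i))).
split; first exact: integrable_sum_R.
rewrite Rintegral_sum//.
apply: eq_bigr => i _.
rewrite (RintegralZl _ measurableT (integrable_Rfubini (iF i))).
congr (_ * _); rewrite Rintegral_fubini//; apply: eq_Rintegral => t _.
rewrite subr0 /= /F /= /g /conv -RintegralZl//; last exact: (conv_integrable (ift i) _ crho).
by apply: eq_Rintegral => x _; rewrite mulrCA.
Qed.

Let psi (d : R) (theta1 : E) (p : E * E) : R :=
  prod_bump d (p.2 - theta1) * line_average x1 k rho p.

Let smooth_psi d theta1 : 0 < d -> smooth (psi d theta1).
Proof.
move=> d0; apply: smoothM; last exact: (smooth_line_average x1 wk crho).
apply: (@smooth_comp_affine _ _ _ (fun p : E * E => p.2 - theta1) (fun p => p.2)).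
- exact: continuous_snd_shift.
- by move=> p v h /=; rewrite addrAC.
- by case: (csmooth_prod_bump (n := n) d0).
Qed.

Let psi_bounded d theta1 : 0 < d -> exists C, forall p, `|psi d theta1 p| <= C.
Proof.
move=> d0; have [C1 C10 h1] := csmooth_bounded (csmooth_prod_bump (n := n) d0).
have [C2 C20 h2] := csmooth_bounded crho.
exists (C1 * \int[mu]_t (if `|t| <= T then C2 else 0)) => p.
rewrite normrM ler_pM// /line_average; apply: ler_norm_Rintegral.
- exact: (line_average_integrable x1 p wk crho).
- exact: integrable_itv_cst.
- move=> t; rewrite normrM /k; case: ifP => _; first by rewrite normr1 mul1r.
  by rewrite normr0 mul0r.
Qed.

Let psi_support d theta1 p : psi d theta1 p != 0 ->
  exists2 t, `|t| <= T & `|x1 + t *: p.2 - p.1| <= e.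
Proof.
move=> psi0; apply: contrapT => h; move: psi0; rewrite /psi.
rewrite (_ : line_average _ _ _ _ = 0) ?mulr0 ?eqxx//.
apply: Rintegral_eq0 => t; rewrite /k; case: ifPn => tT; last by rewrite mul0r.
case: crho => _ ->; first by rewrite mulr0.
move=> hc; apply: h; exists t => //.
exact: (rV_norm_le _ (ltW e0)).2.
Qed.

Let psi_test d theta1 : 0 < d -> line_test_function (lines_meeting V) (psi d theta1).
Proof.
move=> d0; set S := [set p | line_manifold p /\ psi d theta1 p != 0].
have T10 : 0 < T + 1 by rewrite ltr_wpDl.
have near p (tau : R) : 0 < tau -> closure S p -> exists2 q, S q & `|p - q| < tau.
  move=> tau0 /(_ (ball p tau) (nbhsx_ballx _ _ tau0))[q [Sq]].
  by rewrite -ball_normE /=; exists q.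
have Sm p : closure S p -> line_manifold p.
  move=> Sp; apply: closed_line_manifold => B /Sp[q [[mq _] Bq]].
  by exists q.
have St p : closure S p -> exists t, `|x1 + t *: p.2 - p.1| <= 2 * e /\ `|t| <= T.
  move=> Sp; have [q [mq /psi_support[t tT ht]] pq] := near p (e / (T + 1)) (divr_gt0 e0 T10) Sp.
  exists t; split => //.
  have -> : x1 + t *: p.2 - p.1 = (x1 + t *: q.2 - q.1) + (t *: (p.2 - q.2) - (p.1 - q.1)).
    by apply/rowP => i; rewrite !mxE; ring.
  have h1 : `|p.1 - q.1| <= `|p - q| by rewrite [leRHS]prod_normE /= le_max lexx.
  have h2 : `|p.2 - q.2| <= `|p - q| by rewrite [leRHS]prod_normE /= le_max lexx orbT.
  rewrite (le_trans (ler_normD _ _))// mulrDl mul1r lerD//.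
  rewrite (le_trans (ler_normB _ _))// normrZ.
  apply: (@le_trans _ _ ((T + 1) * `|p - q|)).
    by rewrite mulrDl mul1r lerD// ler_pM.
  by rewrite mulrC -ler_pdivlMr// ltW.
split.
- move=> p mp; exists setT, (psi d theta1); split => //; first exact: openT.
  exact/smooth_onW/smooth_psi.
- apply: (subclosed_compact _ (compact_setX (@compact_cube R n (`|x1| + T + 2 * e)) (@compact_cube R n 1))).
    exact: closed_closure.
  move=> p Sp; have [t [h1 h2]] := St p Sp; have [s1 _] := Sm p Sp.
  have p21 : `|p.2| <= 1 by rewrite -s1 norm_le_enorm.
  split; last exact: (rV_norm_le _ ler01).1.
  apply: (rV_norm_le _ _).1; first by rewrite !addr_ge0// mulr_ge0// ltW.
  have -> : p.1 = x1 + t *: p.2 - (x1 + t *: p.2 - p.1) by rewrite opprB addrC subrK.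
  rewrite (le_trans (ler_normB _ _))// lerD// (le_trans (ler_normD _ _))// lerD2l normrZ.
  by rewrite -[leRHS]mulr1 ler_pM.
- move=> p Sp; split; first exact: Sm.
  have [t [h1 _]] := St p Sp; exists (- t); apply: xV.
  rewrite -normrN opprB scaleNr.
  have -> : x1 - (p.1 - t *: p.2) = x1 + t *: p.2 - p.1.
    by apply/rowP => i; rewrite !mxE; ring.
  exact: h1.
Qed.

Let psi_pairing d theta1 : 0 < d ->
  \int[leb_rV]_y (\1_polar_dom y * (prod_bump d (direction y - theta1) * Lk (direction y))) = 0.
Proof.
move=> d0; have := Xft0 (psi_test theta1 d0).
have [C hC] := psi_bounded theta1 d0.
have C0 : 0 <= C by rewrite (le_trans _ (hC 0)).
have mpsi : measurable_fun setT (psi d theta1 \_ line_manifold).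
  apply/(measurable_restrictT _ _).1; first exact: measurable_line_manifold.
  apply: measurable_funTS; apply: continuous_measurable_rV2.
  exact/smooth_continuous/smooth_psi.
have hC' p : `|(psi d theta1 \_ line_manifold) p| <= C.
  by rewrite patchE; case: ifP; rewrite ?normr0.
rewrite (Xray_pairing mpsi hC' ift) => /eqP; rewrite mulf_eq0 => /orP[|/eqP h].
  rewrite pnatr_eq0 => /eqP n0; apply: Rintegral_eq0 => y.
  rewrite indicE memNset ?mul0r// => /polar_domE[_] /eqP; apply.
  by apply/rowP => -[i hi]; exfalso; move: (hi); rewrite n0.
rewrite -[RHS]h; apply: eq_Rintegral => y _.
rewrite indicE; have [|_] := boolP (y \in polar_dom); last by rewrite !mul0r.
rewrite inE => -[_ t1]; congr (_ * _).
have [iI <-] := inner t1; rewrite -(RintegralZl _ measurableT iI).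
apply: eq_Rintegral => x _; rewrite patchE mem_set; last exact: line_throughP.
have [xM|xM] := pselect (cube M0 x); last first.
  have -> : along ft (direction y) x = 0.
    by rewrite /along big1// => i _; rewrite ft0// mulr0.
  by rewrite !mul0r mulr0.
rewrite /psi mulrCA; congr (_ * (_ * _)).
by rewrite line_rho//; apply: (rV_norm_le _ (ltW M00)).2.
Qed.

Let Lk_eq0 theta1 : enorm theta1 = 1 -> Lk theta1 = 0.
Proof.
by apply: (sphere_average_eq0 smooth_Lk) => d d0; exact: psi_pairing.
Qed.

(** The test function is a bump in the direction times a smooth average of the
    mollifier along the line: its pairing with the X-ray transform is the average
    over directions of the line integrals, through [x1], of the mollified field. These
    depend continuously on the direction and so vanish one by one. *)
Lemma rays_vanish v : v != 0 ->
  \int[mu]_t along g v (x1 + t *: v) = 0.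
Proof.
move=> v0; have c0 := lt0r_neq0 (enorm_gt0 v0).
have t1 := enorm_direction v0.
rewrite [v](_ : _ = enorm v *: direction v); last first.
  by rewrite /direction scalerA mulfV// scale1r.
by rewrite (line_integral_scale _ cg c0 (sphere_neq0 t1)) -(Lk_full t1) (Lk_eq0 t1) mulr0.
Qed.

End rays_vanish.

(** * The potential of a closed field *)

Section reflected_mollifier.
Context {R : realType} {n : nat}.
Local Notation E := 'rV[R]_n.
Variables (e : R) (x : E).
Hypothesis e0 : 0 < e.
Let eta (y : E) := mollifier e (x - y).

Let eta_near y : eta y != 0 -> `|y - x| <= e.
Proof.
rewrite distrC => ey; apply: (rV_norm_le _ (ltW e0)).2; apply: contrapT => yc.
by move: ey; rewrite /eta (csmooth_mollifier e0).2 ?eqxx.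
Qed.

Lemma csmooth_reflected_mollifier : csmooth (e + `|x|) eta.
Proof.
split.
  apply: (smooth_comp_affine (A := fun y => x - y) (L := fun v => - v)).
  - rewrite (_ : (fun y => _) = (fun y => (-1) *: y + x)); first exact: continuous_affine.
    by apply/funext => y; rewrite scaleN1r addrC.
  - by move=> y v h; rewrite opprD scalerN addrA.
  - exact: (csmooth_mollifier e0).1.
move=> y yc; apply/eqP; apply: contra_notT yc => /eta_near yx.
apply/(rV_norm_le _ (addr_ge0 (ltW e0) (normr_ge0 _))).
by rewrite -[y](subrK x) (le_trans (ler_normD _ _))// lerD2r.
Qed.

Lemma mollifier_test_function (V : set E) :
  (forall y, `|y - x| <= e -> V y) -> test_function V eta.
Proof.
move=> xV; apply: (csmooth_test_function csmooth_reflected_mollifier) => y Sy; apply: xV.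
have : closed [set y : E | `|y - x| <= e].
  rewrite (_ : [set y | _] = (fun y => y - x) @^-1` cube e).
    apply: closed_comp; last exact: closed_cube.
    move=> z _; rewrite (_ : (fun y => _) = (fun y => 1 *: y + (- x))); first exact: continuous_affine.
    by apply/funext => t; rewrite scale1r.
  apply/seteqP; split => z /=; first by move/(rV_norm_le _ (ltW e0)).
  by move=> h; apply/(rV_norm_le _ (ltW e0)).
by apply=> B /Sy[z [/eta_near ze Bz]]; exists z.
Qed.

End reflected_mollifier.

Section closed_mollified.
Context {R : realType} {n : nat}.
Local Notation E := 'rV[R]_n.

Variables (V : set E) (ft : 'I_n -> E -> R) (e : R) (x : E).
Hypothesis e0 : 0 < e.
Hypothesis ift : forall i, leb_rV.-integrable setT (EFin \o ft i).
Hypothesis xV : forall y, `|y - x| <= e -> V y.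
Hypothesis df0 : forall i j, vanishes_on V
  (exterior_derivative (fun i => regular_distribution (ft i)) i j).

(** The derivatives of the mollified field at [x] are the pairings of the field with the
    derivatives of the reflected mollifier [y |-> mollifier e (x - y)], a test
    function supported in [V]. *)
Lemma closed_mollified i j :
  partial i (conv (ft j) (mollifier e)) x = partial j (conv (ft i) (mollifier e)) x.
Proof.
have cr := csmooth_mollifier (n := n) e0.
have := df0 i j; set rho := mollifier e in cr *.
pose eta (y : E) := rho (x - y).
have AL (y v : E) (h : R) : x - (y + h *: v) = (x - y) + h *: (- v).
  by rewrite opprD scalerN addrA.
have deta k y : partial k eta y = - partial k rho (x - y).
  rewrite /partial (@derive_comp_affine R _ _ (fun y => x - y) (fun v => - v) rho y _ AL).
  by rewrite -[- delta_mx _ _]scaleN1r (smooth_deriveZ _ _ _ cr.1) mulN1r.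
have ceta : csmooth (e + `|x|) eta := csmooth_reflected_mollifier x e0.
have teta : test_function V eta := mollifier_test_function e0 xV.
move=> /(_ _ teta); rewrite /exterior_derivative /partial_distribution /regular_distribution.
have h k l : - (\int[leb_rV]_y (ft k y * partial l eta y)) = partial l (conv (ft k) rho) x.
  rewrite -mulN1r.
  have ii : leb_rV.-integrable setT (EFin \o (fun y => ft k y * partial l eta y)).
    have [C _ hC] := csmooth_bounded (csmooth_derive (delta_mx ord0 l) ceta).
    apply: (integrable_mul_bounded (C := C)) => //.
    exact: smooth_measurable (smooth_derive _ ceta.1).
  rewrite -(RintegralZl (-1) measurableT ii).
  rewrite [RHS](@derive_val _ _ _ _ _ _ _ (is_derive_conv (ift k) x (delta_mx ord0 l) cr)).
  apply: eq_Rintegral => y _; by rewrite deta mulN1r mulrN opprK.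
move=> /subr0_eq h0.
exact: etrans (esym (h j i)) (etrans h0 (h i j)).
Qed.

End closed_mollified.

Section potential.
Context {R : realType}.
Local Notation mu := (@lebesgue_measure R).

Definition half_line (t : R) : R := if t <= 0 then 1 else 0.

Lemma measurable_half_line : measurable_fun setT half_line.
Proof.
apply: measurable_fun_ifT => //.
by apply: measurable_fun_ler.
Qed.

Lemma half_line_le1 t : `|half_line t| <= 1.
Proof. by rewrite /half_line; case: ifP => _; rewrite ?normr1 ?normr0 ?ler01. Qed.

Lemma half_line_FTC n M (u : 'rV[R]_n -> R) x theta : csmooth M u -> theta != 0 ->
  \int[mu]_t (half_line t * 'D_theta u (x + t *: theta)) = u x.
Proof.
move=> cu th0; have cdu := csmooth_derive theta cu.
have nth0 : 0 < `|theta| by rewrite normr_gt0.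
pose T := (`|M| + `|x|) / `|theta| + 1.
have T0 : 0 < T by rewrite ltr_wpDl// divr_ge0// addr_ge0.
have far (u' : 'rV[R]_n -> R) t : csmooth M u' -> T <= `|t| -> u' (x + t *: theta) = 0.
  move=> cu' tT; apply: (line_support cu'); rewrite -ltr_pdivrMr//.
  by rewrite (lt_le_trans _ tT)// ltrDl.
transitivity (\int[mu]_(t in `[- T, 0]) 'D_theta u (x + t *: theta)).
  rewrite [RHS]Rintegral_mkcond; apply: eq_Rintegral => t _.
  rewrite patchE mem_setE in_itv /= /half_line.
  have [t0|t0] := leP t 0; last by rewrite andbF mul0r.
  rewrite mul1r andbT; case: leP => // tT.
  by rewrite (far _ _ cdu)// ler0_norm// lerNr ltW.
have sl : continuous (fun t : R => u (x + t *: theta)).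
  move=> t; apply/differentiable_continuous/derivable1_diffP.
  by apply/derivable_line; apply: smooth_derivable; case: cu.
have sdl : continuous (fun t : R => 'D_theta u (x + t *: theta)).
  move=> t; apply/differentiable_continuous/derivable1_diffP.
  by apply/(derivable_line (fun y => 'D_theta u y)); apply: smooth_derivable; case: cdu.
have NT0 : - T < 0 by rewrite oppr_lt0.
rewrite /Rintegral (@continuous_FTC2 R (fun t => 'D_theta u (x + t *: theta))
  (fun t => u (x + t *: theta)) _ _ NT0).
- rewrite /= scale0r addr0 [X in _ - X](far _ _ cu) ?subr0//.
  by rewrite normrN ler_norm.
- exact: continuous_subspaceT.
- split.
  + by move=> t _; apply/derivable_line; apply: smooth_derivable; case: cu.
  + by apply: cvg_at_right_filter; exact: sl.
  + by apply: cvg_at_left_filter; exact: sl.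
- by move=> t _; rewrite derive1E derive_line.
Qed.

Section primitive.
Variables (m : nat).
Local Notation E := 'rV[R]_m.+2.
Variables (M : R) (g : 'I_m.+2 -> E -> R).
Hypothesis M0 : 0 <= M.
Hypothesis cg : forall i, csmooth M (g i).
Hypothesis closed_g : forall x i j, partial i (g j) x = partial j (g i) x.

Let d0 : E := delta_mx ord0 ord0.
Let i1 : 'I_m.+2 := lift ord0 ord0.
Let d1 : E := delta_mx ord0 i1.

Let d0_neq0 : d0 != 0.
Proof.
by apply/eqP => /matrixP/(_ ord0 ord0)/eqP; rewrite !mxE !eqxx /= oner_eq0.
Qed.

Definition potential (x : E) : R :=
  \int[mu]_t (half_line t * g ord0 (x + t *: d0)).

(** Differentiate under the integral and use closedness to turn the derivative of
    the first component in the direction [v] into a derivative along the line of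
    integration, which integrates to a boundary value. *)
Lemma is_derive_potential x v : is_derive x v potential (along g v x).
Proof.
apply: is_derive_line0.
have := is_derive_line_integral x v 0 measurable_half_line half_line_le1 (cg ord0) d0_neq0.
rewrite (_ : (fun s : R => _) = (fun s : R => potential (x + s *: v))); last first.
  apply/funext => s; apply: eq_Rintegral => t _; by rewrite scaler0 addr0.
move=> /is_derive_eq; apply.
rewrite -[RHS](half_line_FTC x (csmooth_along v cg) d0_neq0).
apply: eq_Rintegral => t _; rewrite derive0 mulr0 addr0; congr (_ * _).
rewrite smooth_derive_partial; last by case: (cg ord0).
rewrite (derive_along _ _ _ cg) [RHS](bigD1 ord0)//= [X in _ = _ + X]big1 ?addr0; last first.
  by move=> i i0; apply: big1 => j _; rewrite mxE (negbTE i0) andbF mul0r.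
by apply: eq_bigr => j _; rewrite mxE !eqxx mul1r closed_g.
Qed.

Lemma smooth_potential : smooth potential.
Proof.
have /choice[C hC] i : exists C : R, forall x, `|g i x| <= C.
  by have [C _ hC] := csmooth_bounded (cg i); exists C.
have dp x v := is_derive_potential x v.
have pE v : (fun x => 'D_v potential x) = along g v.
  by apply/funext => x; apply: derive_val.
apply: smooth_from_derive.
- apply: (@lipschitz_continuousW _ _ _ (\sum_i C i)) => x y.
  have [c [_]] := @mean_value R (fun s => potential (y + s *: (x - y))) _ 0 1
    (fun s => is_derive_line (dp (y + s *: (x - y)) (x - y))).
  rewrite scale0r addr0 scale1r [y + (x - y)]addrC subrK subr0 mulr1 => ->.
  rewrite /along (le_trans (ler_norm_sum _ _ _))// mulr_suml ler_sum// => i _.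
  by rewrite normrM mulrC ler_pM// ler_norm_coord.
- by move=> x v; have [] := dp x v.
- by move=> v; rewrite pE; case: (csmooth_along v cg).
Qed.

Let potential_left x : (forall t, t <= 0 -> g ord0 (x + t *: d0) = 0) -> potential x = 0.
Proof.
move=> h; apply: Rintegral_eq0 => t; rewrite /half_line; case: ifP => [t0|_].
  by rewrite h// mulr0.
by rewrite mul0r.
Qed.

Let potential_shift x s : 0 <= s ->
  (forall t, 0 <= t -> g ord0 (x + t *: d0) = 0) -> potential (x + s *: d0) = potential x.
Proof.
move=> s0 h.
pose F t := half_line (t - s) * g ord0 (x + t *: d0).
have mF : measurable_fun setT (fun t : R => half_line (t - s)).
  apply: measurableT_comp; first exact: measurable_half_line.
  exact: measurable_funB.
have iF : mu.-integrable setT (EFin \o F).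
  by apply: (integrable_line (K := 1) x mF _ (cg ord0) d0_neq0) => t; exact: half_line_le1.
have := Rintegral_affine1 s (oner_neq0 R) iF; rewrite normr1 invr1 mul1r => h1.
transitivity (\int[mu]_t F t).
  rewrite -h1; apply: eq_Rintegral => t _; rewrite /F mul1r addrK.
  by rewrite -addrA -scalerDl [s + t]addrC.
apply: eq_Rintegral => t _; rewrite /F; have [t0|t0] := leP 0 t.
  by rewrite h// !mulr0.
by rewrite /half_line !ifT ?(ltW t0)// subr_le0 (le_trans (ltW t0)).
Qed.

(* Far to the right the potential can be followed along a second direction
   out of the support; this is where the dimension is at least 2. *)
Let potential_far (x : E) : M < x ord0 ord0 -> potential x = 0.
Proof.
move=> xM; pose v : E := (M + 1 - x ord0 i1) *: d1.
have [c [_]] := smooth_mean_value x v smooth_potential.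
rewrite (_ : potential (x + v) = 0); last first.
  apply: potential_left => t _; case: (cg ord0) => _; apply => /(_ i1).
  rewrite !mxE !eqxx /= mulr1 mulr0 addr0 addrC subrK leNgt.
  by rewrite (ger0_norm (addr_ge0 M0 ler01)) ltrDl ltr01.
rewrite (@derive_val _ _ _ _ _ _ _ (is_derive_potential _ _)) /along big1 ?sub0r; last first.
  move=> i _; case: (cg i) => _ ->; first by rewrite mulr0.
  move=> /(_ ord0); rewrite !mxE !eqxx /= !mulr0 addr0 leNgt.
  by rewrite (lt_le_trans xM)// ler_norm.
by move=> /eqP; rewrite oppr_eq0 => /eqP.
Qed.

Variable S : set E.
Hypothesis gS : forall x, ~ S x -> g ord0 x = 0.
Hypothesis convex_S : forall x a b, a <= 0 -> 0 <= b ->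
  S (x + a *: d0) -> S (x + b *: d0) -> S x.

(** A point outside the convex set [S] has no point of [S] on one of the two half-lines
    through it: on the left the integrand vanishes, on the right the potential is
    constant up to a region far away. *)
Lemma potential_support x : ~ S x -> potential x = 0.
Proof.
move=> Sx.
have [h|/existsNP[a /not_implyP[a0 Sa]]] :=
    pselect (forall t, t <= 0 -> g ord0 (x + t *: d0) = 0).
  exact: potential_left.
have h t : 0 <= t -> g ord0 (x + t *: d0) = 0.
  move=> t0; apply: gS => St; apply: Sx; apply: (convex_S a0 t0) => //.
  by apply: contrapT => /gS.
have s0 : 0 <= `|M| + `|x ord0 ord0| + 1 by rewrite !addr_ge0.
rewrite -(potential_shift s0 h); apply: potential_far.
rewrite !mxE !eqxx mulr1 (ger0_norm M0).
have := ler_norm (- x ord0 ord0); rewrite normrN; lra.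
Qed.

End primitive.
End potential.

(** * Mean square norms *)

Section square_norm.
Context {R : realType} d (T : measurableType d) (mu : {measure set T -> \bar R}).
Implicit Types u v w h : T -> R.

Definition sqnorm u : \bar R := (\int[mu]_x ((u x) ^+ 2)%:E)%E.

Lemma measurable_sqr u : measurable_fun setT u ->
  measurable_fun setT (fun x => ((u x) ^+ 2)%:E).
Proof. by move=> mu_; apply/measurable_EFinP; exact: measurable_funX. Qed.

Lemma sqnorm_ge0 u : (0 <= sqnorm u)%E.
Proof. by apply: integral_ge0 => x _; rewrite lee_fin sqr_ge0. Qed.

Lemma le_sqnorm u v : measurable_fun setT u -> measurable_fun setT v ->
  (forall x, `|u x| <= `|v x|) -> (sqnorm u <= sqnorm v)%E.
Proof.
move=> m1 m2 uv; apply: ge0_le_integral.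
- exact: measurableT.
- by move=> x _; rewrite lee_fin sqr_ge0.
- exact: measurable_sqr.
- exact: measurable_sqr.
- by move=> x _; rewrite lee_fin -[leLHS]real_normK ?num_real// -[leRHS]real_normK ?num_real// ler_pXn2r ?nnegrE.
Qed.

Lemma sqnormZ (c : R) u : measurable_fun setT u ->
  sqnorm (fun x => c * u x) = ((c ^+ 2)%:E * sqnorm u)%E.
Proof.
move=> m1; rewrite /sqnorm -ge0_integralZl//.
- by apply: eq_integral => x _; rewrite exprMn.
- exact: measurable_sqr.
- by move=> x _; rewrite lee_fin sqr_ge0.
- by rewrite lee_fin sqr_ge0.
Qed.

Lemma sqnormD u v : measurable_fun setT u -> measurable_fun setT v ->
  (sqnorm (fun x => u x + v x)%R <= 2%:E * (sqnorm u + sqnorm v))%E.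
Proof.
move=> m1 m2; rewrite /sqnorm -ge0_integralD//; last 4 first.
- by move=> x _; rewrite lee_fin sqr_ge0.
- exact: measurable_sqr.
- by move=> x _; rewrite lee_fin sqr_ge0.
- exact: measurable_sqr.
have ms : measurable_fun setT (fun x => (u x ^+ 2)%:E + (v x ^+ 2)%:E)%E.
  by apply: emeasurable_funD; exact: measurable_sqr.
rewrite -ge0_integralZl//.
- apply: ge0_le_integral => //.
  + by move=> x _; rewrite lee_fin sqr_ge0.
  + by apply: measurable_sqr; exact: measurable_funD.
  + exact: measurable_funeM.
  + move=> x _; rewrite -EFinD -EFinM lee_fin.
    have := sqr_ge0 (u x - v x); rewrite sqrrB sqrrD mulr_natl; lra.
- by move=> x _; rewrite -EFinD lee_fin addr_ge0// sqr_ge0.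
Qed.

Lemma sqnormB_triangle u v w : measurable_fun setT u -> measurable_fun setT v ->
  measurable_fun setT w ->
  (sqnorm (fun x => u x - w x)%R <=
   2%:E * (sqnorm (fun x => u x - v x)%R + sqnorm (fun x => v x - w x)%R))%E.
Proof.
move=> m1 m2 m3.
rewrite (_ : (fun x => u x - w x) = (fun x => (u x - v x) + (v x - w x))).
  by apply: sqnormD; exact: measurable_funB.
by apply/funext => x; rewrite addrA subrK.
Qed.

Lemma integrable_of_sqr w h : measurable_fun setT h ->
  mu.-integrable setT (EFin \o w) -> (forall x, 0 <= w x) ->
  mu.-integrable setT (EFin \o (fun x => h x ^+ 2 * w x)) ->
  mu.-integrable setT (EFin \o (fun x => h x * w x)).
Proof.
move=> mh iw w0 iq; have mw := integrable_measurable iw.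
apply: (integrable_le (g := fun x => w x + h x ^+ 2 * w x)).
- exact: measurable_funM.
- move=> x; rewrite normrM (ger0_norm (w0 x)) -[X in X + _]mul1r -mulrDl ler_wpM2r//.
  have := sqr_ge0 (`|h x| - 1); rewrite sqrrB real_normK ?num_real// expr1n mulr1.
  have := normr_ge0 (h x); rewrite mulr2n; lra.
- exact: integrableD_R.
Qed.

(** Jensen's inequality for the square, from the nonnegativity of the variance. It holds
    trivially where the right-hand side is infinite; where it is finite, it makes
    [h1 * w] integrable. *)
Lemma sqr_Rintegral_sub_le w h1 h2 (W : R) :
  measurable_fun setT h1 -> measurable_fun setT h2 ->
  mu.-integrable setT (EFin \o w) -> (forall x, 0 <= w x) -> 0 < W ->
  \int[mu]_x w x <= W -> mu.-integrable setT (EFin \o (fun x => h2 x * w x)) ->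
  (((\int[mu]_x (h1 x * w x) - \int[mu]_x (h2 x * w x)) ^+ 2)%:E <=
   W%:E * \int[mu]_x (((h1 x - h2 x) ^+ 2 * w x)%:E))%E.
Proof.
move=> mh1 mh2 iw w0 W0 wW ih2; have mw := integrable_measurable iw.
pose h x := h1 x - h2 x; have mh : measurable_fun setT h by exact: measurable_funB.
have mq : measurable_fun setT (fun x => h x ^+ 2 * w x).
  by apply: measurable_funM => //; exact: measurable_funX.
have [iq|] := pselect (mu.-integrable setT (EFin \o (fun x => h x ^+ 2 * w x))); last first.
  move=> niq; rewrite [X in (_ <= _ * X)%E](_ : _ = +oo%E); last first.
    apply: contrapT => noo; apply: niq; apply/integrableP; split.
      exact/measurable_EFinP.
    rewrite (eq_integral (fun x => (h x ^+ 2 * w x)%:E)).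
      by rewrite ltey; exact/eqP.
    by move=> x _; rewrite /= ger0_norm// mulr_ge0 ?sqr_ge0.
  by rewrite gt0_muley ?lte_fin// leey.
have iA := integrable_of_sqr mh iw w0 iq.
have iB : (\int[mu]_x (h x ^+ 2 * w x)%:E = (\int[mu]_x (h x ^+ 2 * w x))%R%:E)%E.
  rewrite /Rintegral fineK//; exact: (integrable_fin_num measurableT iq).
have -> : \int[mu]_x (h1 x * w x) - \int[mu]_x (h2 x * w x) = \int[mu]_x (h x * w x).
  have ih1 : mu.-integrable setT (EFin \o (fun x => h1 x * w x)).
    rewrite (_ : (fun x => _) = (fun x => h x * w x + h2 x * w x)).
      exact: integrableD_R.
    by apply/funext => x; rewrite -mulrDl subrK.
  rewrite -(RintegralB measurableT ih1 ih2); apply: eq_Rintegral => x _.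
  by rewrite -mulrBl.
rewrite iB -EFinM lee_fin; set A := \int[mu]_x (h x * w x).
set B := \int[mu]_x _; set W' := \int[mu]_x w x in wW.
have : 0 <= \int[mu]_x ((h x - A / W) ^+ 2 * w x).
  by apply: Rintegral_ge0 => x _; rewrite mulr_ge0 ?sqr_ge0.
have -> : \int[mu]_x ((h x - A / W) ^+ 2 * w x) = B - 2 * (A / W) * A + (A / W) ^+ 2 * W'.
  rewrite -(RintegralZl (2 * (A / W)) measurableT iA) -(RintegralZl _ measurableT iw).
  have iA' := integrableZ_R (2 * (A / W)) iA.
  have iw' := integrableZ_R ((A / W) ^+ 2) iw.
  rewrite -(RintegralB measurableT iq iA') -(RintegralD measurableT (integrableB_R iq iA') iw').
  by apply: eq_Rintegral => x _; ring.
move=> hv; have hw : (A / W) ^+ 2 * W' <= (A / W) ^+ 2 * W by rewrite ler_wpM2l ?sqr_ge0.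
have : A ^+ 2 / W <= B.
  have e1 : 2 * (A / W) * A = 2 * (A ^+ 2 / W) by rewrite expr2; ring.
  have e2 : (A / W) ^+ 2 * W = A ^+ 2 / W by field; rewrite gt_eqF.
  by move: hv hw; rewrite e1 e2; lra.
by rewrite ler_pdivrMr// mulrC.
Qed.

End square_norm.

Section L2.
Context {R : realType} {n : nat}.
Local Notation E := 'rV[R]_n.
Local Notation nsq u := (sqnorm (@leb_rV R n) u%R).
Implicit Types (u v : E -> R) (A U Omega : set E).

Let Lnorm2_cases u : exists2 r : \bar R, Lnorm (@leb_rV R n) 2%:E (EFin \o u) = r &
  (r = +oo%E /\ nsq u = +oo%E) \/
  (exists2 a : R, 0 <= a & r = a%:E /\ nsq u = (a ^+ 2)%:E).
Proof.
have h : (Lnorm (@leb_rV R n) 2%:E (EFin \o u) `^ 2 = nsq u)%E.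
  rewrite poweR_Lnorm ?pnatr_eq0//; apply: eq_integral => x _.
  rewrite (_ : `|(EFin \o u) x|%E = `|u x|%:E)//.
  by rewrite poweR_EFin powR_mulrn// real_normK ?num_real.
have := Lnorm_ge0 (@leb_rV R n) 2%:E (EFin \o u).
move: h; case: (Lnorm _ _ _) => [a|//|//] <- a0; first last.
  by exists +oo%E => //; left; rewrite poweRyr ?pnatr_eq0.
exists a%:E => //; right; exists a => //; split=> //.
by rewrite poweR_EFin powR_mulrn.
Qed.

Lemma in_L2P Omega u : in_L2 Omega u <->
  measurable_fun setT (u \_ Omega) /\ (nsq (u \_ Omega) < +oo)%E.
Proof.
have [r rE h] := Lnorm2_cases (u \_ Omega).
have h' : (r < +oo)%E <-> (nsq (u \_ Omega) < +oo)%E.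
  by case: h => [[-> ->//]|[a a0 [-> ->]]]; rewrite !ltry.
split.
  move=> /andP[]; rewrite !inE /finite_norm /= => mu_; rewrite rE => /h' ?.
  by split.
move=> [mu_ /h' r_oo]; apply/andP; rewrite !inE /finite_norm/= rE; split => //.
Qed.

Lemma L2_dist_lt Omega u v (e : R) : 0 < e ->
  (L2_dist Omega u v < e%:E)%E <-> (nsq ((u \- v)%R \_ Omega) < (e ^+ 2)%:E)%E.
Proof.
move=> e0; rewrite /L2_dist.
have [r -> h] := Lnorm2_cases ((u \- v) \_ Omega).
case: h => [[-> ->//]|[a a0 [-> ->]]].
by rewrite !lte_fin ltr_pXn2r// nnegrE ltW.
Qed.

Lemma sqnorm_affine u (c : R) (b : E) : measurable_fun setT u -> 1 <= c ->
  (nsq (fun x => u (c *: x + b)%R) <= nsq u)%E.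
Proof.
move=> mu_ c1; have c0 : c != 0 by rewrite gt_eqF// (lt_le_trans ltr01).
rewrite /sqnorm (ge0_integral_affine b c0 (f := fun x => ((u x) ^+ 2)%:E)).
- rewrite -[leRHS]mul1e; apply: lee_wpmul2r.
    exact: (sqnorm_ge0 _ u).
  rewrite lee_fin invf_le1 ?exprn_gt0 ?normr_gt0// exprn_ege1//.
  by rewrite ger0_norm// (le_trans ler01).
- exact: measurable_sqr.
- by move=> x; rewrite lee_fin sqr_ge0.
Qed.

(** Restricting to expansions [1 <= c] makes the change of variables a contraction for the
    mean square norm. *)
Definition affine_continuous u := forall e : R, 0 < e -> exists2 delta : R, 0 < delta &
  forall (c : R) (b : E), 1 <= c -> c < 1 + delta -> `|b| < delta ->
    (nsq (fun x => u (c *: x + b) - u x) <= e%:E)%E.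

Let measurable_affine u (c : R) (b : E) : measurable_fun setT u ->
  measurable_fun setT (fun x : E => u (c *: x + b)).
Proof. by move=> mu_; apply: measurableT_comp => //; exact: measurable_fun_affine. Qed.

Lemma affine_continuous_lim u : measurable_fun setT u ->
  (forall e : R, 0 < e -> exists v, [/\ measurable_fun setT v, affine_continuous v &
    (nsq (fun x => u x - v x) <= e%:E)%E]) ->
  affine_continuous u.
Proof.
move=> m1 h e e0; have e8 : 0 < e / 10 by rewrite divr_gt0.
have [v [m2 cv uv]] := h _ e8; have [delta d0 hd] := cv _ e8.
exists delta => // c b c1 cd bd.
have m1' := measurable_affine c b m1; have m2' := measurable_affine c b m2.
apply: (le_trans (sqnormB_triangle _ m1' m2' m1)).
have h1 : (nsq (fun x => u (c *: x + b) - v (c *: x + b)) <= (e / 10)%:E)%E.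
  apply: le_trans uv.
  exact: (@sqnorm_affine (fun x => u x - v x) c b (measurable_funB m1 m2) c1).
have h2 : (nsq (fun x => v (c *: x + b) - u x) <=
    2%:E * ((e / 10)%:E + (e / 10)%:E))%E.
  apply: (le_trans (sqnormB_triangle _ m2' m2 m1)).
  rewrite lee_pmul2l// leeD//; first exact: hd.
  rewrite (_ : nsq _ = nsq (fun x => u x - v x)); first exact: uv.
  by apply: eq_integral => x _; rewrite -[in LHS]sqrrN opprB.
apply: (@le_trans _ _ (2%:E * ((e / 10)%:E + 2%:E * ((e / 10)%:E + (e / 10)%:E)))%E).
  by rewrite lee_pmul2l// leeD.
rewrite [leLHS](_ : _ = (2 * (e / 10 + 2 * (e / 10 + e / 10)))%:E)//.
by rewrite lee_fin; lra.
Qed.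

Lemma affine_continuousD u v : measurable_fun setT u -> measurable_fun setT v ->
  affine_continuous u -> affine_continuous v -> affine_continuous (fun x => u x + v x).
Proof.
move=> m1 m2 cu cv e e0; have e8 : 0 < e / 4 by rewrite divr_gt0.
have [d1 d10 h1] := cu _ e8; have [d2 d20 h2] := cv _ e8.
exists (Num.min d1 d2); first by rewrite lt_min d10.
move=> c b c1; rewrite -ltrBlDl !lt_min => /andP[cd1 cd2] /andP[bd1 bd2].
rewrite (_ : (fun x => _) = (fun x => (u (c *: x + b) - u x) + (v (c *: x + b) - v x))); last first.
  by apply/funext => x; ring.
have mu' := measurable_funB (measurable_affine c b m1) m1.
have mv' := measurable_funB (measurable_affine c b m2) m2.
apply: (le_trans (sqnormD _ mu' mv')).
apply: (@le_trans _ _ (2%:E * ((e / 4)%:E + (e / 4)%:E))%E).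
  rewrite lee_pmul2l// leeD//; first by apply: h1; rewrite -?ltrBlDl.
  by apply: h2; rewrite -?ltrBlDl.
rewrite [leLHS](_ : _ = (2 * (e / 4 + e / 4))%:E)//.
by rewrite lee_fin; lra.
Qed.

Lemma affine_continuousZ (a : R) u : measurable_fun setT u ->
  affine_continuous u -> affine_continuous (fun x => a * u x).
Proof.
move=> m1 cu e e0.
have a0 : 0 < a ^+ 2 + 1 by rewrite ltr_wpDl// sqr_ge0.
have [d d0 h] := cu _ (divr_gt0 e0 a0).
exists d => // c b c1 cd bd.
rewrite (_ : (fun x => _) = (fun x => a * (u (c *: x + b) - u x))); last first.
  by apply/funext => x; rewrite mulrBr.
rewrite sqnormZ; last by apply: measurable_funB => //; exact: measurable_affine.
apply: (@le_trans _ _ ((a ^+ 2)%:E * (e / (a ^+ 2 + 1))%:E)%E).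
  by rewrite lee_wpmul2l ?h// lee_fin sqr_ge0.
rewrite -EFinM lee_fin mulrA ler_pdivrMr// mulrC ler_wpM2l ?ltW//.
by rewrite ltrDl ltr01.
Qed.

Lemma affine_continuous_sum (I : Type) (s : seq I) (F : I -> E -> R) :
  (forall i, measurable_fun setT (F i)) -> (forall i, affine_continuous (F i)) ->
  affine_continuous (fun x => \sum_(i <- s) F i x).
Proof.
move=> mF cF; elim: s => [|i s IH].
  move=> e e0; exists 1 => // c b _ _ _.
  rewrite (_ : nsq _ = 0%E) ?lee_fin ?ltW//.
  by apply: integral0_eq => x _; rewrite !big_nil subrr expr0n.
rewrite (_ : (fun x => _) = (fun x => F i x + \sum_(i <- s) F i x)).
  by apply: affine_continuousD => //; exact: measurable_sum.
by apply/funext => x; rewrite big_cons.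
Qed.

Lemma sqnorm_indic A : measurable A -> nsq (\1_A) = leb_rV A.
Proof.
move=> mA; rewrite -(setIT A) -integral_indic//; apply: eq_integral => x _.
by rewrite setIT indicE; case: (_ \in _); rewrite ?expr1n ?expr0n.
Qed.

End L2.

(** * Mean square continuity under affine maps *)

Import HBNNSimple.

Section affine_continuous_L2.
Context {R : realType} {n : nat}.
Local Notation E := 'rV[R]_n.
Local Notation nsq u := (sqnorm (@leb_rV R n) u%R).
Implicit Types (u v : E -> R) (A U Omega : set E).

Lemma indic_in A (x : E) : A x -> (\1_A x : R) = 1.
Proof. by move=> Ax; rewrite indicE mem_set. Qed.

Lemma indic_out A (x : E) : ~ A x -> (\1_A x : R) = 0.
Proof. by move=> Ax; rewrite indicE memNset. Qed.

(** Open sets form a generating system stable under intersections, which is what the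
    induction on measurable sets below needs. *)
Lemma measurable_rV_open : @measurable _ E = <<s @open E >>.
Proof.
apply/seteqP; split; last first.
  apply: smallest_sub; first exact: sigma_algebra_measurable.
  exact: open_measurable_rV.
move=> A mA.
have mid : measurable_fun setT (id : g_sigma_algebraType (@open E) -> E).
  apply: measurable_fun_rV => i.
  apply: (measurability _ (RGenOpens.measurableE R)).
  move=> _ [_ [a [b ->] <-]]; rewrite setTI; apply: sub_sigma_algebra.
  have /continuousP := @continuous_coord R n i; apply; exact: interval_open.
by have := mid measurableT A mA; rewrite setTI.
Qed.

Lemma cvge0_small (s : (\bar R)^nat) (e : R) : s @ \oo --> 0%E -> 0 < e ->
  exists k, (s k <= e%:E)%E.
Proof.
move=> cs e0; apply: contrapT => /forallNP h.
have : (e%:E <= lim (s k @[k --> \oo]))%E.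
  apply: lime_ge; first by apply/cvg_ex; exists 0%E.
  by near=> k; move: (h k) => /negP; rewrite -ltNge => /ltW.
by rewrite (cvg_lim _ cs)// lee_fin leNgt e0.
Unshelve. all: by end_near. Qed.

Lemma small_measure (D : (set E)^nat) (e : R) : 0 < e ->
  (forall k, measurable (D k)) -> nonincreasing_seq D ->
  (leb_rV (D 0%N) < +oo)%E -> (forall x, exists k, ~ D k x) ->
  exists k, (leb_rV (D k) <= e%:E)%E.
Proof.
move=> e0 mD dD D0 Dx.
have DI : \bigcap_k D k = set0.
  by apply/seteqP; split => // x Dx'; have [k] := Dx x; apply; exact: Dx'.
have := nonincreasing_cvg_mu D0 mD (bigcap_measurableType (fun k _ => mD k)) dD.
by rewrite DI measure0 => /cvge0_small; exact.
Qed.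

Definition inner_part U (k : nat) : set E := [set x | ball x k.+1%:R^-1 `<=` U].

Lemma inner_part_sub U k : inner_part U k `<=` U.
Proof. by move=> x; apply; apply: ballxx; rewrite invr_gt0 ltr0n. Qed.

Lemma measurable_inner_part U k : measurable (inner_part U k).
Proof.
rewrite -[inner_part U k]setCK; apply: measurableC; apply: open_measurable_rV.
rewrite (_ : ~` _ = \bigcup_(y in ~` U) ball y k.+1%:R^-1).
  by apply: bigcup_open => y _; exact: ball_open.
apply/seteqP; split => [x /existsNP[y /not_implyP[xy Uy]]|x [y Uy xy] Kx].
  by exists y => //; exact: ball_sym.
by apply: Uy; apply: Kx; exact: ball_sym.
Qed.

Lemma inner_part_nd U k l : (k <= l)%N -> inner_part U k `<=` inner_part U l.
Proof.
move=> kl x Kk y xy; apply: Kk; apply: le_ball xy.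
by rewrite lef_pV2 ?posrE ?ltr0n// ler_nat.
Qed.

Lemma inner_part_cover U x : open U -> U x -> exists k, inner_part U k x.
Proof.
move=> oU Ux.
have /nbhs_ballP[r /= r0 rU] := open_nbhs_nbhs (conj oU Ux).
exists (Num.truncn r^-1) => y xy; apply: rU; apply: le_ball xy.
rewrite invf_ple ?posrE ?ltr0n//.
by rewrite ltW// Num.Theory.truncnS_gt.
Qed.

(** Points of an inner part of [U] do not leave [U] under a small affine map, and an
    expansion does not increase the measure of the preimage: so the preimage and
    [U] differ by at most twice what lies outside the inner part. *)
Lemma affine_continuous_open U (M : R) : 0 < M -> open U -> U `<=` cube M ->
  affine_continuous (\1_U : E -> R).
Proof.
move=> M0 oU UM e e0; have mU := open_measurable_rV oU.
pose K := inner_part U; have mK k : measurable (K k) by exact: measurable_inner_part.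
have Uoo : (leb_rV U < +oo)%E.
  apply: (le_lt_trans _ (@leb_rV_cube R n M)); apply: le_measure => //; rewrite inE//.
  exact: measurable_cube.
have [k hk] : exists k, (leb_rV (U `\` K k) <= (e / 2)%:E)%E.
  apply: (@small_measure (fun k => U `\` K k)); first exact: divr_gt0.
  - by move=> k; exact: measurableD.
  - move=> k l kl; apply/subsetPset => x [Ux Kx]; split=> // Kl; apply: Kx.
    exact: inner_part_nd Kl.
  - apply: (le_lt_trans _ Uoo); apply: le_measure; rewrite ?inE//.
    + exact: measurableD.
  - move=> x; have [Ux|nUx] := pselect (U x); last by exists 0%N => -[].
    by have [k Kk] := inner_part_cover oU Ux; exists k => -[_].
pose delta := (k.+1%:R * (M + 1))^-1 : R.
have M1 : 0 < M + 1 by rewrite addr_gt0.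
have d0 : 0 < delta by rewrite invr_gt0 mulr_gt0 ?ltr0n.
exists delta => // c b c1 cd bd.
have near x : K k x -> U x /\ U (c *: x + b).
  move=> Kx; have Ux := inner_part_sub Kx.
  split=> //; apply: Kx; rewrite -ball_normE /=.
  have -> : x - (c *: x + b) = - ((c - 1) *: x + b).
    by apply/rowP => i; rewrite !mxE; ring.
  rewrite normrN (le_lt_trans (ler_normD _ _))// normrZ ger0_norm ?subr_ge0//.
  have xM : `|x| <= M by apply/rV_norm_le; [exact: ltW|exact: UM].
  have h1 : (c - 1) * `|x| <= delta * M.
    by rewrite ler_pM ?subr_ge0// lerBlDl ltW.
  rewrite (_ : k.+1%:R^-1 = delta * M + delta); first by rewrite ler_ltD.
  by rewrite -[X in _ + X]mulr1 -mulrDr /delta invfM divfK// gt_eqF.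
have m1 : measurable_fun setT (\1_U : E -> R) by exact: measurable_indic.
have m2 : measurable_fun setT (fun x : E => \1_U (c *: x + b) : R).
  exact: (measurableT_comp m1 (measurable_fun_affine c b)).
have mD : measurable (U `\` K k) by exact: measurableD.
have m3 : measurable_fun setT (\1_(U `\` K k) : E -> R) by exact: measurable_indic.
have Ufin : nsq (\1_U) \is a fin_num.
  by rewrite sqnorm_indic// ge0_fin_numE.
rewrite -(leeD2lE _ _ Ufin).
apply: (@le_trans _ _ (nsq (fun x => \1_U (c *: x + b)) + 2%:E * nsq (\1_(U `\` K k)))%E); last first.
  apply: leeD; first exact: sqnorm_affine.
  rewrite sqnorm_indic//.
  apply: (@le_trans _ _ (2%:E * (e / 2)%:E)%E); first by rewrite lee_pmul2l.
  by rewrite -EFinM lee_fin mulrC divfK.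
have ms v : measurable_fun setT v -> measurable_fun setT (fun x : E => (v x ^+ 2)%:E).
  exact: measurable_sqr.
have s0 v (x : E) : (0 <= ((v x) ^+ 2)%:E)%E by rewrite lee_fin sqr_ge0.
have m4 := measurable_funB m2 m1.
rewrite /sqnorm -(ge0_integralZl_EFin _ measurableT (fun x _ => s0 _ x) (ms _ m3) (ler0n _ 2)).
rewrite -(ge0_integralD _ measurableT (fun x _ => s0 _ x) (ms _ m1) (fun x _ => s0 _ x) (ms _ m4)).
have m5 : measurable_fun setT (fun x : E => (2 : R)%R%:E * (\1_(U `\` K k) x ^+ 2)%:E)%E.
  by apply: measurable_funeM; exact: ms.
rewrite -(ge0_integralD _ measurableT (fun x _ => s0 _ x) (ms _ m2) _ m5); last first.
  by move=> x _; rewrite -EFinM lee_fin mulr_ge0// sqr_ge0.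
apply: ge0_le_integral.
- exact: measurableT.
- by move=> x _; rewrite -EFinD lee_fin addr_ge0// sqr_ge0.
- by apply: emeasurable_funD; [exact: ms|exact: ms].
- by apply: emeasurable_funD => //; exact: ms.
move=> x _; rewrite -EFinM -!EFinD lee_fin.
rewrite (_ : (_ \- _) x = \1_U (c *: x + b) - \1_U x)//.
have h01 A (y : E) : (\1_A y : R) = 0 \/ (\1_A y : R) = 1.
  by rewrite indicE; case: (_ \in _); [right|left].
have [kx|kx] := pselect (K k x).
  have [Ux UAx] := near _ kx.
  rewrite (indic_in Ux) (indic_in UAx) subrr.
  by rewrite expr1n expr0n addr0 lerDl mulr_ge0// sqr_ge0.
have [Ux|Ux] := pselect (U x); last first.
  by rewrite (indic_out Ux) subr0 expr0n add0r lerDl mulr_ge0// sqr_ge0.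
rewrite (indic_in Ux) (@indic_in (U `\` K k) x)//.
case: (h01 U (c *: x + b)) => ->.
  by rewrite sub0r sqrrN !expr1n expr0n add0r mulr1.
by rewrite subrr !expr1n expr0n addr0 mulr1 lerDl.
Qed.

Variable M : R.
Hypothesis M0 : 0 < M.
Local Notation B := (ball (0 : E) M).

Let Bcube : B `<=` cube M.
Proof.
move=> x /(rV_ballE _ _ M0) h i.
by have := h i; rewrite mxE sub0r normrN => /ltW.
Qed.

Let mB : measurable B. Proof. exact: measurable_rV_ball. Qed.

Let Boo A : measurable A -> (leb_rV (A `&` B) < +oo)%E.
Proof.
move=> mA; apply: (le_lt_trans _ (@leb_rV_cube R n M)); apply: le_measure; rewrite ?inE.
- exact: measurableI.
- exact: measurable_cube.
- by move=> x [_ /Bcube].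
Qed.

Let sqnorm_indicD A C : measurable A -> measurable C -> A `<=` C ->
  nsq (fun x => \1_C x - \1_A x) = leb_rV (C `\` A).
Proof.
move=> mA mC AC; rewrite -sqnorm_indic; last exact: measurableD.
apply: eq_integral => x _; congr ((_ ^+ 2)%:E).
have [Ax|Ax] := pselect (A x).
  by rewrite (indic_in (AC _ Ax)) (indic_in Ax) subrr indic_out// => -[].
rewrite (indic_out Ax) subr0; have [Cx|Cx] := pselect (C x).
  by rewrite !indic_in.
by rewrite !indic_out// => -[].
Qed.

(** Continuity in mean is inherited by complements and by countable disjoint
    unions, the partial unions being close in measure. *)
Lemma affine_continuous_indic A : measurable A ->
  affine_continuous (\1_(A `&` B) : E -> R).
Proof.
rewrite measurable_rV_open; move: A; apply: (dynkin_induction (T := E)).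
- exact: measurable_rV_open.
- by move=> U W; exact: openI.
- rewrite setTI; apply: (affine_continuous_open M0); last exact: Bcube.
  exact: ball_open.
- move=> U oU; apply: (affine_continuous_open M0); last by move=> x [_ /Bcube].
  by apply: openI => //; exact: ball_open.
- move=> A mA cA; have mAB := measurableI _ _ mA mB.
  rewrite (_ : \1_ _ = (fun x => \1_B x + (- 1) * \1_(A `&` B) x)).
    apply: affine_continuousD.
    + exact: measurable_indic.
    + by apply: measurable_funM => //; exact: measurable_indic.
    + apply: (affine_continuous_open M0); [exact: ball_open|exact: Bcube].
    + by apply: affine_continuousZ => //; exact: measurable_indic.
  apply/funext => x; have [Bx|Bx] := pselect (B x); last first.
    by rewrite !indic_out ?mulr0 ?addr0// => -[].
  rewrite [in RHS](indic_in Bx); have [Ax|Ax] := pselect (A x).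
    by rewrite indic_out ?indic_in ?mulN1r ?subrr// => -[].
  by rewrite indic_in ?indic_out ?mulr0 ?addr0// => -[].
move=> F mF tF cF; pose G k := (\bigcup_(i < k) F i) `&` B.
have mU : measurable (\bigcup_k F k) by exact: bigcup_measurable.
have mUk k : measurable (\bigcup_(i < k) F i).
  by apply: bigcup_measurable.
have mG k : measurable (G k) by apply: measurableI.
have mFB k : measurable (F k `&` B) by exact: measurableI.
have GE k : (\1_(G k) : E -> R) = (fun x => \sum_(i <- iota 0 k) \1_(F i `&` B) x).
  apply/funext => x; have [Gx|Gx] := pselect (G k x).
    rewrite (indic_in Gx); case: Gx => -[i /= ik Fi] Bx.
    rewrite (bigD1_seq i) ?mem_iota ?add0n ?iota_uniq//= indic_in// big1 ?addr0// => j ji.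
    rewrite indic_out// => -[Fj _]; move/eqP: ji; apply.
    by apply: (tF _ _ I I); exists x.
  rewrite (indic_out Gx) big_seq big1// => i.
  rewrite mem_iota add0n => /= ik; rewrite indic_out// => -[Fi Bx]; apply: Gx.
  by split=> //; exists i.
apply: affine_continuous_lim; first by apply: measurable_indic; exact: measurableI.
move=> e e0; pose D k := ((\bigcup_k F k) `&` B) `\` G k.
have [k hk] : exists k, (leb_rV (D k) <= e%:E)%E.
  apply: (@small_measure D) => //.
  - by move=> k; apply: measurableD => //; exact: measurableI.
  - move=> k l kl; apply/subsetPset => x [Ux Gx]; split=> // -[[i ik Fi] Bx]; apply: Gx.
    by split=> //; exists i => //=; exact: leq_trans kl.
  - apply: (le_lt_trans _ (Boo mU)); apply: le_measure; rewrite ?inE//.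
    + by apply: measurableD => //; exact: measurableI.
    + exact: measurableI.
    + by move=> x [].
  - move=> x; have [[[i _ Fi] Bx]|nx] := pselect (((\bigcup_k F k) `&` B) x).
      by exists i.+1 => -[_]; apply; split=> //; exists i => /=.
    by exists 0%N => -[].
exists (\1_(G k)); split.
- exact: measurable_indic.
- rewrite GE; apply: affine_continuous_sum => // i; exact: measurable_indic.
- rewrite sqnorm_indicD//; first exact: measurableI.
  by move=> x [[i _ Fi] Bx]; split => //; exists i.
Qed.

Let affine_continuous_L2_ge0 u : measurable_fun setT u -> (nsq u < +oo)%E ->
  (forall x, ~ B x -> u x = 0) -> (forall x, 0 <= u x) -> affine_continuous u.
Proof.
move=> m1 u2 u0 upos.
have mE : measurable_fun setT (EFin \o u) by exact/measurable_EFinP.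
pose w k := nnsfun_approx measurableT mE k.
pose v k (x : E) : R := w k x.
have pE x : setT x -> (0 <= (EFin \o u) x)%E by rewrite lee_fin.
have mv k : measurable_fun setT (v k) by exact: measurable_funP.
have cv x : (v k x)%:E @[k --> \oo] --> (u x)%:E.
  exact: (cvg_nnsfun_approx measurableT mE pE (x := x) I).
have v0 k x : 0 <= v k x by exact: fun_ge0.
have vu k x : v k x <= u x.
  have := le_approx k pE (x := x) I.
  by rewrite -(nnsfun_approxE measurableT mE) lee_fin.
apply: affine_continuous_lim => // e e0.
have [k hk] : exists k, (nsq (fun x => u x - v k x) <= e%:E)%E.
  apply: cvge0_small => //.
  have [|||||_ _] := @dominated_convergence _ _ _ (@leb_rV R n) setT measurableT
    (fun k x => ((u x - v k x) ^+ 2)%:E) (cst 0%E) (fun x => ((u x) ^+ 2)%:E).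
  - by move=> k; apply: measurable_sqr; exact: measurable_funB.
  - exact: measurable_cst.
  - apply: aeW => x _; apply: cvg_EFin; first by near=> k.
    have : (fun k => (u x - v k x) ^+ 2) @ \oo --> (u x - u x) ^+ 2.
      by apply: cvgM; apply: cvgB => //; [exact: cvg_cst|exact: fine_cvg (cv x)|exact: cvg_cst|exact: fine_cvg (cv x)].
    by rewrite subrr expr0n.
  - apply/integrableP; split; first exact: measurable_sqr.
    rewrite (eq_integral (fun x => ((u x) ^+ 2)%:E))// => x _.
    by rewrite /= ger0_norm// sqr_ge0.
  - apply: aeW => x k _; rewrite /= lee_fin ger0_norm ?sqr_ge0// ler_pXn2r ?nnegrE ?subr_ge0//.
    by rewrite lerBlDr lerDl.
  by rewrite integral0; exact.
exists (v k); split => //.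
pose s : seq R := finmap.enum_fset (fset_set (range (v k))).
rewrite (_ : v k = (fun x => \sum_(i < size s) (s`_i * \1_((v k @^-1` [set s`_i]) `&` B) x))).
  apply: affine_continuous_sum => i.
    by apply: measurable_funM => //; apply: measurable_indic; exact: measurableI.
  apply: affine_continuousZ.
    by apply: measurable_indic; exact: measurableI.
  by apply: affine_continuous_indic.
apply/funext => x; rewrite {1}/v (fimfunEord (w k)); apply: eq_bigr => i _.
have [Bx|Bx] := pselect (B x).
  by congr (_ * _); rewrite !indicE in_setI (mem_set Bx) andbT.
rewrite [in RHS]indic_out ?mulr0; last by case.
have vx : v k x = 0 by apply/eqP; rewrite eq_le v0 (le_trans (vu k x))// u0.
have [si|si] := pselect ((v k @^-1` [set s`_i]) x); last by rewrite indic_out ?mulr0.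
by move: si; rewrite /= vx => <-; rewrite mul0r.
Unshelve. all: by end_near. Qed.

(** Simple functions are dense in mean square. *)
Lemma affine_continuous_L2 u : measurable_fun setT u -> (nsq u < +oo)%E ->
  (forall x, ~ B x -> u x = 0) -> affine_continuous u.
Proof.
move=> m1 u2 u0.
have h v : measurable_fun setT v -> (forall x, `|v x| <= `|u x|) ->
    (forall x, 0 <= v x) -> affine_continuous v.
  move=> mv vu v0; apply: affine_continuous_L2_ge0 => //.
    exact: le_lt_trans (le_sqnorm _ mv m1 vu) u2.
  move=> x /u0 ux; apply/eqP; rewrite -normr_le0 (le_trans (vu x))// ux normr0//.
pose p x := Num.max (u x) 0; pose q x := Num.max (- u x) 0.
have mp : measurable_fun setT p by exact: measurable_maxr.
have mq : measurable_fun setT q.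
  by apply: measurable_maxr => //; exact: measurableT_comp.
have pq x : [/\ 0 <= p x, 0 <= q x, `|p x| <= `|u x|, `|q x| <= `|u x| & u x = p x - q x].
  rewrite /p /q; have [ux|ux] := leP 0 (u x).
    have h1 : - u x <= 0 by rewrite oppr_le0.
    by rewrite (max_idPr h1) subr0 normr0 normr_ge0 lexx.
  have h1 : 0 <= - u x by rewrite oppr_ge0 ltW.
  by rewrite (max_idPl h1) sub0r opprK normrN normr0 normr_ge0 lexx.
rewrite (_ : u = (fun x => p x + (- 1) * q x)); last first.
  by apply/funext => x; rewrite mulN1r; case: (pq x).
have cp : affine_continuous p by apply: h => // x; case: (pq x).
have cq : affine_continuous q by apply: h => // x; case: (pq x).
apply: affine_continuousD => //; first exact: measurable_funM.
exact: affine_continuousZ.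
Qed.

End affine_continuous_L2.

(** * Averages in mean square *)

Section averages.
Context {R : realType} {n : nat}.
Local Notation E := 'rV[R]_n.
Local Notation mu := (@lebesgue_measure R).
Local Notation nsq u := (sqnorm (@leb_rV R n) u%R).

(** Jensen in the averaging variable, then Tonelli: a weighted average of functions
    of small mean square norm has small mean square norm. Used for mollification
    and for primitives along a direction. *)
Lemma sqnorm_average_le d (Y : measurableType d)
    (m : {sigma_finite_measure set Y -> \bar R})
    (h1 h2 : E * Y -> R) (w : Y -> R) (W : R) (K : \bar R) :
  measurable_fun setT h1 -> measurable_fun setT h2 ->
  m.-integrable setT (EFin \o w) -> (forall y, 0 <= w y) -> 0 < W ->
  \int[m]_y w y <= W ->
  (forall x, m.-integrable setT (EFin \o (fun y => h2 (x, y) * w y))) ->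
  measurable_fun setT
    (fun x => \int[m]_y (h1 (x, y) * w y) - \int[m]_y (h2 (x, y) * w y)) ->
  (0 <= K)%E ->
  (forall y, 0 < w y -> (nsq (fun x => h1 (x, y) - h2 (x, y)) <= K)%E) ->
  (nsq (fun x => \int[m]_y (h1 (x, y) * w y) - \int[m]_y (h2 (x, y) * w y)) <=
   (W ^+ 2)%:E * K)%E.
Proof.
move=> mh1 mh2 iw w0 W0 wW ih2 mD K0 hK; have mw := integrable_measurable iw.
pose q (p : E * Y) := (h1 p - h2 p) ^+ 2 * w p.2.
have mq : measurable_fun setT q.
  apply: measurable_funM; last exact: (measurableT_comp mw measurable_snd).
  by apply: measurable_funX; exact: measurable_funB.
have mqE : measurable_fun setT (EFin \o q) by exact/measurable_EFinP.
have q0 p : (0 <= (EFin \o q) p)%E by rewrite lee_fin mulr_ge0 ?sqr_ge0.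
have mx (x : E) : measurable_fun setT (fun y : Y => (x, y)).
  exact: measurable_pair1.
have my (y : Y) : measurable_fun setT (fun x : E => (x, y)).
  exact: measurable_pair2.
have mF : measurable_fun setT (fun x => \int[m]_y (q (x, y))%:E)%E.
  exact: (@measurable_fun_fubini_tonelli_F _ _ _ _ _ m (EFin \o q)).
have mG : measurable_fun setT (fun y => \int[@leb_rV R n]_x (q (x, y))%:E)%E.
  exact: (@measurable_fun_fubini_tonelli_G _ _ _ _ _ (@leb_rV R n) (EFin \o q)).
have W0' : (0 <= W%:E)%E by rewrite lee_fin ltW.
apply: (@le_trans _ _ (\int[leb_rV]_x (W%:E * \int[m]_y (q (x, y))%:E))%E).
  apply: ge0_le_integral.
  - exact: measurableT.
  - by move=> x _; rewrite lee_fin sqr_ge0.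
  - exact: measurable_sqr.
  - exact: measurable_funeM.
  - move=> x _; apply: (sqr_Rintegral_sub_le _ _ iw w0 W0 wW (ih2 x)).
      exact: measurableT_comp mh1 (mx x).
    exact: measurableT_comp mh2 (mx x).
rewrite (ge0_integralZl_EFin _ measurableT (fun x _ => integral_ge0 _ _) mF (ltW W0)); last first.
  by move=> x _ y _; exact: q0.
rewrite expr2 EFinM -muleA; apply: lee_wpmul2l => //.
rewrite (fubini_tonelli (EFin \o q) mqE q0).
apply: (@le_trans _ _ (\int[m]_y ((w y)%:E * K))%E); last first.
  have mwE : measurable_fun setT (EFin \o w) by exact/measurable_EFinP.
  have w0E y : setT y -> (0 <= (EFin \o w) y)%E by rewrite lee_fin.
  rewrite (ge0_integralZr m measurableT mwE w0E K0).
  apply: lee_wpmul2r => //.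
  have -> : (\int[m]_y (w y)%:E = (\int[m]_y w y)%:E)%E.
    rewrite /Rintegral fineK//; exact: (integrable_fin_num measurableT iw).
  by rewrite lee_fin.
apply: ge0_le_integral.
- exact: measurableT.
- by move=> y _; apply: integral_ge0 => x _; exact: q0.
- exact: mG.
- by apply: emeasurable_funM; [exact/measurable_EFinP|exact: measurable_cst].
move=> y _; rewrite (_ : (\int[leb_rV]_x (EFin \o q) (x, y) =
    (w y)%:E * nsq (fun x => h1 (x, y) - h2 (x, y)))%E); last first.
  rewrite -ge0_integralZl//.
  - by apply: eq_integral => x _; rewrite /= /q /= mulrC EFinM.
  - apply: measurable_sqr; apply: measurable_funB.
      exact: measurableT_comp mh1 (my y).
    exact: measurableT_comp mh2 (my y).
  - by move=> x _; rewrite lee_fin sqr_ge0.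
  - by rewrite lee_fin.
have := w0 y; rewrite le_eqVlt => /orP[/eqP <-|wy]; first by rewrite !mul0e.
by apply: lee_wpmul2l; [rewrite lee_fin|exact: hK].
Qed.

Lemma sqnorm_integrable M (u : E -> R) : measurable_fun setT u -> (nsq u < +oo)%E ->
  (forall x, ~ cube M x -> u x = 0) -> leb_rV.-integrable setT (EFin \o u).
Proof.
move=> mu_ u2 u0.
have iq : leb_rV.-integrable setT (EFin \o (fun x => u x ^+ 2 * \1_(@cube R n M) x)).
  apply/integrableP; split.
    apply/measurable_EFinP; apply: measurable_funM; first exact: measurable_funX.
    exact: measurable_indic (measurable_cube _).
  rewrite (eq_integral (fun x => ((u x) ^+ 2)%:E))// => x _ /=.
  have [xM|xM] := pselect (cube M x); last by rewrite u0// expr0n mul0r normr0.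
  by rewrite indic_in// mulr1 ger0_norm// sqr_ge0.
have iw : leb_rV.-integrable setT (EFin \o (\1_(@cube R n M) : E -> R)).
  apply: (@integrable_bounded_support _ _ _ _ (cube M) 1).
  - exact: measurable_cube.
  - exact: leb_rV_cube.
  - exact: measurable_indic (measurable_cube _).
  - by move=> x xM; rewrite indic_in// normr1.
  - by move=> x xM; rewrite indic_out.
have w0 x : 0 <= (\1_(@cube R n M) x : R) by rewrite indicE; case: (_ \in _).
have := integrable_of_sqr mu_ iw w0 iq.
rewrite (_ : (fun x => u x * _) = u)//; apply/funext => x.
have [xM|xM] := pselect (cube M x); first by rewrite indic_in// mulr1.
by rewrite u0// mul0r.
Qed.

(** Convergence in mean square on a bounded set is enough to pass to the limit in
    integrals against bounded functions. *)
Lemma sqnorm_bounded_pairing M : exists2 K : R, 0 < K & forall (u X : E -> R) (C : R),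
  measurable_fun setT u -> (forall x, ~ cube M x -> u x = 0) ->
  measurable_fun setT X -> (forall x, `|X x| <= C) ->
  (((\int[leb_rV]_x (u x * X x)) ^+ 2)%:E <= (K * C ^+ 2)%:E * nsq u)%E.
Proof.
pose w : E -> R := \1_(cube M).
have iw : leb_rV.-integrable setT (EFin \o w).
  apply: (@integrable_bounded_support _ _ _ _ (cube M) 1).
  - exact: measurable_cube.
  - exact: leb_rV_cube.
  - exact: measurable_indic (measurable_cube _).
  - by move=> x xM; rewrite /w indic_in// normr1.
  - by move=> x xM; rewrite /w indic_out.
have w0 x : 0 <= w x by rewrite /w indicE; case: (_ \in _).
have w1 x : w x <= 1 by rewrite /w indicE; case: (_ \in _).
pose K := \int[leb_rV]_x w x + 1; have K0 : 0 < K.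
  by rewrite ltr_wpDl// Rintegral_ge0.
exists K => // u X C mu_ u0 mX XC; have C0 : 0 <= C := le_trans (normr_ge0 _) (XC 0).
have i0 : leb_rV.-integrable setT (EFin \o (fun x : E => (0 : R) * w x)).
  exact: integrableZ_R.
have mh : measurable_fun setT (fun x => u x * X x) by exact: measurable_funM.
have wK : \int[leb_rV]_x w x <= K by rewrite lerDl.
have m0 : measurable_fun setT (fun _ : E => 0 : R) by exact: measurable_cst.
have := sqr_Rintegral_sub_le mh m0 iw w0 K0 wK i0.
rewrite [X in _ - X]Rintegral_eq0 ?subr0; last by move=> x; rewrite mul0r.
rewrite (_ : \int[leb_rV]_x (u x * X x * w x) = \int[leb_rV]_x (u x * X x)); last first.
  apply: eq_Rintegral => x _; rewrite /w; have [xM|xM] := pselect (cube M x).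
    by rewrite indic_in// mulr1.
  by rewrite u0// !mul0r.
move=> /le_trans; apply; rewrite EFinM -muleA; apply: lee_wpmul2l.
  by rewrite lee_fin ltW.
rewrite -ge0_integralZl//; last 3 first.
- exact: measurable_sqr.
- by move=> x _; rewrite lee_fin sqr_ge0.
- by rewrite lee_fin sqr_ge0.
apply: ge0_le_integral.
- exact: measurableT.
- by move=> x _; rewrite lee_fin mulr_ge0 ?sqr_ge0.
- apply/measurable_EFinP; apply: measurable_funM; last exact: integrable_measurable iw.
  by apply: measurable_funX; exact: measurable_funB.
- by apply: measurable_funeM; exact: measurable_sqr.
move=> x _; rewrite -EFinM lee_fin subr0 exprMn.
have q0 : 0 <= u x ^+ 2 * X x ^+ 2 := mulr_ge0 (sqr_ge0 _) (sqr_ge0 _).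
apply: (@le_trans _ _ (u x ^+ 2 * X x ^+ 2)); first by rewrite ler_piMr.
rewrite mulrC; apply: ler_wpM2r; first exact: sqr_ge0.
by rewrite -[leLHS]real_normK ?num_real// ler_pXn2r ?nnegrE.
Qed.

(** A mollification composed with an affine map is an average of affine
    perturbations of [u]. *)
Lemma mollify_affine M (u : E -> R) (e : R) : 0 < M -> measurable_fun setT u ->
  (nsq u < +oo)%E -> (forall x, ~ cube M x -> u x = 0) -> 0 < e ->
  exists2 delta : R, 0 < delta & forall (c : R) (b : E) (r : R),
    1 <= c -> c < 1 + delta -> `|b| < delta -> 0 < r -> r < delta ->
    (nsq (fun x => conv u (mollifier r) (c *: x + b) - u x) <= e%:E)%E.
Proof.
move=> M0 m1 u2 u0 e0; have iu := sqnorm_integrable m1 u2 u0.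
have M1 : 0 < M + 1 by rewrite addr_gt0.
have uB x : ~ ball (0 : E) (M + 1) x -> u x = 0.
  move=> xB; apply: u0 => xM; apply: xB; apply/(rV_ballE _ _ M1) => i.
  by rewrite mxE sub0r normrN (le_lt_trans (xM i))// ltrDl.
have [delta d0 hd] := affine_continuous_L2 M1 m1 u2 uB e0.
exists (delta / 2); first exact: divr_gt0.
move=> c b r c1 cd bd r0 rd.
have cr := csmooth_mollifier (n := n) r0; set rho := mollifier r in cr *.
have irho := csmooth_integrable cr.
have mA : measurable_fun setT (fun p : E * E => c *: p.1 + b - p.2).
  apply: measurable_fun_rV => i; under eq_fun do rewrite !mxE.
  apply: measurable_funB; last exact: (measurableT_comp (measurable_coord i) measurable_snd).
  apply: measurable_funD => //; apply: measurable_funM => //.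
  exact: (measurableT_comp (measurable_coord i) measurable_fst).
pose h1 (p : E * E) := u (c *: p.1 + b - p.2).
pose h2 (p : E * E) := u p.1.
have convE x : conv u rho (c *: x + b) = \int[leb_rV]_y (h1 (x, y) * rho y).
  set a := c *: x + b.
  have N1 : - 1 != 0 :> R by rewrite oppr_eq0 oner_eq0.
  have := Rintegral_affine a N1 (conv_integrable iu a cr).
  rewrite normrN normr1 expr1n invr1 mul1r /conv => <-; apply: eq_Rintegral => y _.
  rewrite scaleN1r /h1 /= -/a [- y + a]addrC; congr (_ * rho _).
  by rewrite opprB addrC subrK.
have intE x : \int[leb_rV]_y (h2 (x, y) * rho y) = u x.
  by rewrite /h2 /= (RintegralZl (u x) measurableT irho) mollifier_integral// mulr1.
rewrite (_ : (fun x => _) = (fun x => \int[leb_rV]_y (h1 (x, y) * rho y) -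
    \int[leb_rV]_y (h2 (x, y) * rho y))); last first.
  by apply/funext => x; rewrite convE intE.
have := @sqnorm_average_le _ _ (@leb_rV R n) h1 h2 rho 1 e%:E.
rewrite expr1n mul1e; apply.
- exact: (measurableT_comp m1 mA).
- exact: (measurableT_comp m1 measurable_fst).
- exact: irho.
- by move=> y; exact: mollifier_ge0.
- exact: ltr01.
- by rewrite mollifier_integral.
- by move=> x; exact: (integrableZ_R (h2 (x, 0)) irho).
- rewrite (_ : (fun x => _) = (fun x => conv u rho (c *: x + b) - u x)); last first.
    by apply/funext => x; rewrite convE intE.
  apply: measurable_funB => //; apply: measurableT_comp; last exact: measurable_fun_affine.
  exact: smooth_measurable (smooth_conv iu cr).
- by rewrite lee_fin ltW.
move=> y ry.
have yr : `|y| <= r.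
  apply/rV_norm_le; first exact: ltW.
  by apply: contrapT => yc; move: ry; rewrite (cr.2 y yc) ltxx.
rewrite (_ : (fun x => _) = (fun x => u (c *: x + (b - y)) - u x)); last first.
  by apply/funext => x; rewrite /h1 /h2 /= addrA.
apply: hd => //.
  by move: cd d0; lra.
by rewrite (le_lt_trans (ler_normB _ _))//; lra.
Qed.

Definition half_window (T t : R) : R := if (- T <= t) && (t <= 0) then 1 else 0.

Lemma measurable_half_window T : measurable_fun setT (half_window T).
Proof.
apply: measurable_fun_ifT => //.
by apply: measurable_and; apply: measurable_fun_ler.
Qed.

Lemma half_window_ge0 T t : 0 <= half_window T t.
Proof. by rewrite /half_window; case: ifP. Qed.

Lemma half_window_far T t : `|T| < `|t| -> half_window T t = 0.
Proof.
move=> tT; rewrite /half_window; case: ifP => // /andP[h1 h2].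
move: tT; rewrite ltNge ler0_norm// => /negP[].
by rewrite (le_trans _ (ler_norm T))// lerNl.
Qed.

Lemma half_window_integrable T : mu.-integrable setT (EFin \o half_window T).
Proof.
apply: (integrable_bounded_itv (C := 1) (T := `|T|)).
- exact: measurable_half_window.
- by move=> t; rewrite /half_window; case: ifP; rewrite ?normr1 ?normr0.
- by move=> t; exact: half_window_far.
Qed.

(** The window makes the primitive a finite average; on a cube it agrees with the
    integral from minus infinity for functions supported in that cube, provided the
    window is longer than the side. *)
Definition primitive (T : R) (v : E) (u : E -> R) (x : E) : R :=
  \int[mu]_t (u (x + t *: v) * half_window T t).

Lemma csmooth_window_integrable M (u : E -> R) x v T : csmooth M u ->
  mu.-integrable setT (EFin \o (fun t : R => u (x + t *: v) * half_window T t)).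
Proof.
move=> cu; have [C C0 hC] := csmooth_bounded cu.
apply: (integrable_bounded_itv (C := C) (T := `|T|)).
- apply: measurable_funM; last exact: measurable_half_window.
  exact: (measurableT_comp (smooth_measurable cu.1) (measurable_line x v)).
- move=> t; rewrite normrM (ger0_norm (half_window_ge0 _ _)) -[leRHS]mulr1.
  apply: ler_pM => //; first exact: half_window_ge0.
  by rewrite /half_window; case: ifP.
- by move=> t tT; rewrite half_window_far// mulr0.
Qed.

Let measurable_add_line (v : E) :
  measurable_fun setT (fun p : E * measurableTypeR R => p.1 + p.2 *: v).
Proof.
apply: measurable_fun_rV => i; under eq_fun do rewrite !mxE.
apply: measurable_funD; first exact: (measurableT_comp (measurable_coord i) measurable_fst).
apply: measurable_funM => //; exact: measurable_snd.
Qed.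

Lemma measurable_primitive (T : R) (v : E) (u : E -> R) :
  measurable_fun setT u -> measurable_fun setT (primitive T v u).
Proof.
move=> m_u; apply: (@measurable_Rintegral R _ _ E (measurableTypeR R) mu
  (fun p => u (p.1 + p.2 *: v) * half_window T p.2)).
apply: measurable_funM; first exact: (measurableT_comp m_u (measurable_add_line v)).
exact: (measurableT_comp (measurable_half_window T) measurable_snd).
Qed.

(** Where [u1] fails to be integrable along a line, the right-hand side of Jensen's
    inequality is infinite, so the bound holds at every point. *)
Lemma sqnorm_primitive M (T : R) (v : E) : 0 < T -> exists2 K : R, 0 < K &
  forall u1 u2 : E -> R, measurable_fun setT u1 -> (nsq u1 < +oo)%E ->
    (forall x, ~ cube M x -> u1 x = 0) -> csmooth M u2 ->
    (nsq (fun x => primitive T v u1 x - primitive T v u2 x) <=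
      K%:E * nsq (fun x => u1 x - u2 x))%E.
Proof.
move=> T0; have iw := half_window_integrable T.
pose W := \int[mu]_t half_window T t + 1.
have W0 : 0 < W by rewrite ltr_wpDl// Rintegral_ge0// => t _; exact: half_window_ge0.
exists (W ^+ 2); first exact: exprn_gt0.
move=> u1 u2 m1 n1 z1 cu2.
have m2 := smooth_measurable cu2.1.
have mA := measurable_add_line v.
have meas := measurable_primitive T v.
have iu2 (x : E) : mu.-integrable setT
    (EFin \o (fun t : R => u2 (x + t *: v) * half_window T t)).
  exact: csmooth_window_integrable cu2.
apply: (@sqnorm_average_le _ (measurableTypeR R) mu (fun p => u1 (p.1 + p.2 *: v))
  (fun p => u2 (p.1 + p.2 *: v)) (half_window T) W).
- exact: (measurableT_comp m1 mA).
- exact: (measurableT_comp m2 mA).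
- exact: iw.
- exact: half_window_ge0.
- exact: W0.
- by rewrite lerDl.
- exact: iu2.
- exact: measurable_funB (meas _ m1) (meas _ m2).
- exact: sqnorm_ge0.
- move=> t _.
  have := @sqnorm_affine R n (fun x => u1 x - u2 x) 1 (t *: v) (measurable_funB m1 m2) (lexx 1).
  by congr (_ <= _)%E; congr (sqnorm _ _); apply/funext => x; rewrite scale1r.
Qed.

End averages.

(** * Convexity and translation invariance *)

Section convexity.
Context {R : realType} {n : nat}.
Local Notation E := 'rV[R]_n.

Lemma convex_combination (Omega : set E) (x y : E) (t : R) : convex_set Omega ->
  0 <= t -> t <= 1 -> Omega x -> Omega y -> Omega (t *: x + (1 - t) *: y).
Proof.
move=> cO t0 t1 Ox Oy.
have := cO x y (Itv01 t0 t1) (mem_set Ox) (mem_set Oy).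
by rewrite inE.
Qed.

Definition thicken (Omega : set E) (e : R) : set E :=
  [set x | exists2 y, Omega y & `|x - y| <= e].

(** The thickening of a convex set is convex; only the segments used for
    [potential_support] are considered. *)
Lemma thicken_line (Omega : set E) (e : R) (x v : E) (a b : R) : convex_set Omega ->
  a <= 0 -> 0 <= b -> thicken Omega e (x + a *: v) -> thicken Omega e (x + b *: v) ->
  thicken Omega e x.
Proof.
move=> cO a0 b0 [y1 O1 h1] [y2 O2 h2].
have [ab|ab] := eqVneq a b.
  have a00 : a = 0 by apply/eqP; rewrite eq_le a0 ab.
  by exists y1 => //; move: h1; rewrite a00 scale0r addr0.
have ba : 0 < b - a by rewrite subr_gt0 lt_neqAle ab (le_trans a0).
pose t := b / (b - a).
have t0 : 0 <= t by rewrite divr_ge0// ltW.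
have t1 : t <= 1 by rewrite ler_pdivrMr// mul1r lerDl oppr_ge0.
have tab : t * a + (1 - t) * b = 0 by rewrite /t; field; rewrite gt_eqF.
clearbody t.
exists (t *: y1 + (1 - t) *: y2); first exact: convex_combination.
have -> : x - (t *: y1 + (1 - t) *: y2) =
    t *: (x + a *: v - y1) + (1 - t) *: (x + b *: v - y2) - (t * a + (1 - t) * b) *: v.
  by apply/rowP => i; rewrite !mxE; ring.
rewrite tab scale0r subr0 (le_trans (ler_normD _ _))// !normrZ.
rewrite (ger0_norm t0) ger0_norm ?subr_ge0//.
have -> : e = t * e + (1 - t) * e by ring.
by rewrite lerD// ler_wpM2l// subr_ge0.
Qed.

(** [x] is a convex combination of a point of [Omega] close to the dilated point and of a
    point of the ball around [o]. *)
Lemma thicken_dilation (Omega : set E) (o x : E) (r e lambda : R) : convex_set Omega ->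
  (forall y, `|y - o| < r -> Omega y) -> 1 < lambda -> e < r * (lambda - 1) ->
  thicken Omega e (lambda *: x + (1 - lambda) *: o) -> Omega x.
Proof.
move=> cO hr l1 er [y Oy hy]; have l0 : 0 < lambda by rewrite (lt_trans ltr01).
have l10 : 0 < lambda - 1 by rewrite subr_gt0.
set z := lambda *: x + (1 - lambda) *: o - y in hy.
have Oz : Omega (o + (lambda - 1)^-1 *: z).
  apply: hr; rewrite addrC addKr normrZ normfV (gtr0_norm l10) mulrC ltr_pdivrMr//.
  exact: le_lt_trans er.
have il0 : 0 <= lambda^-1 by rewrite invr_ge0 ltW.
have il1 : lambda^-1 <= 1 by rewrite invf_le1// ltW.
have := convex_combination cO il0 il1 Oy Oz.
congr Omega; rewrite /z; apply/rowP => i; rewrite !mxE; field.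
by rewrite !gt_eqF.
Qed.

Lemma conv_thicken (Omega : set E) (u : E -> R) (e : R) x : 0 < e ->
  ~ thicken Omega e x -> conv (u \_ Omega) (mollifier e) x = 0.
Proof.
move=> e0 xO; apply: Rintegral_eq0 => y; rewrite patchE; case: ifPn; last by rewrite mul0r.
rewrite inE => Oy; case: (csmooth_mollifier (n := n) e0) => _ ->; first by rewrite mulr0.
by move=> xy; apply: xO; exists y => //; exact: (rV_norm_le _ (ltW e0)).2.
Qed.

End convexity.

Section translation_invariance.
Context {R : realType} {n : nat}.
Local Notation E := 'rV[R]_n.

(** Translating along [v] does not change the integral of [w * Psi]. *)
Lemma integral_derive_invariant M (w Psi : E -> R) (v : E) (C : R) : csmooth M w ->
  measurable_fun setT Psi -> (forall x, `|Psi x| <= C) ->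
  (forall x (s : R), Psi (x + s *: v) = Psi x) ->
  \int[leb_rV]_x ('D_v w x * Psi x) = 0.
Proof.
move=> cw mPsi PC Pinv; have cdw := csmooth_derive v cw.
have [C1 C10 hC1] := csmooth_bounded cdw.
have iw := csmooth_integrable cw.
have M'0 : 0 <= `|M| + `|v| by rewrite addr_ge0.
have N0 : (1 : R) != 0 by rewrite oner_eq0.
have shift (s : R) : leb_rV.-integrable setT (EFin \o (fun x : E => w (x + s *: v))).
  have := integrable_affine (s *: v) N0 iw.
  by congr (is_true (integrable _ _ _)); apply/funext => x /=; rewrite scale1r.
pose G (x : E) := \1_(cube (`|M| + `|v|)) x * (C1 * C).
have d : is_derive (0 : R) 1 (fun s : R => \int[leb_rV]_x (w (x + s *: v) * Psi x))
    (\int[leb_rV]_x ('D_v w (x + 0 *: v) * Psi x)).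
  apply: (@derive_under_Rintegral R _ _ (@leb_rV R n)
    (fun s x => w (x + s *: v) * Psi x) (fun s x => 'D_v w (x + s *: v) * Psi x) G 1) => //.
  - by move=> s _; apply: (integrable_mul_bounded (shift s) mPsi PC).
  - move=> s x _.
    rewrite (_ : (fun s : R => w (x + s *: v) * Psi x) =
      (fun s : R => Psi x * w (x + s *: v))); last by apply/funext => ?; rewrite mulrC.
    rewrite mulrC; apply: (is_deriveZ (Psi x)).
    by apply: is_derive_line; apply: smooth_is_derive; exact: cw.1.
  - apply: (@integrable_bounded_support _ _ _ _ (cube (`|M| + `|v|)) `|C1 * C|).
    + exact: measurable_cube.
    + exact: leb_rV_cube.
    + apply: measurable_funM => //; exact: measurable_indic (measurable_cube _).
    + by move=> x xM; rewrite /G indic_in// mul1r.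
    + by move=> x xM; rewrite /G indic_out// mul0r.
  - move=> s x s1; rewrite /G; have [xM|xM] := pselect (cube (`|M| + `|v|) x).
      by rewrite indic_in// mul1r normrM ler_pM.
    rewrite (_ : 'D_v w (x + s *: v) = 0) ?mul0r ?normr0 ?indic_out ?mul0r//.
    case: cdw => _; apply => h; apply: xM; apply/(rV_norm_le _ M'0).
    rewrite -[x](addrK (s *: v)) (le_trans (ler_normB _ _))// lerD//.
      by apply/rV_norm_le => // i; rewrite (le_trans (h i))// ler_norm.
    by rewrite normrZ ler_piMl// ltW.
have := @derive_val _ _ _ _ _ _ _ d.
rewrite (_ : (fun s : R => _) = cst (\int[leb_rV]_x (w x * Psi x))); last first.
  apply/funext => s; have iP := integrable_mul_bounded iw mPsi PC.
  have := Rintegral_affine (s *: v) N0 iP; rewrite normr1 expr1n invr1 mul1r => <-.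
  by apply: eq_Rintegral => x _; rewrite scale1r Pinv.
rewrite derive_cst => h; rewrite [RHS]h; apply: eq_Rintegral => x _.
by rewrite scale0r addr0.
Qed.

Lemma csmooth_by_parts M N (u xi : E -> R) v : csmooth M u -> csmooth N xi ->
  \int[leb_rV]_x (u x * 'D_v xi x) = - \int[leb_rV]_x ('D_v u x * xi x).
Proof.
move=> cu cx; have [cdu cdx] := (csmooth_derive v cu, csmooth_derive v cx).
have prod_csmooth (f1 f2 : E -> R) M' : csmooth M' f1 -> smooth f2 -> csmooth M' (fun x => f1 x * f2 x).
  by move=> [s1 z1] s2; split; [exact: smoothM|move=> x /z1 ->; rewrite mul0r].
have i1 := csmooth_integrable (prod_csmooth _ _ _ cu cdx.1).
have i2 := csmooth_integrable (prod_csmooth _ _ _ cdu cx.1).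
apply/eqP; rewrite -addr_eq0 -(RintegralD measurableT i1 i2); apply/eqP.
have m1 : measurable_fun setT (fun _ : E => 1 : R) by exact: measurable_cst.
rewrite -[RHS](@integral_derive_invariant M _ (fun _ => 1) v 1 (prod_csmooth _ _ _ cu cx.1) m1)//; last first.
  by move=> x; rewrite normr1.
apply: eq_Rintegral => x _; rewrite mulr1.
have d1 := smooth_is_derive x v cu.1; have d2 := smooth_is_derive x v cx.1.
have := @derive_val _ _ _ _ _ _ _ (is_deriveM d1 d2).
move=> ->; rewrite /GRing.scale /=; ring.
Qed.

End translation_invariance.

(** * The field is a gradient *)

Lemma eq0_small_sqr (R : realType) (a D : R) :
  (forall e, 0 < e -> a ^+ 2 <= D * e) -> a = 0.
Proof.
move=> h; apply/eqP; rewrite -sqrf_eq0; apply/eqP/le_anti; rewrite sqr_ge0 andbT.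
rewrite leNgt; apply/negP => a0.
have D1 : 0 < `|D| + 1 by rewrite ltr_wpDl.
have e0 : 0 < a ^+ 2 / (`|D| + 1) / 2 by rewrite !divr_gt0.
have := h _ e0; rewrite leNgt => /negP; apply.
apply: (@le_lt_trans _ _ ((`|D| + 1) * (a ^+ 2 / (`|D| + 1) / 2))).
  apply: ler_wpM2r; first exact: ltW.
  by rewrite (le_trans (ler_norm D))// lerDl.
rewrite mulrA mulrCA divff ?gt_eqF// mulr1; lra.
Qed.

Lemma test_partial0 (R : realType) n (Omega : set 'rV[R]_n) eta i x :
  test_function Omega eta -> ~ Omega x -> partial i eta x = 0.
Proof.
move=> [_ _ eO] Ox.
apply: (@derive_eq0_open _ _ (~` closure [set x | eta x != 0])).
- by rewrite openC; exact: closed_closure.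
- move=> y Sy; apply/eqP; apply: contra_notT Sy => ey; exact: subset_closure.
- by move=> /eO.
Qed.

Section gradient.
Context {R : realType} {m : nat}.
Local Notation E := 'rV[R]_m.+2.
Local Notation nsq u := (sqnorm (@leb_rV R m.+2) u%R).

Variables (Omega V : set E) (f : E -> E) (M0 : R).
Hypotheses (oO : open Omega) (cO : convex_set Omega) (M00 : 0 < M0)
  (OM : Omega `<=` cube M0).
Hypothesis fL2 : in_L2_field Omega f.
Hypotheses (oV : open V) (VO : V `<=` Omega).
Variable x0 : E.
Hypothesis Vx0 : V x0.

Let ft i : E -> R := (fun x => f x ord0 i) \_ Omega.

Hypothesis df0 : forall i j, vanishes_on V
  (exterior_derivative (zero_ext_distribution Omega f) i j).
Hypothesis Xf0 : forall psi, line_test_function (lines_meeting V) psi ->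
  Xray1 (zero_ext_distribution Omega f) psi = 0.

Let mft i : measurable_fun setT (ft i).
Proof. by have [] := (in_L2P _ _).1 (fL2 i). Qed.

Let nft i : (nsq (ft i) < +oo)%E.
Proof. by have [] := (in_L2P _ _).1 (fL2 i). Qed.

Let ft0 i x : ~ cube M0 x -> ft i x = 0.
Proof. by move=> xM; rewrite /ft patchE memNset// => /OM. Qed.

Let ift i : leb_rV.-integrable setT (EFin \o ft i).
Proof. exact: sqnorm_integrable (mft i) (nft i) (@ft0 i). Qed.

Let g (e : R) i := conv (ft i) (mollifier e).

Let cg e i : 0 < e -> csmooth (M0 + e) (g e i).
Proof.
by move=> e0; apply: csmooth_conv; [exact: ift|exact: csmooth_mollifier|exact: ft0].
Qed.

Let closed_g : exists2 r : R, 0 < r & forall e, 0 < e -> e < r ->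
  forall x i j, partial i (g e j) x = partial j (g e i) x.
Proof.
have /nbhs_ballP[r /= r0 rV] := open_nbhs_nbhs (conj oV Vx0).
exists (r / 4); first exact: divr_gt0.
move=> e e0 er x i j.
have V3 y : `|y - x0| < 3 * e -> V y.
  by move=> h; apply: rV; rewrite -ball_normE /= distrC; lra.
apply: (@closed_everywhere R _ (M0 + e) e (g e) x0 e0).
- by move=> k; exact: cg.
- move=> y yx k l; apply: (@closed_mollified R _ V ft e y e0 ift) => [z zy|k' l'].
    apply: V3; rewrite -[z](subrK y) -addrA (le_lt_trans (ler_normD _ _))//; lra.
  exact: df0.
move=> y yx v v0.
apply: (@rays_vanish R _ V ft M0 e y M00 e0 ift ft0 _ _ v v0) => [z zy|psi].
  apply: V3; rewrite -[z](subrK y) -addrA (le_lt_trans (ler_normD _ _))//; lra.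
by move/Xf0.
Qed.

(** The potentials of the mollifications of [f] are supported in a thin neighbourhood of
    [Omega]; dilated copies of them are test functions of [Omega]. *)
Let approximation (e : R) : 0 < e -> exists2 eta : E -> R, test_function Omega eta &
  forall i, (nsq (fun x => ft i x - partial i eta x) <= e%:E)%E.
Proof.
move=> e0.
have [p0 Oo] : Omega !=set0 by exists x0; exact: VO.
have /nbhs_ballP[r r0' rO] := open_nbhs_nbhs (conj oO Oo); have r0 : 0 < r := r0'.
have hr y : `|y - p0| < r -> Omega y.
  by move=> h; apply: rO; rewrite -ball_normE /= distrC.
have [rc rc0 hc] := closed_g.
have /choice[delta hd] i : exists delta : R, 0 < delta /\
    forall (c : R) (b : E) (r : R),
    1 <= c -> c < 1 + delta -> `|b| < delta -> 0 < r -> r < delta ->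
    (nsq (fun x => conv (ft i) (mollifier r) (c *: x + b) - ft i x) <= e%:E)%E.
  by have [d d0 h] := mollify_affine M00 (mft i) (nft i) (@ft0 i) e0; exists d.
pose d := \big[Num.min/1]_(i < m.+2) delta i.
have d0 : 0 < d by apply: lt_bigmin => [|i _]; [exact: ltr01|case: (hd i)].
have dd i : d <= delta i by exact: bigmin_le_cond.
have o1 : 0 < `|p0| + 1 by rewrite ltr_wpDl.
pose s := d / (`|p0| + 1) / 2; have s0 : 0 < s by rewrite !divr_gt0.
pose lambda := 1 + s; have l1 : 1 < lambda by rewrite ltrDl.
have so : s * (`|p0| + 1) < d.
  rewrite /s mulrAC divfK ?gt_eqF//; lra.
have sd : s < d.
  apply: le_lt_trans so; rewrite ler_peMr ?(ltW s0)// lerDr//.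
pose b : E := (1 - lambda) *: p0.
have bd : `|b| < d.
  rewrite normrZ /lambda opprD addNKr normrN (gtr0_norm s0).
  by apply: le_lt_trans so; rewrite ler_wpM2l ?(ltW s0)// lerDl.
pose q := Num.min (Num.min rc d) (r * s) / 4.
have q0 : 0 < q by rewrite divr_gt0// !lt_min rc0 d0 mulr_gt0.
have mn : q < Num.min (Num.min rc d) (r * s).
  have : 0 < Num.min (Num.min rc d) (r * s) by rewrite !lt_min rc0 d0 mulr_gt0.
  rewrite /q; lra.
have mn2 : 2 * q < Num.min (Num.min rc d) (r * s).
  have : 0 < Num.min (Num.min rc d) (r * s) by rewrite !lt_min rc0 d0 mulr_gt0.
  rewrite /q; lra.
have [qc qd] : q < rc /\ q < d by move: mn; rewrite !lt_min => /andP[/andP[]].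
have qr : 2 * q < r * (lambda - 1).
  by move: mn2; rewrite !lt_min /lambda addrC addKr => /andP[].
have Mq : 0 <= M0 + q by rewrite addr_ge0 ?ltW.
have cgq i : csmooth (M0 + q) (g q i) by exact: cg.
have clq := hc q q0 qc.
have gS x : ~ thicken Omega q x -> g q ord0 x = 0 by exact: conv_thicken.
pose phi := potential (g q).
have sphi : smooth phi := smooth_potential cgq clq.
have phi0 x : ~ thicken Omega q x -> phi x = 0.
  apply: (potential_support Mq cgq clq gS) => y a b' a0 b0.
  exact: thicken_line.
pose A (x : E) := lambda *: x + b.
pose eta x := lambda^-1 * phi (A x).
have cA : continuous A by exact: continuous_affine.
have AL (x v : E) (h : R) : A (x + h *: v) = A x + h *: (lambda *: v).
  by rewrite /A scalerDr scalerA mulrC -scalerA addrAC.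
have sA : smooth (phi \o A) := smooth_comp_affine (L := fun v => lambda *: v) cA AL sphi.
have seta : smooth eta by exact: smoothZ.
have l0 : lambda != 0 by rewrite gt_eqF// (lt_trans ltr01).
have deta i x : partial i eta x = g q i (A x).
  have -> : partial i eta x = lambda^-1 * 'D_(delta_mx ord0 i) (phi \o A) x.
    have dA := smooth_is_derive x (delta_mx ord0 i) sA.
    exact: (@derive_val _ _ _ _ _ _ _ (is_deriveZ lambda^-1 dA)).
  rewrite (@derive_comp_affine R _ _ A (fun v => lambda *: v) phi x _ AL).
  rewrite (smooth_deriveZ _ _ _ sphi) mulrA mulVf// mul1r.
  rewrite (@derive_val _ _ _ _ _ _ _ (is_derive_potential cgq clq (A x) (delta_mx ord0 i))).
  rewrite /along (bigD1 i)//= big1 ?addr0 => [|j ji]; first by rewrite mxE !eqxx mul1r.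
  by rewrite mxE (negbTE ji) andbF mul0r.
have etaS x : eta x != 0 -> thicken Omega q (A x).
  by move=> ex; apply: contrapT => /phi0 h; move: ex; rewrite /eta h mulr0 eqxx.
have thickO x : thicken Omega (2 * q) (A x) -> Omega x by exact: (thicken_dilation cO hr l1 qr).
have etaO : closure [set x | eta x != 0] `<=` Omega.
  move=> x Sx; apply: thickO.
  have ql : 0 < q / lambda by rewrite divr_gt0// (lt_trans ltr01).
  have [y [/etaS[z Oz yz] xy]] := Sx _ (nbhsx_ballx x _ ql).
  exists z => //; move: xy; rewrite -ball_normE /= => xy.
  have -> : A x - z = lambda *: (x - y) + (A y - z).
    by apply/rowP => i; rewrite !mxE; ring.
  rewrite (le_trans (ler_normD _ _))// mulr_natl mulr2n lerD// normrZ.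
  rewrite gtr0_norm ?(lt_trans ltr01)// mulrC -ler_pdivlMr ?(lt_trans ltr01)//.
  exact: ltW.
have teta : test_function Omega eta.
  apply: (@csmooth_test_function _ _ M0) => //; split => // x xM.
  apply/eqP; apply: contra_notT xM => ex; apply: OM; apply: etaO.
  exact: subset_closure.
exists eta => // i; have [di0 hi] := hd i.
rewrite (_ : nsq _ = nsq (fun x => conv (ft i) (mollifier q) (lambda *: x + b) - ft i x)).
  apply: hi; [exact: ltW| | |exact: q0|].
  - by rewrite /lambda ltrD2l (lt_le_trans sd).
  - exact: lt_le_trans (dd i).
  - exact: lt_le_trans (dd i).
by apply: eq_integral => x _; rewrite deta -[in LHS]sqrrN opprB.
Qed.

Let d0 : E := delta_mx ord0 ord0.
Let T := 2 * M0 + 1.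
Let T0 : 0 < T. Proof. by rewrite /T; move: M00; lra. Qed.
Let phi := primitive T d0 (ft ord0).

Let test_cube eta : test_function Omega eta -> csmooth M0 eta.
Proof.
move=> [seta _ eO]; split=> // x xM; apply/eqP; apply: contra_notT xM => ex.
by apply: OM; apply: eO; exact: subset_closure.
Qed.

Let test_primitive eta x : test_function Omega eta -> cube M0 x ->
  primitive T d0 (partial ord0 eta) x = eta x.
Proof.
move=> /test_cube ce xM.
have d0_neq0 : d0 != 0.
  by apply/eqP => /matrixP/(_ ord0 ord0)/eqP; rewrite !mxE !eqxx /= oner_eq0.
rewrite -[RHS](half_line_FTC x ce d0_neq0); apply: eq_Rintegral => t _.
rewrite mulrC /half_window /half_line.
have [tT|tT] := leP (- T) t; first by [].
rewrite mul0r (_ : 'D_d0 eta _ = 0) ?mulr0//.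
case: (csmooth_derive d0 ce) => _; apply => /(_ ord0).
rewrite !mxE !eqxx mulr1 leNgt => /negP; apply.
have := xM ord0; rewrite ler_norml => /andP[_ h].
rewrite -normrN (lt_le_trans _ (ler_norm _))//.
by move: tT h; rewrite /T; lra.
Qed.

Let potential_approximation : exists2 K : R, 0 < K &
  measurable_fun setT phi /\
  forall eta, test_function Omega eta ->
    (nsq ((phi \- eta) \_ Omega) <=
     K%:E * nsq (fun x => ft ord0 x - partial ord0 eta x))%E.
Proof.
have [K K0 hK] := sqnorm_primitive M0 d0 T0; exists K => //.
split; first exact: measurable_primitive.
move=> eta teta; have ce := test_cube teta.
have cde : csmooth M0 (partial ord0 eta) := csmooth_derive _ ce.
have h := hK _ _ (mft ord0) (nft ord0) (@ft0 ord0) cde.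
have mO := open_measurable_rV oO.
have mphi := measurable_primitive T d0 (mft ord0).
apply: le_trans h; apply: le_sqnorm.
- apply/(measurable_restrictT _ mO); apply: measurable_funTS.
  exact: measurable_funB mphi (smooth_measurable ce.1).
- exact: measurable_funB mphi (measurable_primitive _ _ (smooth_measurable cde.1)).
move=> x; rewrite patchE; case: ifPn; last by rewrite normr0.
by rewrite inE => Ox; rewrite test_primitive//; exact: OM.
Qed.

Let phiO : measurable_fun setT (phi \_ Omega) /\ (nsq (phi \_ Omega) < +oo)%E.
Proof.
have [K K0 [mphi hK]] := potential_approximation.
have mO := open_measurable_rV oO.
have mres (u : E -> R) : measurable_fun setT u -> measurable_fun setT (u \_ Omega).
  by move=> mu_; apply/(measurable_restrictT _ mO); exact: measurable_funTS.
split; first exact: mres.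
have [eta teta he] := approximation ltr01; have ce := test_cube teta.
have me := smooth_measurable ce.1.
rewrite (_ : phi \_ Omega = (fun x => ((phi \- eta) \_ Omega) x + eta x)); last first.
  apply/funext => x; rewrite !patchE; case: ifPn => [_|]; first by rewrite /= subrK.
  move=> /negP; rewrite inE => Ox; rewrite add0r; apply/esym/eqP.
  apply: contra_notT Ox => ex; case: teta => _ _; apply; exact: subset_closure.
apply: (le_lt_trans (sqnormD _ (mres _ (measurable_funB mphi me)) me)).
rewrite lte_mul_pinfty// lte_add_pinfty//.
  apply: (le_lt_trans (hK _ teta)); rewrite lte_mul_pinfty ?lee_fin ?ltW//.
  exact: le_lt_trans (he ord0) (ltry _).
have [C C0 hC] := csmooth_bounded ce.
have i2 : leb_rV.-integrable setT (EFin \o (fun x => eta x * eta x)).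
  exact: (integrable_mul_bounded (csmooth_integrable ce) me hC).
have /integrableP[_] := i2.
by rewrite (eq_integral (fun x => ((eta x) ^+ 2)%:E))// => x _; rewrite /= -expr2 ger0_norm// sqr_ge0.
Qed.

(** The potential is the primitive of the first component along the first coordinate:
    the primitive is bounded in mean square, so it is close to a test function whose
    first partial derivative is close to that component. All identities pass to the
    limit from these test functions. *)
Lemma gradient_of_H10 : exists phi, in_H10 Omega phi /\ weak_gradient Omega phi f.
Proof.
have [K K0 [mphi hK]] := potential_approximation; have [mO nO] := phiO.
have wg : weak_gradient Omega phi f.
  move=> i xi txi; have cx := test_cube txi; have cdx := csmooth_derive (delta_mx ord0 i) cx.
  rewrite /partial_distribution /zero_ext_distribution /regular_distribution -/(ft i).
  have [L L0 hL] := @sqnorm_bounded_pairing R m.+2 M0.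
  have [C1 C10 hC1] := csmooth_bounded cx; have [C2 C20 hC2] := csmooth_bounded cdx.
  have iphi : leb_rV.-integrable setT (EFin \o phi \_ Omega).
    apply: (sqnorm_integrable (M := M0) mO nO) => x xM; rewrite patchE memNset//.
    by move=> /OM.
  apply/esym/eqP; rewrite -subr_eq0 opprK; apply/eqP.
  apply: (@eq0_small_sqr _ _ (2 * (L * C2 ^+ 2 * K + L * C1 ^+ 2))) => e e0.
  have [eta teta he] := approximation e0; have ce := test_cube teta.
  have me := smooth_measurable ce.1; have mde := smooth_measurable (csmooth_derive (delta_mx ord0 i) ce).1.
  have mdx := smooth_measurable cdx.1; have mx := smooth_measurable cx.1.
  have i1 := integrable_mul_bounded (ift i) mx hC1.
  have i2 := integrable_mul_bounded iphi mdx hC2.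
  have i3 := integrable_mul_bounded (csmooth_integrable ce) mdx hC2.
  have i4 := integrable_mul_bounded (csmooth_integrable (csmooth_derive (delta_mx ord0 i) ce)) mx hC1.
  set a := \int[leb_rV]_x ((ft i x - partial i eta x) * xi x).
  set b := \int[leb_rV]_x (((phi \- eta) \_ Omega) x * partial i xi x).
  have -> : \int[leb_rV]_x (ft i x * xi x) + \int[leb_rV]_x ((phi \_ Omega) x * partial i xi x) = a + b.
    have -> : a = \int[leb_rV]_x (ft i x * xi x) - \int[leb_rV]_x (partial i eta x * xi x).
      rewrite -(RintegralB measurableT i1 i4); apply: eq_Rintegral => x _.
      by rewrite mulrBl.
    have -> : b = \int[leb_rV]_x ((phi \_ Omega) x * partial i xi x) - \int[leb_rV]_x (eta x * partial i xi x).
      rewrite -(RintegralB measurableT i2 i3); apply: eq_Rintegral => x _.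
      rewrite -mulrBl !patchE; case: ifPn => [//|].
      move=> /negP; rewrite inE => Ox; rewrite (_ : eta x = 0) ?subr0//.
      apply/eqP; apply: contra_notT Ox => ex; case: teta => _ _; apply.
      exact: subset_closure.
    rewrite [X in _ = _ + (_ - X)](csmooth_by_parts _ ce cx) opprK.
    by rewrite addrACA [X in _ = _ + X]addrC; ring.
  have ha : a ^+ 2 <= L * C1 ^+ 2 * e.
    have z x : ~ cube M0 x -> ft i x - partial i eta x = 0.
      move=> xM; rewrite ft0// (_ : partial i eta x = 0) ?subrr//.
      by case: (csmooth_derive (delta_mx ord0 i) ce) => _; apply.
    have := hL _ _ C1 (measurable_funB (mft i) mde) z mx hC1.
    move=> h; rewrite -lee_fin; apply: (le_trans h); rewrite [leRHS]EFinM.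
    apply: lee_wpmul2l; last exact: he.
    by rewrite lee_fin mulr_ge0 ?sqr_ge0 ?ltW.
  have hb : b ^+ 2 <= L * C2 ^+ 2 * K * e.
    have z x : ~ cube M0 x -> ((phi \- eta) \_ Omega) x = 0.
      by move=> xM; rewrite patchE memNset// => /OM.
    have mpe : measurable_fun setT ((phi \- eta) \_ Omega).
      apply/(measurable_restrictT _ (open_measurable_rV oO)); apply: measurable_funTS.
      exact: measurable_funB.
    have := hL _ _ C2 mpe z mdx hC2.
    move=> h; rewrite -mulrA -lee_fin; apply: (le_trans h); rewrite [leRHS]EFinM; apply: lee_wpmul2l.
      by rewrite lee_fin mulr_ge0 ?sqr_ge0 ?ltW.
    rewrite [leRHS]EFinM; apply: (le_trans (hK _ teta)); apply: lee_wpmul2l; last exact: he.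
    by rewrite lee_fin ltW.
  have := sqr_ge0 (a - b); rewrite sqrrB sqrrD; move: ha hb; rewrite mulr2n; lra.
exists phi; split => //; split; first by apply/in_L2P.
exists f; split => // e e0.
pose e' := Num.min (e ^+ 2) (e ^+ 2 / K) / 2.
have e20 : 0 < e ^+ 2 by rewrite exprn_gt0.
have m0 : 0 < Num.min (e ^+ 2) (e ^+ 2 / K) by rewrite lt_min e20 divr_gt0.
have e'0 : 0 < e' by rewrite divr_gt0.
have : e' < Num.min (e ^+ 2) (e ^+ 2 / K) by rewrite /e'; lra.
rewrite lt_min => /andP[h1 h2].
have [eta teta he] := approximation e'0; exists eta; split => //.
  apply/(L2_dist_lt _ _ _ e0); apply: (le_lt_trans (hK _ teta)).
  apply: (@le_lt_trans _ _ (K%:E * e'%:E)%E).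
    by apply: lee_wpmul2l; [rewrite lee_fin ltW|exact: he].
  by rewrite -EFinM lte_fin mulrC -ltr_pdivlMr.
move=> i; apply/(L2_dist_lt _ _ _ e0); apply: (@le_lt_trans _ _ e'%:E); last first.
  by rewrite lte_fin.
rewrite [leLHS](_ : _ = nsq (fun x => ft i x - partial i eta x)); first exact: he.
apply: eq_integral => x _; rewrite /ft !patchE; case: ifPn => [//|].
by move=> /negP; rewrite inE => Ox; rewrite (test_partial0 _ teta Ox) subrr.
Qed.

End gradient.

(** * The X-ray transform of a gradient *)

Lemma within_continuous_local (R : realType) (W : topologicalType) (K : set W) (f : W -> R) :
  (forall p, K p -> exists (U : set W) (h : W -> R),
     [/\ open U, U p, {for p, continuous h} & forall q, U q -> K q -> f q = h q]) ->
  {within K, continuous f}.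
Proof.
move=> loc; apply/subspace_continuousP => p Kp.
have [U [h [oU Up ch hE]]] := loc p Kp.
apply/cvgrPdist_lt => e e0; rewrite near_withinE.
have /cvgrPdist_lt/(_ e e0) hh := ch.
apply: filterS2 (open_nbhs_nbhs (conj oU Up)) hh => q Uq hq Kq.
by rewrite /from_subspace (hE p Up Kp) (hE q Uq Kq).
Qed.

Section line_test_functions.
Context {R : realType} {n : nat}.
Local Notation E := 'rV[R]_n.
Variables (G : set (E * E)) (psi : E * E -> R).
Hypothesis GL : G `<=` line_manifold.
Hypothesis tpsi : line_test_function G psi.

Let local_extension p : line_manifold p -> exists (U : set (E * E)) (h : E * E -> R),
  [/\ open U, U p, {for p, continuous h} & forall q, U q -> line_manifold q -> psi q = h q].
Proof.
case: tpsi => spsi _ _ /spsi[U [h [oU Up sh hE]]]; exists U, h; split => //.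
Transparent smooth_on.
by have [] := sh [::] p Up.
Opaque smooth_on.
Qed.

(** Relatively open preimages: around each line the test function extends to a
    continuous function. *)
Lemma measurable_line_test : measurable_fun setT (psi \_ line_manifold).
Proof.
apply/(measurable_restrictT _ measurable_line_manifold).
apply: (measurability _ (RGenOpens.measurableE R)) => _ [_ [a [b ->] <-]].
set I := (X in _ @^-1` X).
pose F := [set U : set (E * E) | open U /\ U `&` line_manifold `<=` psi @^-1` I].
rewrite (_ : _ `&` _ = line_manifold `&` \bigcup_(U in F) U).
  apply: measurableI; first exact: measurable_line_manifold.
  by apply: open_measurable_rV2; apply: bigcup_open => U [].
apply/seteqP; split => [p [Lp Ip]|p [Lp [U [_ UI] Up]]]; last first.
  by split => //; apply: UI.
split => //; have [U [h [oU Up ch hE]]] := local_extension Lp.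
have oI : open I by exact: interval_open.
have hp : nbhs p (h @^-1` I).
  by apply: ch; apply: open_nbhs_nbhs; split => //; rewrite -hE.
exists (interior (U `&` h @^-1` I)); last first.
  by apply: filterI => //; exact: open_nbhs_nbhs.
split; first exact: open_interior.
by move=> q [/interior_subset[Uq hq] Lq]; rewrite /= hE.
Qed.

Lemma line_test_bounded : exists C, forall p, `|(psi \_ line_manifold) p| <= C.
Proof.
have [_ cK KG] := tpsi; set K := closure _ in cK KG.
have K0 p : ~ K p -> (psi \_ line_manifold) p = 0.
  move=> Kp; rewrite patchE; case: ifPn => //; rewrite inE => Lp.
  by apply/eqP; apply: contra_notT Kp => pp; exact: subset_closure.
have [Kn|nK] := pselect (K !=set0); last first.
  by exists 0 => p; rewrite K0 ?normr0// => Kp; apply: nK; exists p.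
have cn : {within K, continuous (fun p => `|psi p|)}.
  apply: within_continuous_local => p Kp.
  have [U [h [oU Up ch hE]]] := local_extension (GL (KG p Kp)).
  exists U, (fun q => `|h q|); split => //.
    by apply: continuous_comp => //; exact: norm_continuous.
  by move=> q Uq Kq; rewrite hE//; exact: GL (KG q Kq).
have [c cM h] := compact_EVT_max Kn cK cn.
exists `|psi c| => p; have [Kp|/K0 ->] := pselect (K p); last by rewrite normr0.
rewrite patchE mem_set; last exact: GL (KG p Kp).
by apply: h; rewrite inE.
Qed.

End line_test_functions.

Section Xray_of_gradient.
Context {R : realType} {n : nat}.
Local Notation E := 'rV[R]_n.
Local Notation nsq u := (sqnorm (@leb_rV R n) u%R).
Variables (Omega : set E) (M0 : R).
Hypotheses (oO : open Omega) (M00 : 0 < M0) (OM : Omega `<=` cube M0).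

(** Tested against reflected mollifiers, [u] has mollifications that vanish on inner parts
    of [Omega]; these exhaust [Omega]. *)
Lemma weakly_zero (u : E -> R) : measurable_fun setT u -> (nsq u < +oo)%E ->
  (forall x, ~ Omega x -> u x = 0) ->
  (forall xi, test_function Omega xi -> \int[leb_rV]_x (u x * xi x) = 0) ->
  nsq u = 0%E.
Proof.
move=> m_u u2 u0 weak; pose K := inner_part Omega.
have mK k : measurable (K k) by exact: measurable_inner_part.
have uM x : ~ cube M0 x -> u x = 0 by move=> xM; apply: u0 => /OM.
have iu := sqnorm_integrable m_u u2 uM.
have hK k : (\int[leb_rV]_(x in K k) ((u x) ^+ 2)%:E = 0)%E.
  rewrite integral_mkcond.
  have -> : (\int[leb_rV]_x ((fun x => ((u x) ^+ 2)%:E) \_ (K k)) x =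
      nsq (fun x => u x * \1_(K k) x))%E.
    apply: eq_integral => x _; rewrite patchE indicE.
    by case: (x \in K k); rewrite ?mulr1 ?mulr0 ?expr0n.
  have muK : measurable_fun setT (fun x => u x * \1_(K k) x).
    by apply: measurable_funM => //; exact: measurable_indic.
  apply/eqP; rewrite eq_le sqnorm_ge0 andbT; apply/lee_addgt0Pr => e e0; rewrite add0e.
  have [delta d0 hd] := mollify_affine M00 m_u u2 uM e0.
  have k0 : 0 < k.+1%:R^-1 :> R by rewrite invr_gt0 ltr0n.
  pose r := Num.min delta k.+1%:R^-1 / 2.
  have mn0 : 0 < Num.min delta k.+1%:R^-1 by rewrite lt_min d0.
  have r0 : 0 < r by rewrite divr_gt0.
  have : r < Num.min delta k.+1%:R^-1 by rewrite /r; lra.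
  rewrite lt_min => /andP[rd rk].
  have d1 : 1 < 1 + delta by rewrite ltrDl.
  have b0 : `|0 : E| < delta by rewrite normr0.
  apply: le_trans (hd 1 0 r (lexx 1) d1 b0 r0 rd).
  apply: le_sqnorm => //.
    apply: measurable_funB => //; apply: measurableT_comp; last exact: measurable_fun_affine.
    exact: smooth_measurable (smooth_conv iu (csmooth_mollifier r0)).
  move=> x; have [Kx|Kx] := pselect (K k x); last by rewrite indic_out// mulr0 normr0.
  rewrite indic_in// mulr1 scale1r addr0 (_ : conv _ _ x = 0) ?sub0r ?normrN//.
  apply: weak; apply: mollifier_test_function => // y yx; apply: Kx.
  by rewrite -ball_normE /= distrC (le_lt_trans yx).
have nd : nondecreasing_seq K by move=> k l kl; apply/subsetPset; exact: inner_part_nd.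
have := @ge0_nondecreasing_set_cvg_integral _ _ _ K (fun x => ((u x) ^+ 2)%:E) (@leb_rV R n) nd mK.
have -> : (fun i => \int[leb_rV]_(x in K i) ((u x) ^+ 2)%:E)%E = cst 0%E.
  by apply/funext => k; exact: hK.
move=> h; have {}h := h (fun i => measurable_funTS (measurable_sqr m_u))
  (fun i x _ => ltac:(by rewrite lee_fin sqr_ge0)).
have := cvg_lim (@ereal_hausdorff R) h; rewrite lim_cst; last exact: ereal_hausdorff.
move=> ->; rewrite integral_mkcond; apply: eq_integral => x _; rewrite patchE.
case: ifPn => // /negP; rewrite inE => nKx; rewrite u0 ?expr0n//.
by move=> /(inner_part_cover oO)[k Kk]; apply: nKx; exists k.
Qed.

(** For a direction [theta] the field pairs as the derivative of [eta] along [theta]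
    against a function that is constant along [theta]. *)
Lemma Xray_of_test_gradient (psi : E * E -> R) (C : R) (eta : E -> R) M :
  measurable_fun setT (psi \_ line_manifold) ->
  (forall p, `|(psi \_ line_manifold) p| <= C) -> csmooth M eta ->
  \sum_i \int[leb_rV]_x (partial i eta x * Xray1_adjoint psi i x) = 0.
Proof.
move=> mpsi psiC ce.
have ide i : leb_rV.-integrable setT (EFin \o partial i eta).
  exact: csmooth_integrable (csmooth_derive _ ce).
rewrite (Xray_pairing mpsi psiC ide) Rintegral_eq0 ?mulr0// => y.
rewrite indicE; have [|_] := boolP (y \in polar_dom); last by rewrite mul0r.
rewrite inE => -[_ t1]; rewrite mul1r; set theta := direction y in t1 *.
have mPsi : measurable_fun setT (fun x => (psi \_ line_manifold) (line_through x theta)).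
  apply: (measurableT_comp mpsi); apply: measurable_line_through => //.
rewrite -[RHS](integral_derive_invariant (v := theta) ce mPsi (fun x => psiC _)).
  apply: eq_Rintegral => x _; congr (_ * _).
  by rewrite (smooth_derive_partial _ _ ce.1).
move=> x s; congr ((psi \_ line_manifold) (_, theta)).
have tt : dot theta theta = 1 by rewrite -enorm_sqr t1 expr1n.
have -> : dot (x + s *: theta) theta = dot x theta + s.
  rewrite -[s in RHS]mulr1 -tt /dot mulr_sumr -big_split; apply: eq_bigr => i _.
  by rewrite /= !mxE mulrDl mulrA.
by rewrite scalerDl opprD addrACA subrr addr0.
Qed.

(** The field agrees with the gradient of [phi] in mean square, hence is a limit of
    gradients of test functions; the adjoint transform is bounded. *)
Lemma Xray_of_gradient (V : set E) (f : E -> E) (phi : E -> R) (psi : E * E -> R) :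
  in_L2_field Omega f -> in_H10 Omega phi -> weak_gradient Omega phi f ->
  line_test_function (lines_meeting V) psi ->
  Xray1 (zero_ext_distribution Omega f) psi = 0.
Proof.
move=> fL2 [phiL2 [h [hL2 wh ah]]] wf tpsi.
have LV : @lines_meeting R n V `<=` line_manifold by move=> p [].
have mpsi := measurable_line_test tpsi; have [C psiC] := line_test_bounded LV tpsi.
have mX i := measurable_Xray1_adjoint mpsi psiC i.
have [B XB] := Xray1_adjoint_bounded mpsi psiC.
have mO := open_measurable_rV oO.
pose ft i : E -> R := (fun x => f x ord0 i) \_ Omega.
pose ht i : E -> R := (fun x => h x ord0 i) \_ Omega.
have F i := (in_L2P _ _).1 (fL2 i); have H i := (in_L2P _ _).1 (hL2 i).
have ft0 i x : ~ cube M0 x -> ft i x = 0 by move=> xM; rewrite /ft patchE memNset// => /OM.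
have ht0 i x : ~ cube M0 x -> ht i x = 0 by move=> xM; rewrite /ht patchE memNset// => /OM.
have ift i := sqnorm_integrable (F i).1 (F i).2 (@ft0 i).
have iht i := sqnorm_integrable (H i).1 (H i).2 (@ht0 i).
have [L L0 hL] := @sqnorm_bounded_pairing R n M0.
have fh i : nsq (fun x => ft i x - ht i x) = 0%E.
  apply: weakly_zero.
  - exact: measurable_funB (F i).1 (H i).1.
  - have mN : measurable_fun setT (fun x => (- 1) * ht i x).
      by apply: measurable_funM => //; exact: (H i).1.
    rewrite (_ : (fun x => _) = (fun x => ft i x + (- 1) * ht i x)); last first.
      by apply/funext => x; rewrite mulN1r.
    apply: (le_lt_trans (sqnormD _ (F i).1 mN)); rewrite lte_mul_pinfty// lte_add_pinfty//.
      exact: (F i).2.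
    rewrite sqnormZ; last exact: (H i).1.
    by rewrite sqrrN expr1n mul1e; exact: (H i).2.
  - by move=> x Ox; rewrite /ft /ht !patchE !memNset// subrr.
  move=> xi txi; have [M _ cx] := test_function_csmooth txi.
  have [C1 _ hC1] := csmooth_bounded cx; have mx := smooth_measurable cx.1.
  have i1 := integrable_mul_bounded (ift i) mx hC1.
  have i2 := integrable_mul_bounded (iht i) mx hC1.
  have e1 := wf i xi txi; have e2 := wh i xi txi.
  have e12 : \int[leb_rV]_x (ft i x * xi x) = \int[leb_rV]_x (ht i x * xi x).
    exact: etrans (esym e1) e2.
  have := RintegralB measurableT i1 i2; rewrite e12 subrr => <-.
  by apply: eq_Rintegral => x _; rewrite mulrBl.
have fhX i : \int[leb_rV]_x (ft i x * Xray1_adjoint psi i x) =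
    \int[leb_rV]_x (ht i x * Xray1_adjoint psi i x).
  have i1 := integrable_mul_bounded (ift i) (mX i) (XB i).
  have i2 := integrable_mul_bounded (iht i) (mX i) (XB i).
  apply/eqP; rewrite -subr_eq0 -(RintegralB measurableT i1 i2); apply/eqP.
  have z x : ~ cube M0 x -> ft i x - ht i x = 0 by move=> xM; rewrite ft0// ht0// subrr.
  have := hL _ _ B (measurable_funB (F i).1 (H i).1) z (mX i) (XB i).
  rewrite [X in (_ <= _ * X)%E](fh i) mule0 lee_fin => h1.
  apply: (@eq0_small_sqr _ _ 0) => e e0; rewrite mul0r; apply: le_trans h1.
  rewrite le_eqVlt; apply/orP; left; apply/eqP; congr (_ ^+ 2).
  by apply: eq_Rintegral => x _; rewrite mulrBl.
rewrite /Xray1 /zero_ext_distribution /regular_distribution.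
rewrite (eq_bigr (fun i => \int[leb_rV]_x (ht i x * Xray1_adjoint psi i x))); last first.
  by move=> i _; exact: fhX.
apply/eqP; rewrite -normr_le0; apply/ler_addgt0Pr => e e0; rewrite add0r.
pose D := (L * B ^+ 2 + 1) * (n%:R + 1).
have LB : 0 <= L * B ^+ 2 by rewrite mulr_ge0 ?sqr_ge0 ?ltW.
have LB1 : 0 < L * B ^+ 2 + 1 by rewrite ltr_wpDl.
have n1 : 0 < n%:R + 1 :> R by rewrite ltr_wpDl.
have e'0 : 0 < e / D by rewrite divr_gt0// mulr_gt0.
have [eta [teta _ he]] := ah _ e'0; have [M _ ce] := test_function_csmooth teta.
have bound i : `|\int[leb_rV]_x (ht i x * Xray1_adjoint psi i x) -
    \int[leb_rV]_x (partial i eta x * Xray1_adjoint psi i x)| <= (L * B ^+ 2 + 1) * (e / D).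
  have cde := csmooth_derive (delta_mx ord0 i) ce.
  have i1 := integrable_mul_bounded (iht i) (mX i) (XB i).
  have i2 := integrable_mul_bounded (csmooth_integrable cde) (mX i) (XB i).
  rewrite -(RintegralB measurableT i1 i2).
  have z x : ~ cube M0 x -> ht i x - partial i eta x = 0.
    by move=> xM; rewrite ht0// (test_partial0 _ teta) ?subrr// => /OM.
  have h1 := hL _ _ B (measurable_funB (H i).1 (smooth_measurable cde.1)) z (mX i) (XB i).
  have h2 : (nsq (fun x => ht i x - partial i eta x) <= ((e / D) ^+ 2)%:E)%E.
    have /(L2_dist_lt _ _ _ e'0)/ltW := he i; apply: le_trans.
    rewrite le_eqVlt; apply/orP; left; apply/eqP; apply: eq_integral => x _.
    rewrite /ht !patchE; case: ifPn => [//|].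
    by move=> /negP; rewrite inE => Ox; rewrite (test_partial0 _ teta Ox) subrr.
  rewrite -(@ler_pXn2r _ 2) ?nnegrE; [|by []|exact: normr_ge0|exact: mulr_ge0 (ltW LB1) (ltW e'0)].
  rewrite real_normK ?num_real//.
  apply: (@le_trans _ _ (L * B ^+ 2 * (e / D) ^+ 2)).
    rewrite -lee_fin; apply: le_trans.
      apply: le_trans h1; rewrite le_eqVlt; apply/orP; left; apply/eqP; congr ((_ ^+ 2)%:E).
      by apply: eq_Rintegral => x _; rewrite mulrBl.
    by rewrite [leRHS]EFinM; apply: lee_wpmul2l; [rewrite lee_fin|exact: h2].
  rewrite [leRHS]exprMn; apply: ler_wpM2r; first exact: sqr_ge0.
  rewrite expr2.
  move: LB; set c := L * B ^+ 2 => LB; nra.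
have -> : \sum_(i < n) \int[leb_rV]_x (ht i x * Xray1_adjoint psi i x) =
    \sum_(i < n) (\int[leb_rV]_x (ht i x * Xray1_adjoint psi i x) -
      \int[leb_rV]_x (partial i eta x * Xray1_adjoint psi i x)).
  by rewrite sumrB (Xray_of_test_gradient mpsi psiC ce) subr0.
rewrite (le_trans (ler_norm_sum _ _ _))//.
apply: (@le_trans _ _ (\sum_(i < n) (L * B ^+ 2 + 1) * (e / D))); first exact: ler_sum.
rewrite sumr_const card_ord -mulr_natl /D.
have -> : n%:R * ((L * B ^+ 2 + 1) * (e / ((L * B ^+ 2 + 1) * (n%:R + 1)))) = e * (n%:R / (n%:R + 1)).
  by field; rewrite !gt_eqF.
by rewrite ler_piMr ?(ltW e0)// ler_pdivrMr// mul1r lerDl.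
Qed.

End Xray_of_gradient.

Theorem theorem1p5 (R : realType) (n : nat) (Omega V : set 'rV[R]_n)
  (f : 'rV[R]_n -> 'rV[R]_n) :
  (2 <= n)%N ->
  smooth_convex_domain Omega -> bounded_set Omega ->
  in_L2_field Omega f ->
  open V -> V !=set0 -> V `<=` Omega ->
  (forall i j : 'I_n, vanishes_on V
     (exterior_derivative (zero_ext_distribution Omega f) i j)) ->
  (forall psi, line_test_function (lines_meeting V) psi ->
     Xray1 (zero_ext_distribution Omega f) psi = 0) <->
  (exists phi : 'rV[R]_n -> R, in_H10 Omega phi /\ weak_gradient Omega phi f).
Proof.
move=> n2 [oO _ _ cO _] bO fL2 oV [x0 Vx0] VO df0.
have [M0 M00 OM] := bounded_set_cube bO.
split => [Xf0|[phi [phiH wf]] psi tpsi]; last first.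
  exact: (Xray_of_gradient oO M00 OM fL2 phiH wf tpsi).
case: n n2 Omega V f oO cO bO fL2 oV x0 Vx0 VO df0 M0 M00 OM Xf0 => [//|[//|m]] _
  Omega V f oO cO bO fL2 oV x0 Vx0 VO df0 M0 M00 OM Xf0.
exact: (gradient_of_H10 oO cO M00 OM fL2 oV VO Vx0 df0 Xf0).
Qed.
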